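(* Let $d\in\{3,4,5\}$. Let $\mu$ be a probability measure on $\mathbb N=\{0,1,2,\dots\}$ and let $\theta,\eta$ be probability measures on $\mathbb Z^d$ such that: (i) $\mu$ has mean $1$ and finite variance, and $\mu\not\equiv\delta_1$; (ii) $\eta$ is aperiodic, irreducible, with mean $0$ and finite $(d+1)$-th moment; (iii) $\theta$ is symmetric, irreducible, with some finite exponential moments. Let $R_n$ be the set of points of $\mathbb Z^d$ visited by the branching random walk $(V_u)_{u\in\mathcal T^{IGW}}$ (offspring law $\mu$, jump law $\theta$) when $u$ runs over the first $n$ subtrees $\mathcal T_0,\dots,\mathcal T_{n-1}$ of the Galton-Watson forest $\mathcal T^{IGW}$. Then, almost surely under $\mathbb P_{\mu,\theta}$, as $n\to\infty$, $$\mathtt{cap}_\eta R_n=n^{\frac{d-2}{2}+o_{\tt as}(1)},$$ where $o_{\tt as}(1)$ denotes a quantity which converges to $0$ almost surely as $n\to\infty$.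
   Context: Capacity: for a finite set $A\subset\mathbb Z^d$, $\mathtt{cap}_\eta A:=\sum_{x\in A}\mathsf P^\eta_x(\tau_A^+=\infty)$, where under $\mathsf P^\eta_x$, $(S_n)_{n\ge0}$ is a random walk on $\mathbb Z^d$ with i.i.d. jumps of law $\eta$ started at $x$, and $\tau_A^+:=\inf\{n\ge1: S_n\in A\}$. For the random set $R_n$, this is the capacity of the realized set. Galton-Watson forest: let $(\mathcal T_n)_{n\ge0}$ be independent Galton-Watson trees with offspring law $\mu$ (each starts from one initial ancestor, and every particle independently has a number of children of law $\mu$). Take a fixed infinite ray (spine) $(w_n)_{n\ge0}$, where $w_{n-1}$ is regarded as the parent of $w_n$ for $n\ge1$, and attach $\mathcal T_n$ to $w_n$ so that $w_n$ is the root of $\mathcal T_n$. The resulting infinite tree, rooted at $\varnothing:=w_0$, is denoted $\mathcal T^{IGW}$. Branching random walk: attach to the edges of $\mathcal T^{IGW}$ i.i.d. random variables of law $\theta$, independent of $\mathcal T^{IGW}$. Put $V_\varnothing:=0$, and for $u\ne\varnothing$ let $V_u$ be the sum of the variables on the edges of the unique simple path from $\varnothing$ to $u$. $\mathbb P_{\mu,\theta}$ denotes the law of $(V_u)_{u\in\mathcal T^{IGW}}$. Finally $R_n:=\{V_u: u\in\bigcup_{j=0}^{n-1}\mathcal T_j\}$. Terminology: irreducible / aperiodic means that the random walk with that jump law is an irreducible / aperiodic Markov chain on $\mathbb Z^d$; symmetric means $\theta(x)=\theta(-x)$; ''some finite exponential moments'' means $\sum_x e^{\lambda|x|}\theta(x)<\infty$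 for some $\lambda>0$. *)

(* Defs.v *)
From HB Require Import structures.
From mathcomp Require Import all_boot all_order all_algebra.
From mathcomp Require Import all_classical all_reals all_analysis.

Set Implicit Arguments.
Unset Strict Implicit.
Unset Printing Implicit Defensive.

Import Order.TTheory GRing.Theory Num.Theory.
Import numFieldNormedType.Exports.

Local Open Scope classical_set_scope.
Local Open Scope ring_scope.

(* Z^d, as an alias of 'rV[int]_d so that it can carry the discrete
   sigma-algebra. *)
Definition Zd (d : nat) : Type := 'rV[int]_d.

HB.instance Definition _ (d : nat) := GRing.Zmodule.copy (Zd d) 'rV[int]_d.
HB.instance Definition _ (d : nat) := Countable.copy (Zd d) 'rV[int]_d.
HB.instance Definition _ (d : nat) := isPointed.Build (Zd d) 0.
HB.instance Definition _ (d : nat) :=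
  @isMeasurable.Build default_measure_display (Zd d)
    discrete_measurable discrete_measurable0
    discrete_measurableC discrete_measurableU.

Definition coord (d : nat) (x : Zd d) (i : 'I_d) : int :=
  (x : 'rV[int]_d) ord0 i.

Definition enorm (R : realType) (d : nat) (x : Zd d) : R :=
  Num.sqrt (\sum_(i < d) ((coord x i)%:~R : R) ^+ 2).

Section Moments.
Local Open Scope ereal_scope.

Definition offspring_mean (R : realType) (mu : probability nat R) : \bar R :=
  \int[mu]_k (k%:R : R)%:E.

Definition offspring_variance (R : realType) (mu : probability nat R) : \bar R :=
  \int[mu]_k (((k%:R - fine (offspring_mean mu)) ^+ 2)%R)%:E.

Definition mean_zero (R : realType) (d : nat) (nu : probability (Zd d) R) :=
  forall i : 'I_d, \int[nu]_x ((coord x i)%:~R : R)%:E = 0.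

Definition finite_moment (R : realType) (d : nat) (k : nat)
    (nu : probability (Zd d) R) :=
  \int[nu]_x ((enorm R x ^+ k)%R)%:E < +oo.

Definition exponential_moment (R : realType) (d : nat)
    (nu : probability (Zd d) R) :=
  exists2 lambda : R, (0 < lambda)%R &
    \esum_(x in [set: Zd d]) ((expR (lambda * enorm R x))%:E * nu [set x])
      < +oo.

Definition symmetric_law (R : realType) (d : nat) (nu : probability (Zd d) R) :=
  forall x : Zd d, nu [set x] = nu [set (- x)%R].

End Moments.

Section MarkovChain.
Local Open Scope ereal_scope.
Variables (R : realType) (E : choiceType).
Implicit Type p : E -> E -> \bar R.

Fixpoint transition p (n : nat) (x y : E) : \bar R :=
  if n is m.+1 then \esum_(z in [set: E]) (p x z * transition p m z y)
  else (x == y)%:R%:E.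

Definition irreducible_chain p :=
  forall x y : E, exists n : nat, 0 < transition p n x y.

(* Every state x has period gcd {n >= 1 | p^n(x, x) > 0} equal to 1 (the gcd
   of a possibly infinite set of positive integers being expressed through its
   common divisors). *)
Definition aperiodic_chain p :=
  forall (x : E) (k : nat),
    (forall n : nat, (0 < n)%N -> 0 < transition p n x x -> (k %| n)%N) ->
    k = 1%N.

End MarkovChain.

Definition walk_kernel (R : realType) (d : nat) (nu : probability (Zd d) R)
  (x y : Zd d) : \bar R := nu [set y - x].

Section Independence.
Local Open Scope ereal_scope.

Definition mutually_independent (dT : measure_display) (T : measurableType dT)
    (R : realType) (P : probability T R) (I : choiceType)
    (F : I -> set (set T)) :=
  forall (s : seq I) (A : I -> set T), uniq s ->
    (forall i : I, i \in s -> F i (A i)) ->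
    P (\bigcap_(i in [set` s]) A i) = \prod_(i <- s) P (A i).

Definition has_law (dT dE : measure_display) (T : measurableType dT)
    (E : measurableType dE) (R : realType) (P : probability T R)
    (nu : probability E R) (X : {RV P >-> E}) :=
  forall A : set E, measurable A -> distribution P X A = nu A.

End Independence.

Section Capacity.
Variables (dT : measure_display) (T : measurableType dT) (R : realType) (d : nat).

Definition iid_jumps (P : probability T R) (eta : probability (Zd d) R)
    (Y : nat -> {RV P >-> Zd d}) :=
  (forall k : nat, has_law eta (Y k)) /\
  mutually_independent P (fun k : nat => g_sigma_algebra_preimage (Y k)).

Definition walk (P : probability T R) (Y : nat -> {RV P >-> Zd d}) (x : Zd d)
  (n : nat) (w : T) : Zd d := x + \sum_(k < n) Y k w.

(* The set is the event { tau_A^+ = oo } for the walk started at x. The sum is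
   an esum so that no finiteness proof for A is needed; for finite A it is the
   finite sum. *)
Definition capacity (P : probability T R) (Y : nat -> {RV P >-> Zd d})
    (A : set (Zd d)) : \bar R :=
  \esum_(x in A) P [set w | forall n : nat, (1 <= n)%N -> ~ A (walk Y x n w)].

End Capacity.

(* Ulam-Harris labelling of the vertices of the forest: (j, u) is the vertex of
   T_j reached from its root w_j by the word u of child indices, read from the
   root. In particular w_j = (j, [::]). *)
Definition vertex : Type := (nat * seq nat)%type.

(* The Galton-Watson tree with nu v children at the vertex v. *)
Definition gw_tree (nu : seq nat -> nat) : set (seq nat) :=
  [set u | forall k : nat, (k < size u)%N -> (nth 0%N u k < nu (take k u))%N].

Section BranchingRandomWalk.
Variables (dT : measure_display) (T : measurableType dT) (R : realType) (d : nat).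

(* N v is the number of children of v inside its tree, X v the variable on the
   edge from the parent of v to v, the parent of w_j (j >= 1) being w_(j-1).
   Both families are indexed by all potential vertices; only the labels of
   vertices of the forest matter, and X (0, [::]) is never used. *)
Definition igw_brw (P : probability T R) (mu : probability nat R)
    (theta : probability (Zd d) R)
    (N : vertex -> {RV P >-> nat}) (X : vertex -> {RV P >-> Zd d}) :=
  [/\ forall v : vertex, has_law mu (N v),
      forall v : vertex, has_law theta (X v) &
      mutually_independent P
        (fun i : vertex + vertex =>
           match i with
           | inl v => g_sigma_algebra_preimage (N v)
           | inr v => g_sigma_algebra_preimage (X v)
           end)].

Definition position (P : probability T R) (X : vertex -> {RV P >-> Zd d})
    (w : T) (v : vertex) : Zd d :=
  \sum_(1 <= k < v.1.+1) X (k, [::]) w +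
  \sum_(0 <= k < size v.2) X (v.1, take k.+1 v.2) w.

(* R_n *)
Definition visited (P : probability T R) (N : vertex -> {RV P >-> nat})
    (X : vertex -> {RV P >-> Zd d}) (n : nat) (w : T) : set (Zd d) :=
  [set position X w v | v in
    [set v : vertex | (v.1 < n)%N /\ gw_tree (fun u => N (v.1, u) w) v.2]].

End BranchingRandomWalk.

(* Main.v *)
(** The proof is a second moment argument along the scales [n = 4 ^ k], where
    polynomial factors in [k] are affordable.

    Let [G] be the Green function of the [eta]-walk. An irreducible law on Z^d
    has [p_n <= C n ^ (- d / 2)], so the mean of [G] at the position of the
    [theta]-walk after [k] steps is at most [C k ^ (1 - d / 2)]. For every list
    [L] of points of a finite set [A], with repetitions, the maximum principle
    gives [|L| ^ 2 <= 4 cap A * \sum_(x, y in L) G (y - x)].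

    Lower bound: take for [L] the positions of the vertices of height less than
    [h ~ n / k ^ 2] in the first [n] trees. Their number concentrates around its
    mean, of order [n h], and, since conditionally on the trees [V_y - V_x] is
    a [theta]-walk at time the graph distance of [x] and [y], their mean energy
    is [O (n ^ (4 - (d - 2) / 2))].

    Upper bound: with high probability the first [n] trees have height at most
    [n k ^ 2], and then an exponential moment bound keeps all the positions in
    a cube of side [sqrt n] times a power of [k], whose capacity is of order
    [side ^ (d - 2)].

    All the exceptional events have probability [O (1 / k ^ 2)], and
    Borel-Cantelli concludes. *)

(* A critical tree has infinite mean progeny, so the vertices of the full trees cannot be counted by
   moments. Cut at height [h], the count has mean of order [n h] and variance [O(n h^3)], hence
   relative variance [O(h / n)]: the division by [k^2] makes this summable over the scales. With
   [s = (d - 2) / 2], the sum of [(a + b + 1)^(-s)] over two heights below [h] is [O(h^(2 - s))] as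
   soon as [s < 2], and this is where [d <= 5] enters. Then the pairs in one tree do not dominate
   the energy, and [(n h)^2 / n^(4 - s)] is [n^s] up to powers of [k]. The heat kernel bound is a
   comparison: some convolution power of an irreducible law dominates a multiple of the uniform law
   on the corners of a box, which is a product of lazy steps, and the binomial decay of these is
   transferred through a recursive inequality. Capacity is handled through escape probabilities up
   to a finite horizon, for which last exit identities hold by recursion; the horizon goes to
   infinity only at the end. *)
Require Import Defs.
From HB Require Import structures.
From mathcomp Require Import all_boot all_order all_algebra.
From mathcomp Require Import all_classical all_reals all_analysis.
From mathcomp Require Import measurable_realfun ring lra.
From mathcomp Require Import zify.

Set Implicit Arguments.
Unset Strict Implicit.
Unset Printing Implicit Defensive.

Import Order.TTheory GRing.Theory Num.Theory.
Import numFieldNormedType.Exports.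

Local Open Scope classical_set_scope.
Local Open Scope ring_scope.

(** * Countable sums and independence *)

Section CountableSums.
Local Open Scope ereal_scope.
Variable R : realType.

Lemma esum_ge_term (I : choiceType) (D : set I) (a : I -> \bar R) (i : I) :
  D i -> (forall j, D j -> 0 <= a j) -> a i <= \esum_(j in D) a j.
Proof.
move=> Di a0; apply: esum_ge; exists [set i].
  by split; [exact: finite_set1|move=> _ ->].
by rewrite fsbig_set1.
Qed.

(** The constant may be infinite. For a positive real one, [le_real] used with [k] and then with its
    inverse gives the two inequalities. *)
Lemma esumZl (I : choiceType) (D : set I) (c : \bar R) (a : I -> \bar R) :
  0 <= c -> (forall i, 0 <= a i) ->
  \esum_(i in D) (c * a i) = c * \esum_(i in D) a i.
Proof.
have le_real (k : R) (b : I -> \bar R) : (0 <= k)%R ->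
    (forall i, 0 <= b i) ->
    \esum_(i in D) (k%:E * b i) <= k%:E * \esum_(i in D) b i.
  move=> k0 b0; apply: ge_ereal_sup => _ [X [finX XD]] <-.
  rewrite -ge0_mule_fsumr//.
  by rewrite lee_wpmul2l ?lee_fin//; apply: ereal_sup_ubound; exists X.
move=> c0 a0; case: c c0 => [k||//]; last first.
  move=> _; have [a_eq0|] := pselect (forall i, D i -> a i = 0).
    rewrite (esum1 a_eq0) mule0; apply: esum1 => i Di.
    by rewrite a_eq0// mule0.
  move=> /existsNP[i /not_implyP[Di /eqP ai]].
  have ai0 : 0 < a i by rewrite lt0e ai a0.
  rewrite gt0_mulye; last first.
    by apply: lt_le_trans ai0 (esum_ge_term Di _) => j _.
  apply/eqP; rewrite -leye_eq -[leLHS](gt0_mulye ai0).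
  apply: (esum_ge_term (a := fun i => +oo * a i) Di) => j Dj.
  by rewrite mule_ge0// a0.
rewrite lee_fin le_eqVlt => /predU1P[<-|k0].
  by rewrite mul0e; apply: esum1 => i _; rewrite mul0e.
apply/eqP; rewrite eq_le; apply/andP; split; first exact: le_real (ltW k0) a0.
rewrite -[leRHS]mul1e -[1](_ : k%:E * k^-1%:E = 1); last first.
  by rewrite -EFinM divff// gt_eqF.
rewrite -muleA lee_pmul2l ?lte_fin// ?fin_num//.
rewrite [X in X <= _](_ : _ = \esum_(i in D) (k^-1%:E * (k%:E * a i))).
  by apply: le_real; [rewrite invr_ge0 ltW|move=> i;
    rewrite mule_ge0 ?a0// lee_fin ltW].
apply: eq_esum => i _; rewrite muleA -EFinM mulVf ?mul1e// gt_eqF//.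
Qed.

Lemma esumZr (I : choiceType) (D : set I) (c : \bar R) (a : I -> \bar R) :
  0 <= c -> (forall i, 0 <= a i) ->
  \esum_(i in D) (a i * c) = (\esum_(i in D) a i) * c.
Proof.
move=> c0 a0; rewrite muleC -esumZl//; apply: eq_esum => i _; exact: muleC.
Qed.

Lemma exchange_esum (I J : choiceType) (A : set I) (B : set J)
    (a : I -> J -> \bar R) : (forall i j, A i -> B j -> 0 <= a i j) ->
  \esum_(i in A) \esum_(j in B) a i j = \esum_(j in B) \esum_(i in A) a i j.
Proof.
move=> a0; rewrite esum_esum// esum_esum; last by move=> *; exact: a0.
rewrite (reindex_esum (B `*`` fun=> A) (A `*`` fun=> B) (fun x => (x.2, x.1)))//.
split => [[j i] [/= ? ?]//|[? ?] [? ?] _ _ [-> ->]//|[i j] [/= ? ?]].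
by exists (j, i).
Qed.

Lemma reindex_esumT (I J : choiceType) (e : I -> J) (a : J -> \bar R) :
  bijective e -> \esum_(j in [set: J]) a j = \esum_(i in [set: I]) a (e i).
Proof. by rewrite -setTT_bijective; exact: reindex_esum. Qed.

Lemma esum_indicator (I : choiceType) (x : I) (a : I -> \bar R) :
  (forall i, 0 <= a i) ->
  \esum_(i in [set: I]) ((i == x)%:R%:E * a i) = a x.
Proof.
move=> a0; rewrite (esumID [set x])/=; last first.
  by move=> i _; rewrite mule_ge0// lee_fin.
rewrite setTI esum_set1 ?eqxx ?mul1e// esum1 ?adde0// => i [_ /=].
by move=> /eqP/negPf ->; rewrite mul0e.
Qed.

Lemma esum_sub (I : choiceType) (A B : set I) (a : I -> \bar R) :
  A `<=` B -> \esum_(i in A) a i <= \esum_(i in B) a i.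
Proof.
move=> AB; apply: ge_ereal_sup => _ [X [finX XA]] <-.
by apply: ereal_sup_ubound; exists X => //; split => //; apply: subset_trans AB.
Qed.

Lemma esum_seq_le (I : choiceType) (s : seq I) (a : I -> \bar R) :
  uniq s -> (forall i, 0 <= a i) ->
  \sum_(i <- s) a i <= \esum_(i in [set: I]) a i.
Proof.
move=> us a0; apply: esum_ge; exists [set` s]; first by split.
by rewrite fsbig_seq.
Qed.

(** Bridge to the series over [nat], the form in which countable additivity is stated; an integer
    coding no element contributes 0. *)
Lemma esum_bigcup_pickle (I : countType) (a : I -> \bar R) :
  (forall i, 0 <= a i) ->
  \esum_(i in [set: I]) a i =
  \sum_(n <oo) (if unpickle n is Some i then
                  if pickle i == n then a i else 0 else 0).
Proof.
move=> a0; rewrite nneseries_esumT; last first.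
  by move=> n; case: unpickle => // i; case: ifP.
rewrite [RHS](esumID (range (@pickle I)))/=; last first.
  by move=> n _; case: unpickle => // i; case: ifP.
rewrite [X in _ + X]esum1 ?adde0; last first.
  move=> n [_ nr]; case: unpickle => // i; case: ifP => // /eqP ni.
  by exfalso; apply: nr; exists i.
rewrite setTI esum_image; last by move=> x y _ _; exact: pcan_inj (@pickleK I) _ _.
by apply: eq_esum => i _; rewrite pickleK eqxx.
Qed.

End CountableSums.

Section CountableRandomVariable.
Local Open Scope ereal_scope.
Variables (dT : measure_display) (T : measurableType dT) (R : realType).
Variables (P : {measure set T -> \bar R}) (E : countType) (X : T -> E).
Hypothesis mX : forall z, measurable (X @^-1` [set z]).

(** The partition by the values of [X], indexed by their codes so that sigma-additivity applies; the
    piece of an integer coding no value is empty. *)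
Let F (A : set T) (n : nat) : set T := A `&` [set w | pickle (X w) = n].

Let F_bigcup (A : set T) : A = \bigcup_n F A n.
Proof.
apply/seteqP; split => [w Aw|w [n _ []//]].
by exists (pickle (X w)).
Qed.

Let F_measurable (A : set T) n : measurable A -> measurable (F A n).
Proof.
move=> mA; apply: measurableI => //.
have [[z zn]|nz] := pselect (exists z : E, pickle z = n).
  rewrite (_ : [set _ | _] = X @^-1` [set z])//.
  apply/seteqP; split => w /=; last by move=> ->.
  by rewrite -zn => /(pcan_inj (@pickleK E)).
rewrite (_ : [set _ | _] = set0)//.
by apply/seteqP; split => w //= wn; apply: nz; exists (X w).
Qed.

Let F_trivIset (A : set T) : trivIset setT (F A).
Proof. by move=> i j _ _ [w [[_ <-] [_ <-]]]. Qed.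

Let F_pickle (A : set T) (f : set T -> \bar R) n : f set0 = 0 ->
  f (F A n) = if unpickle n is Some z then
      if pickle z == n then f (A `&` X @^-1` [set z]) else 0 else 0.
Proof.
move=> f0; case zE : unpickle => [z|].
  case: ifP => [/eqP zn|/eqP zn].
    congr f; congr (_ `&` _); apply/seteqP; split => w /=; last by move=> ->.
    by rewrite -zn => /(pcan_inj (@pickleK E)).
  rewrite (_ : F A n = set0)//; apply/seteqP; split => w //= [_ /= wn].
  by apply: zn; move: zE; rewrite -wn pickleK => -[<-].
rewrite (_ : F A n = set0)//; apply/seteqP; split => w //= [_ /= wn].
by move: zE; rewrite -wn pickleK.
Qed.

Lemma preimage_countable_measurable (B : set E) : measurable (X @^-1` B).
Proof.
rewrite (F_bigcup (X @^-1` B)); apply: bigcupT_measurable => n.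
have [[z zn Bz]|nz] := pselect (exists2 z : E, pickle z = n & B z).
  rewrite (_ : F _ n = X @^-1` [set z])//.
  apply/seteqP; split => w /=; last by rewrite /F/= => ->.
  by move=> [_]; rewrite /= -zn => /(pcan_inj (@pickleK E)).
rewrite (_ : F _ n = set0)//; apply/seteqP; split => w //= [Bw wn].
by apply: nz; exists (X w).
Qed.

Lemma measure_countable_partition (A : set T) : measurable A ->
  P A = \esum_(z in [set: E]) P (A `&` X @^-1` [set z]).
Proof.
move=> mA; rewrite esum_bigcup_pickle//.
rewrite {1}(F_bigcup A) measure_bigcup; [|by move=> *; exact: F_measurable|
  exact: F_trivIset].
apply: congr_lim; apply/funext => n; apply: congr_big_nat => // i _.
  by rewrite in_setT.
by rewrite F_pickle.
Qed.

Lemma integral_countable (A : set T) (g : E -> \bar R) : measurable A ->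
  (forall z, 0 <= g z) ->
  \int[P]_(w in A) g (X w) =
  \esum_(z in [set: E]) (g z * P (A `&` X @^-1` [set z])).
Proof.
move=> mA g0; rewrite esum_bigcup_pickle; last by move=> z; rewrite mule_ge0.
rewrite {1}(F_bigcup A) ge0_integral_bigcup//.
- apply: congr_lim; apply/funext => n; apply: eq_bigr => i _.
  rewrite (F_pickle A (f := fun B => \int[P]_(w in B) g (X w)))//; last first.
    by rewrite integral_set0.
  case: unpickle => // z; case: ifP => // _.
  rewrite (eq_integral (cst (g z))); last first.
    by move=> w; rewrite inE => -[_ /= ->].
  by rewrite integral_cst//; apply: measurableI.
- by move=> n; exact: F_measurable.
- rewrite -F_bigcup => _ B mB; apply: measurableI => //.
  exact: (preimage_countable_measurable (g @^-1` B)).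
Qed.

End CountableRandomVariable.

Section IndependentSigmaAlgebras.
Local Open Scope ereal_scope.
Variables (dT : measure_display) (T : measurableType dT) (R : realType).
Variable P : probability T R.

(** The events [B] satisfying the product formula form a Dynkin system, and the pi-system [G] lies
    in it by assumption. *)
Lemma independent_dynkin (A : set T) (G : set (set T)) :
  measurable A -> G `<=` measurable -> setI_closed G ->
  (forall B, G B -> P (A `&` B) = P A * P B) ->
  forall B, <<s G >> B -> P (A `&` B) = P A * P B.
Proof.
move=> mA mG GI GA B.
rewrite -(setI_closed_g_dynkin_g_sigma_algebra GI).
suff /(_ B) : <<d G >> `<=` [set B | measurable B /\ P (A `&` B) = P A * P B].
  by move=> + GB => /(_ GB)[].
apply: smallest_sub; last by move=> C GC; split; [exact: mG|exact: GA].
split => [|C [mC PC]|F tF FP].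
- by split => //; rewrite setIT probability_setT mule1.
- split; first exact: measurableC.
  have -> : A `&` ~` C = A `\` (A `&` C) by rewrite setDIr setDv set0U setDE.
  have PfA : P A \is a fin_num by exact: fin_num_measure.
  rewrite measureD//; last 2 first.
    exact: measurableI.
    by rewrite -ge0_fin_numE// fin_num_measure.
  transitivity (P A - P A * P C); first by rewrite -PC setIA setIid.
  rewrite [X in _ = _ * X]probability_setC//.
  by rewrite muleBr ?mule1.
- split; first by apply: bigcupT_measurable => n; case: (FP n).
  rewrite setI_bigcupr !measure_bigcup//.
  + have PfA : P A \is a fin_num by exact: fin_num_measure.
    rewrite -(fineK PfA) -nneseriesZl//; apply: congr_lim; apply/funext => n.
    by apply: eq_bigr => i _; rewrite fineK//; case: (FP i).
  + by move=> n _; case: (FP n).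
  + by move=> n _; apply: measurableI => //; case: (FP n).
  + move=> i j _ _ [w [[_ Fi] [_ Fj]]]; apply: tF => //.
    by exists w.
Qed.

Variables (I : choiceType) (F : I -> set (set T)).
Hypothesis F_indep : mutually_independent P F.
Hypothesis F_measurable : forall i, F i `<=` measurable.
Hypothesis F_setT : forall i, F i setT.
Hypothesis F_setI : forall i, setI_closed (F i).

Definition joint_sigma (S : set I) : set (set T) := <<s \bigcup_(i in S) F i >>.

(** Finite intersections of events of the families in [S]: a pi-system that generates
    [joint_sigma S]. *)
Let box (S : set I) : set (set T) := [set B | exists (s : seq I) (A : I -> set T),
  [/\ uniq s, forall i, i \in s -> S i, forall i, F i (A i) &
      B = \bigcap_(i in [set` s]) A i]].

Let box_measurable S : box S `<=` measurable.
Proof.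
move=> _ [s [A [us sS FA ->]]].
rewrite bigcap_seq; apply: bigsetI_measurable => i _.
exact: F_measurable (FA i).
Qed.

Let box_setI S : setI_closed (box S).
Proof.
move=> _ _ [s [A [us sS FA ->]]] [s' [A' [us' sS' FA' ->]]].
exists (undup (s ++ s')), (fun i => (if i \in s then A i else setT) `&`
   (if i \in s' then A' i else setT)); split.
- exact: undup_uniq.
- by move=> i; rewrite mem_undup mem_cat => /orP[/sS|/sS'].
- by move=> i; apply: F_setI; case: ifP.
- apply/seteqP; split => w /=.
    move=> [wA wA'] i /= _; split; first by case: ifP => // /wA.
    by case: ifP => // /wA'.
  move=> wAA'; split => i /= i_s.
    have /= := wAA' i; rewrite /= mem_undup mem_cat i_s => /(_ isT)[].
    by [].
  have /= := wAA' i; rewrite /= mem_undup mem_cat i_s orbT => /(_ isT)[_].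
  by [].
Qed.

Let joint_sigma_box S : joint_sigma S `<=` <<s box S >>.
Proof.
apply: smallest_sub; first exact: smallest_sigma_algebra.
move=> B [i Si FB]; apply: sub_gen_smallest.
exists [:: i], (fun j => if j == i then B else setT); split => //.
- by move=> j; rewrite inE => /eqP ->.
- by move=> j; case: eqP => // ->.
- by rewrite set_cons1 bigcap_set1 eqxx.
Qed.

Lemma joint_sigma_measurable S : joint_sigma S `<=` measurable.
Proof.
apply: smallest_sub; first exact: sigma_algebra_measurable.
by move=> B [i Si]; apply: F_measurable.
Qed.

(** Grouping of independent families. Two boxes over disjoint index sets concatenate into one box
    with distinct indices, where independence applies; Dynkin's argument then extends one factor at
    a time. *)
Lemma joint_sigma_independent (S S' : set I) (A B : set T) :
  S `&` S' = set0 -> joint_sigma S A -> joint_sigma S' B ->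
  P (A `&` B) = P A * P B.
Proof.
move=> SS' SA SB.
have box_indep C D : box S C -> box S' D -> P (C `&` D) = P C * P D.
  move=> [s [A1 [us sS FA ->]]] [s' [A2 [us' sS' FA' ->]]].
  have ss' i : i \in s -> i \in s' -> False.
    by move=> /sS Si /sS' Si'; have : (S `&` S') i by []; rewrite SS'.
  pose A12 i := if i \in s then A1 i else A2 i.
  have -> : \bigcap_(i in [set` s]) A1 i `&` \bigcap_(i in [set` s']) A2 i =
      \bigcap_(i in [set` s ++ s']) A12 i.
    apply/seteqP; split => w /=.
      move=> [wA wA'] i /=; rewrite mem_cat /A12.
      by case: ifPn => [i_s _|_ /= i_s']; [exact: wA|exact: wA'].
    move=> wA; split => i /= i_s.
      by have := wA i; rewrite /= mem_cat /A12 i_s; apply.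
    have := wA i; rewrite /= mem_cat /A12 i_s orbT => /(_ isT).
    by case: ifPn => // /ss' /(_ i_s).
  rewrite !F_indep//.
  - rewrite big_cat/=; congr (_ * _); apply: eq_big_seq => i i_s.
      by rewrite /A12 i_s.
    by rewrite /A12; case: ifPn => // /ss' /(_ i_s).
  - rewrite cat_uniq us us' andbT/=; apply/hasPn => i i_s'.
    by apply/negP => /ss' /(_ i_s').
  - by move=> i _; rewrite /A12; case: ifP.
have AD D : box S' D -> P (A `&` D) = P A * P D.
  move=> bD; rewrite setIC muleC.
  apply: (independent_dynkin (G := box S)).
  - exact: box_measurable bD.
  - exact: box_measurable.
  - exact: box_setI.
  - by move=> C bC; rewrite setIC muleC; exact: box_indep.
  - exact: joint_sigma_box SA.
apply: (independent_dynkin (G := box S')).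
- exact: joint_sigma_measurable SA.
- exact: box_measurable.
- exact: box_setI.
- exact: AD.
- exact: joint_sigma_box SB.
Qed.

Lemma joint_sigma_gen (S : set I) i (A : set T) : S i -> F i A -> joint_sigma S A.
Proof. by move=> Si FA; apply: sub_gen_smallest; exists i. Qed.

Lemma joint_sigmaS (S S' : set I) : S `<=` S' -> joint_sigma S `<=` joint_sigma S'.
Proof.
move=> SS'; apply: smallest_sub; first exact: smallest_sigma_algebra.
by move=> B [i /SS' Si FB]; exact: joint_sigma_gen FB.
Qed.

End IndependentSigmaAlgebras.

Section JointSigmaClosure.
Variables (dT : measure_display) (T : measurableType dT).
Variables (I : choiceType) (F : I -> set (set T)) (S : set I).
Let M := g_sigma_algebraType (\bigcup_(i in S) F i).

Lemma joint_sigma_setT : joint_sigma F S setT.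
Proof. exact: (@measurableT _ M). Qed.

Lemma joint_sigma_set0 : joint_sigma F S set0.
Proof. exact: (@measurable0 _ M). Qed.

Lemma joint_sigma_setI A B :
  joint_sigma F S A -> joint_sigma F S B -> joint_sigma F S (A `&` B).
Proof. exact: (@measurableI _ M). Qed.

Lemma joint_sigma_setC A : joint_sigma F S A -> joint_sigma F S (~` A).
Proof. exact: (@measurableC _ M). Qed.

Lemma joint_sigma_bigcup (D : set nat) (A : nat -> set T) :
  (forall n, D n -> joint_sigma F S (A n)) ->
  joint_sigma F S (\bigcup_(n in D) A n).
Proof. exact: (@bigcup_measurable _ M). Qed.

Lemma joint_sigma_bigcap (D : set nat) (A : nat -> set T) :
  (forall n, D n -> joint_sigma F S (A n)) ->
  joint_sigma F S (\bigcap_(n in D) A n).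
Proof.
move=> SA; rewrite -[X in joint_sigma _ _ X]setCK setC_bigcap.
by apply: joint_sigma_setC; apply: joint_sigma_bigcup => n Dn;
  apply: joint_sigma_setC; exact: SA.
Qed.

(** Events described through the value of a countable variable, as all the recursive ones below, are
    unions of this form. *)
Lemma joint_sigma_exists (J : countType) (D : set J) (A : J -> set T) :
  (forall j, D j -> joint_sigma F S (A j)) ->
  joint_sigma F S [set w | exists2 j, D j & A j w].
Proof.
move=> SA; rewrite (_ : [set _ | _] =
    \bigcup_n (if unpickle n is Some j then
      if pselect (D j) then A j else set0 else set0)).
  apply: joint_sigma_bigcup => n _; case: unpickle => [j|];
    last exact: joint_sigma_set0.
  by case: pselect => // Dj; [exact: SA|exact: joint_sigma_set0].
apply/seteqP; split => [w [j Dj Aj]|w [n _]].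
  by exists (pickle j) => //; rewrite pickleK; case: pselect.
by case: unpickle => // j; case: pselect => // Dj Ajw; exists j.
Qed.

End JointSigmaClosure.

(** * Convolution powers and heat kernel bounds *)

Section Convolution.
Local Open Scope ereal_scope.
Variables (R : realType) (d : nat).
Implicit Types (f g h : Zd d -> \bar R) (nu : probability (Zd d) R).

(** Values are extended reals, so that associativity and Fubini hold for nonnegative functions
    without summability conditions. *)
Definition convolution f g (z : Zd d) : \bar R :=
  \esum_(y in [set: Zd d]) (f y * g (z - y)%R).

Definition unit_mass (z : Zd d) : \bar R := (z == 0%R)%:R%:E.

Definition conv_power f n : Zd d -> \bar R := iter n (convolution f) unit_mass.

Definition total_mass f : \bar R := \esum_(z in [set: Zd d]) f z.

Definition mass_function nu (z : Zd d) : \bar R := nu [set z].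

Lemma unit_mass_ge0 z : 0 <= unit_mass z.
Proof. by rewrite lee_fin. Qed.

Lemma mass_function_ge0 nu z : 0 <= mass_function nu z.
Proof. exact: measure_ge0. Qed.

Lemma convolution_ge0 f g z : (forall y, 0 <= f y) -> (forall y, 0 <= g y) ->
  0 <= convolution f g z.
Proof. by move=> f0 g0; apply: esum_ge0 => y _; rewrite mule_ge0. Qed.

Lemma conv_power_ge0 f n z : (forall y, 0 <= f y) -> 0 <= conv_power f n z.
Proof.
move=> f0; elim: n z => [|n IH] z; first exact: unit_mass_ge0.
exact: convolution_ge0.
Qed.

Lemma total_mass_ge0 f : (forall y, 0 <= f y) -> 0 <= total_mass f.
Proof. by move=> f0; apply: esum_ge0. Qed.

Lemma eq_convolution f f' g g' : f =1 f' -> g =1 g' ->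
  convolution f g = convolution f' g'.
Proof. by move=> /funext -> /funext ->. Qed.

Lemma bijective_addr (z : Zd d) : bijective (fun y : Zd d => (y + z)%R).
Proof. by exists (fun y => y - z)%R => y; rewrite ?addrK ?subrK. Qed.

Lemma bijective_subr (z : Zd d) : bijective (fun y : Zd d => (z - y)%R).
Proof. by exists (fun y => z - y)%R => y; rewrite subKr. Qed.

Lemma convolutionC f g : convolution f g = convolution g f.
Proof.
apply/funext => z; rewrite /convolution (reindex_esumT _ (bijective_subr z)).
by apply: eq_esum => y _; rewrite subKr muleC.
Qed.

(* Transfer of a weighted sum to the product space, from which mass,
   associativity and moment computations all follow. *)
Lemma esum_convolution f g (k : Zd d -> \bar R) : (forall y, 0 <= f y) ->
  (forall y, 0 <= g y) -> (forall y, 0 <= k y) ->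
  \esum_(z in [set: Zd d]) (convolution f g z * k z) =
  \esum_(y in [set: Zd d]) (f y * \esum_(x in [set: Zd d]) (g x * k (x + y)%R)).
Proof.
move=> f0 g0 k0; transitivity (\esum_(z in [set: Zd d])
   \esum_(y in [set: Zd d]) (f y * (g (z - y)%R * k z))).
  apply: eq_esum => z _; rewrite /convolution -esumZr//; last first.
    by move=> y; rewrite mule_ge0.
  by apply: eq_esum => y _; rewrite muleA.
rewrite exchange_esum; last by move=> *; rewrite !mule_ge0.
apply: eq_esum => y _; rewrite esumZl//; last by move=> x; rewrite mule_ge0.
congr (_ * _); rewrite (reindex_esumT _ (bijective_addr y)).
by apply: eq_esum => x _; rewrite addrK.
Qed.

Lemma convolutionA f g h : (forall y, 0 <= f y) -> (forall y, 0 <= g y) ->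
  (forall y, 0 <= h y) ->
  convolution (convolution f g) h = convolution f (convolution g h).
Proof.
move=> f0 g0 h0; apply/funext => z.
have hz0 y : 0 <= h (z - y)%R by [].
apply: (etrans (esum_convolution f0 g0 hz0)).
apply: eq_esum => y _; congr (_ * _); apply: eq_esum => x _.
by congr (_ * h _); rewrite opprD addrCA addrC.
Qed.

Lemma convolution_unit f : (forall y, 0 <= f y) -> convolution unit_mass f = f.
Proof.
move=> f0; apply/funext => z.
by rewrite /convolution (esum_indicator 0%R (fun y => f0 (z - y)%R)) subr0.
Qed.

Lemma total_mass_unit : total_mass unit_mass = 1.
Proof.
rewrite /total_mass -[RHS](esum_indicator (0%R : Zd d) (fun=> @lee01 R)).
by apply: eq_esum => z _; rewrite mule1.
Qed.

Lemma total_mass_convolution f g : (forall y, 0 <= f y) -> (forall y, 0 <= g y) ->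
  total_mass (convolution f g) = total_mass f * total_mass g.
Proof.
move=> f0 g0; transitivity (\esum_(z in [set: Zd d]) (convolution f g z * 1)).
  by apply: eq_esum => z _; rewrite mule1.
rewrite esum_convolution// -esumZr//; last exact: total_mass_ge0.
by apply: eq_esum => y _; congr (_ * _); apply: eq_esum => x _; rewrite mule1.
Qed.

Lemma convolutionDl f f' g : (forall y, 0 <= f y) -> (forall y, 0 <= f' y) ->
  (forall y, 0 <= g y) ->
  convolution (fun y => f y + f' y) g = fun z => convolution f g z + convolution f' g z.
Proof.
move=> f0 f'0 g0; apply/funext => z; rewrite /convolution -esumD; last 2 first.
  by move=> *; rewrite mule_ge0.
  by move=> *; rewrite mule_ge0.
by apply: eq_esum => y _; rewrite ge0_muleDl.
Qed.

Lemma convolutionZr f g (c : \bar R) z : 0 <= c -> (forall y, 0 <= f y) ->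
  (forall y, 0 <= g y) ->
  convolution f (fun y => c * g y) z = c * convolution f g z.
Proof.
move=> c0 f0 g0; rewrite /convolution -esumZl//; last by move=> y; rewrite mule_ge0.
by apply: eq_esum => y _; rewrite muleCA.
Qed.

Lemma convolutionDr f g g' : (forall y, 0 <= f y) -> (forall y, 0 <= g y) ->
  (forall y, 0 <= g' y) ->
  convolution f (fun y => g y + g' y) = fun z => convolution f g z + convolution f g' z.
Proof.
move=> f0 g0 g'0; rewrite convolutionC convolutionDl//.
by rewrite !(convolutionC _ f).
Qed.

Lemma convolution_sumr (n : nat) f (g : 'I_n -> Zd d -> \bar R) z :
  (forall y, 0 <= f y) -> (forall i y, 0 <= g i y) ->
  convolution f (fun y => \sum_(i < n) g i y) z = \sum_(i < n) convolution f (g i) z.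
Proof.
move=> f0 g0; rewrite /convolution -esum_sum; last by move=> *; rewrite mule_ge0.
by apply: eq_esum => y _; rewrite ge0_sume_distrr.
Qed.

Lemma convolution_le_sup f g (B : \bar R) z : (forall y, 0 <= f y) -> 0 <= B ->
  (forall y, g y <= B) -> convolution f g z <= total_mass f * B.
Proof.
move=> f0 B0 gB; rewrite /total_mass -esumZr//.
by apply: le_esum => y _; rewrite lee_wpmul2l.
Qed.

Lemma le_convolution f f' g g' z : (forall y, 0 <= f y) ->  (forall y, 0 <= g y) ->
  (forall y, f y <= f' y) -> (forall y, g y <= g' y) ->
  convolution f g z <= convolution f' g' z.
Proof. by move=> f0 g0 ff' gg'; apply: le_esum => y _; rewrite lee_pmul. Qed.

Lemma conv_powerS f n : conv_power f n.+1 = convolution f (conv_power f n).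
Proof. by []. Qed.

Lemma conv_power1 f : (forall y, 0 <= f y) -> conv_power f 1 = f.
Proof. by move=> f0; rewrite conv_powerS convolutionC convolution_unit. Qed.

Lemma conv_powerD f m n : (forall y, 0 <= f y) ->
  conv_power f (m + n) = convolution (conv_power f m) (conv_power f n).
Proof.
move=> f0; have cf0 k y : 0 <= conv_power f k y by exact: conv_power_ge0.
elim: m => [|m IH]; first by rewrite convolution_unit.
by rewrite addSn !conv_powerS IH convolutionA.
Qed.

Lemma conv_powerSr f n : (forall y, 0 <= f y) ->
  conv_power f n.+1 = convolution (conv_power f n) f.
Proof. by move=> f0; rewrite -addn1 conv_powerD// conv_power1. Qed.

Lemma conv_powerM f m n : (forall y, 0 <= f y) ->
  conv_power f (m * n) = conv_power (conv_power f m) n.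
Proof.
move=> f0; elim: n => [|n IH]; first by rewrite muln0.
by rewrite mulnS conv_powerD// IH.
Qed.

Lemma total_mass_mass_function nu : total_mass (mass_function nu) = 1.
Proof.
rewrite -(probability_setT nu).
have mid (z : Zd d) : measurable (id @^-1` [set z]) by [].
rewrite (measure_countable_partition nu mid)//.
by apply: eq_esum => z _; rewrite setTI.
Qed.

Lemma total_mass_conv_power f n : (forall y, 0 <= f y) -> total_mass f = 1 ->
  total_mass (conv_power f n) = 1.
Proof.
move=> f0 f1; elim: n => [|n IH]; first exact: total_mass_unit.
by rewrite conv_powerS total_mass_convolution ?IH ?f1 ?mule1// => y;
  exact: conv_power_ge0.
Qed.

Lemma mass_le_total f z : (forall y, 0 <= f y) -> f z <= total_mass f.
Proof. by move=> f0; exact: esum_ge_term. Qed.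

Lemma transition_conv_power nu n x y :
  transition (walk_kernel nu) n x y = conv_power (mass_function nu) n (y - x)%R.
Proof.
have nu0 := mass_function_ge0 nu.
elim: n x => [|n IH] x /=; first by rewrite /unit_mass subr_eq0 eq_sym.
rewrite [RHS]/convolution (reindex_esumT _ (bijective_addr x)).
apply: eq_esum => z _; rewrite /walk_kernel addrK IH.
by rewrite opprD addrA addrAC.
Qed.

Lemma irreducible_conv_power nu z : irreducible_chain (walk_kernel nu) ->
  exists n, 0 < conv_power (mass_function nu) n z.
Proof.
move=> /(_ 0%R z)[n]; rewrite transition_conv_power subr0; by exists n.
Qed.

Lemma convolution_gt0 f g x y : (forall z, 0 <= f z) -> (forall z, 0 <= g z) ->
  0 < f x -> 0 < g y -> 0 < convolution f g (x + y)%R.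
Proof.
move=> f0 g0 fx gy; apply: (@lt_le_trans _ _ (f x * g (x + y - x)%R)).
  by rewrite mule_gt0// addrAC subrr add0r.
apply: (esum_ge_term (a := fun z => f z * g (x + y - z)%R)) => // z _.
by rewrite mule_ge0.
Qed.

Lemma conv_powerD_gt0 f m n x y : (forall z, 0 <= f z) ->
  0 < conv_power f m x -> 0 < conv_power f n y ->
  0 < conv_power f (m + n) (x + y)%R.
Proof.
by move=> f0 fx fy; rewrite conv_powerD//; apply: convolution_gt0 => // z;
  exact: conv_power_ge0.
Qed.

End Convolution.

(** * Inequalities between powers and their sums *)

Section PowerDecay.
Variable R : realType.
Implicit Types x y s t c : R.

Lemma powR_expR x s : 0 < x -> x `^ s = expR (s * ln x).
Proof. by move=> x0; rewrite /powR gt_eqF. Qed.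

Lemma ler_powRN x y s : 0 < x -> x <= y -> 0 <= s -> y `^ (- s) <= x `^ (- s).
Proof.
move=> x0 xy s0; have y0 : 0 < y by exact: lt_le_trans xy.
rewrite !powRN lef_pV2 ?posrE ?powR_gt0//.
by rewrite ge0_ler_powR// nnegrE ltW.
Qed.

Lemma powRN_ge_linear y s : 0 <= y -> 0 <= s -> 1 - s * y <= (1 + y) `^ (- s).
Proof.
move=> y0 s0; rewrite powR_expR; last by rewrite ltr_wpDr.
apply: le_trans (expR_ge1Dx _); rewrite lerD2l mulNr lerN2.
by rewrite ler_wpM2l// le_ln1Dx//; lra.
Qed.

Lemma powRN_le_half t q : 0 <= t <= 1 -> 1 <= q -> (1 + t) `^ (- q) <= 1 - t / 2.
Proof.
move=> /andP[t0 t1] q1; apply: (@le_trans _ _ (1 + t)^-1).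
  rewrite -powR_inv1; last lra.
  by apply: ler_powR; [lra|rewrite lerN2].
rewrite -div1r ler_pdivrMr; last lra.
nra.
Qed.

Lemma powRN_small s (e : R) : 0 < s -> 0 < e -> exists n : nat, n.+1%:R `^ (- s) <= e.
Proof.
move=> s0 e0; have x0 : 0 < e `^ (- s^-1) by exact: powR_gt0.
exists (Num.bound (e `^ (- s^-1))).
rewrite [leRHS](_ : e = (e `^ (- s^-1)) `^ (- s)); last first.
  by rewrite -powRrM mulrNN mulVf ?gt_eqF// powRr1// ltW.
apply: ler_powRN => //; last exact: ltW.
apply: ltW; apply: lt_trans (archi_boundP (ltW x0)) _.
by rewrite -natr1 ltrDl.
Qed.

Lemma ler_powRN_vanishing (a b c : R) s : 0 < s ->
  (forall n : nat, a <= b + c * n.+1%:R `^ (- s)) -> a <= b.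
Proof.
move=> s0 abc; rewrite leNgt; apply/negP => ba.
have M0 : 0 < `|c| + 1 by rewrite ltr_wpDl.
have gap : 0 < (a - b) / (2 * (`|c| + 1)) by rewrite divr_gt0 ?mulr_gt0 ?subr_gt0.
have [n] := powRN_small s0 gap; have := abc n; have := powR_ge0 (n.+1%:R : R) (- s).
move: (_ `^ _) => z z0 abz; rewrite ler_pdivlMr ?mulr_gt0// => zg.
have := ler_wpM2r z0 (ler_norm c); nra.
Qed.

(** After division by [x^(-q)], with [t = 1 / x], the left side is at most [1 - c t / 2] and the
    right side at least [1 - q (c t / (2 q))]: the shift [c / (2 q)] is the one for which these two
    bounds coincide. *)
Lemma powRN_supersolution c q x : 0 < c <= 1 -> 1 <= q -> 1 <= x ->
  c * (x + 1) `^ (- q) + (1 - c) * x `^ (- q) <= (x + c / (2 * q)) `^ (- q).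
Proof.
move=> /andP[c0 c1] q1 x1.
have x0 : 0 < x by lra.
have t01 : 0 <= x^-1 <= 1 by rewrite invr_ge0 ltW//= invf_le1.
have -> : x + 1 = x * (1 + x^-1) by field; lra.
have -> : x + c / (2 * q) = x * (1 + c / (2 * q) * x^-1).
  by field; apply/andP; split; lra.
have cq0 : 0 <= c / (2 * q) by rewrite divr_ge0; lra.
rewrite !powRM ?(ltW x0)//; last 2 first.
  by rewrite addr_ge0// mulr_ge0//; case/andP: t01.
  by case/andP: t01 => t0 _; lra.
have xq := powR_gt0 (- q) x0.
rewrite mulrCA (mulrC (1 - c)) -mulrDr ler_pM2l//.
apply: le_trans (powRN_ge_linear _ _); last 2 first.
  by rewrite mulr_ge0//; case/andP: t01.
  by lra.
have -> : q * (c / (2 * q) * x^-1) = c * (x^-1 / 2) by field; apply/andP; split; lra.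
have /(ler_wpM2l (ltW c0)) := powRN_le_half t01 q1.
by move: (_ `^ _) => z; lra.
Qed.

Lemma powR_increment_ge s (k : nat) : 0 < s <= 1 ->
  s / 2 * k.+1%:R `^ (s - 1) <= k.+1%:R `^ s - k%:R `^ s.
Proof.
move=> /andP[s0 s1]; have k0 : 0 < (k.+1%:R : R) by rewrite ltr0n.
have kinv0 : 0 < (k.+1%:R : R)^-1 by rewrite invr_gt0.
have kinv1 : (k.+1%:R : R)^-1 <= 1 by rewrite invf_le1// ler1n.
have -> : k.+1%:R `^ (s - 1) = k.+1%:R `^ s * (k.+1%:R : R)^-1.
  by rewrite powRD; [rewrite powR_inv1// ltW|rewrite (gt_eqF k0) implybT].
have -> : k%:R = k.+1%:R * (1 - (k.+1%:R : R)^-1).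
  by rewrite mulrBr mulr1 divff ?gt_eqF// -natr1 addrK.
rewrite powRM ?subr_ge0// ?(ltW k0)//.
set a := k.+1%:R `^ s; have a0 : 0 < a by exact: powR_gt0.
set u := k.+1%:R^-1 in kinv0 kinv1 *.
suff : (1 - u) `^ s <= 1 - s * u / 2 by nra.
have [u1|u1] := eqVneq u 1.
  by rewrite u1 subrr powR0 ?gt_eqF//; lra.
have ult1 : u < 1 by rewrite lt_neqAle u1.
have su : 0 <= s * u <= 1 by apply/andP; split; nra.
rewrite powR_expR; last lra.
have : expR (s * ln (1 - u)) <= expR (- (s * u)).
  by rewrite ler_expR -mulrN ler_pM2l// le_ln1Dx//; lra.
move=> /le_trans; apply.
rewrite expRN -div1r ler_pdivrMr ?expR_gt0//.
have := expR_ge1Dx (s * u); case/andP: su.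
by move: (s * u) (expR _) => v w *; nra.
Qed.

Lemma sum_powRN_le s (n : nat) : 0 < s <= 1 ->
  \sum_(k < n) k.+1%:R `^ (s - 1) <= 2 / s * n%:R `^ s :> R.
Proof.
move=> s01; have s0 : 0 < s by case/andP: s01.
elim: n => [|n IH].
  by rewrite big_ord0 mulr_ge0 ?powR_ge0// divr_ge0// ltW.
rewrite big_ord_recr/=; apply: le_trans (lerD IH (lexx _)) _.
rewrite -lerBrDl -mulrBr.
have := powR_increment_ge n s01.
move: (n.+1%:R `^ (s - 1)) (n.+1%:R `^ s - n%:R `^ s) => a b sab.
have -> : a = 2 / s * (s / 2 * a) by field; lra.
by rewrite ler_wpM2l// divr_ge0// ltW.
Qed.

Lemma powRN_decrement_ge s (m : nat) : 0 < s -> (0 < m)%N ->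
  s * m.+1%:R `^ (- (1 + s)) <= m%:R `^ (- s) - m.+1%:R `^ (- s).
Proof.
move=> s0 m0; have M0 : 0 < (m.+1%:R : R) by rewrite ltr0n.
have -> : m.+1%:R `^ (- (1 + s)) = m.+1%:R `^ (- s) * (m.+1%:R : R)^-1.
  rewrite opprD addrC powRD; first by rewrite powR_inv1// ltW.
  by rewrite (gt_eqF M0) implybT.
have u1 : (m.+1%:R : R)^-1 < 1 by rewrite invf_lt1// ltr1n.
have u0 : 0 < (m.+1%:R : R)^-1 by rewrite invr_gt0.
have -> : m%:R = m.+1%:R * (1 - (m.+1%:R : R)^-1).
  by rewrite mulrBr mulr1 divff ?gt_eqF// -natr1 addrK.
rewrite powRM ?subr_ge0 ?(ltW u1)// ?(ltW M0)//.
set a := m.+1%:R `^ _; have a0 : 0 < a by exact: powR_gt0.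
set u := m.+1%:R^-1 in u0 u1 *.
suff : 1 + s * u <= (1 - u) `^ (- s) by nra.
rewrite powR_expR; last lra.
apply: le_trans (expR_ge1Dx _) _; rewrite ler_expR mulNr -mulrN ler_pM2l//.
by rewrite lerNr le_ln1Dx//; lra.
Qed.

(** The terms with [m <= k] are equal and add up to at most [(k + 1)^(-s)]; the others telescope by
    [powRN_decrement_ge] and bring the factor [s^-1]. *)
Lemma sum_powRN_max_le s (k L : nat) : 0 < s ->
  \sum_(m < L) (maxn k m).+1%:R `^ (- (1 + s)) <= (1 + s^-1) * k.+1%:R `^ (- s) :> R.
Proof.
move=> s0; have K0 : 0 < (k.+1%:R : R) by rewrite ltr0n.
have head L' : (L' <= k.+1)%N ->
    \sum_(m < L') (maxn k m).+1%:R `^ (- (1 + s)) = L'%:R * k.+1%:R `^ (- (1 + s)) :> R.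
  move=> L'k; rewrite (eq_bigr (fun=> k.+1%:R `^ (- (1 + s)))).
    by rewrite sumr_const card_ord mulr_natl.
  move=> i _; congr (_.+1%:R `^ _); apply/maxn_idPl.
  by rewrite -ltnS (leq_trans (ltn_ord i)).
have headle : k.+1%:R * k.+1%:R `^ (- (1 + s)) = k.+1%:R `^ (- s) :> R.
  rewrite -{1}(powRr1 (ltW K0)) -powRD; last by rewrite (gt_eqF K0) implybT.
  by congr (_ `^ _); lra.
have [Lk|kL] := leqP L k.+1.
  rewrite head//; apply: (@le_trans _ _ (k.+1%:R * k.+1%:R `^ (- (1 + s)))).
    by rewrite ler_wpM2r ?powR_ge0// ler_nat.
  rewrite headle ler_peMl ?powR_ge0// lerDl invr_ge0 ltW//.
have tail j : \sum_(m < k.+1 + j) (maxn k m).+1%:R `^ (- (1 + s)) <=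
    (1 + s^-1) * k.+1%:R `^ (- s) - s^-1 * (k.+1 + j)%:R `^ (- s) :> R.
  elim: j => [|j IH].
    by rewrite addn0 head// headle mulrDl mul1r addrK.
  rewrite addnS big_ord_recr/=; apply: le_trans (lerD IH (lexx _)) _.
  have := @powRN_decrement_ge s (k.+1 + j) s0 isT.
  have -> : maxn k (k + j).+1 = (k.+1 + j)%N by apply/maxn_idPr; lia.
  move: (_ `^ (- (1 + s))) => z; rewrite -!addSn.
  move: ((k.+1 + j)%:R `^ _) ((k.+1 + j).+1%:R `^ _) => u v zuv.
  have -> : z = s^-1 * (s * z) by rewrite mulrA mulVf ?mul1r// gt_eqF.
  have : s^-1 * (s * z) <= s^-1 * (u - v) by rewrite ler_wpM2l// invr_ge0 ltW.
  by rewrite mulrBr; lra.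
rewrite -(subnKC (ltnW kL)); apply: le_trans (tail _) _.
by rewrite gerDl oppr_le0 mulr_ge0 ?powR_ge0// invr_ge0 ltW.
Qed.

End PowerDecay.

(** * Size of the central binomial coefficients *)

Section CentralBinomial.

Lemma central_bin_recl m :
  (m.+1 * 'C(m.+1.*2, m.+1) = 2 * (m.*2.+1 * 'C(m.*2, m)))%N.
Proof.
have E1 : (m.+1 * 'C(m.*2.+2, m.+1) = m.*2.+2 * 'C(m.*2.+1, m))%N.
  by rewrite -mul_bin_diag.
have E2 : (m.*2.+1 * 'C(m.*2, m) = m.+1 * 'C(m.*2.+1, m))%N.
  rewrite (mul_bin_down m.*2.+1 m); congr (_ * _)%N; lia.
rewrite doubleS E1 E2; lia.
Qed.

(** Squaring keeps [C(2m, m) <= 4^m / sqrt (2m + 1)] within the integers; the induction step reduces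
    to [(2m + 1) (2m + 3) <= (2m + 2)^2]. *)
Lemma central_bin_sqr_le m : ('C(m.*2, m) ^ 2 * m.*2.+1 <= 4 ^ m.*2)%N.
Proof.
elim: m => [|m IH]; first by [].
rewrite -(leq_pmul2l (_ : 0 < m.+1 ^ 2)%N) ?expn_gt0// mulnA -expnMn.
rewrite central_bin_recl doubleS.
have : ((m.*2.+1) * (m.*2.+3) <= 4 * m.+1 ^ 2)%N.
  by rewrite -!muln2; nia.
rewrite (expnS _ (m.*2.+1)) (expnS _ m.*2).
move: 'C(m.*2, m) (4 ^ m.*2)%N IH => c e IH H.
apply: (@leq_trans (4 * (c ^ 2 * m.*2.+1) * (m.*2.+1 * m.*2.+3))%N).
  by apply: eq_leq; rewrite !expnS !expn0 !muln1; ring.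
apply: (@leq_trans (4 * e * (4 * m.+1 ^ 2))%N); first by rewrite leq_mul// leq_mul.
by apply: eq_leq; ring.
Qed.

Lemma bin_le_central m k : ('C(m.*2, k) <= 'C(m.*2, m))%N.
Proof.
have low i : (i <= m -> 'C(m.*2, m - i) <= 'C(m.*2, m))%N.
  elim: i => [|i IH] im; first by rewrite subn0.
  apply: leq_trans (IH (ltnW im)).
  have := mul_bin_left m.*2 (m - i.+1).
  have -> : (m - i.+1).+1 = (m - i)%N by lia.
  move=> E; rewrite -(leq_pmul2l (_ : 0 < m - i)%N); last by lia.
  by rewrite E leq_mul2r; apply/orP; right; lia.
have [km|mk] := leqP k m; first by have := low (m - k)%N (leq_subr _ _); rewrite subKn.
have [k2m|] := leqP k m.*2; last by move=> /bin_small ->.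
rewrite -bin_sub//; have := low (k - m)%N.
have -> : (m - (k - m) = m.*2 - k)%N by lia.
by apply; lia.
Qed.

(** Odd rows reduce to even ones by Pascal's rule, at the price of the factor 2. *)
Lemma bin_sqr_le j m : ('C(j, m) ^ 2 * j.+1 <= 2 * 4 ^ j)%N.
Proof.
rewrite -(odd_double_half j); move: j./2 => h; case: (odd j) => /=; last first.
  rewrite add0n; apply: (@leq_trans (4 ^ h.*2)); last by rewrite leq_pmull.
  apply: leq_trans (central_bin_sqr_le h).
  by rewrite leq_mul2r leq_exp2r ?bin_le_central ?orbT.
have -> : ('C(1 + h.*2, m) ^ 2 * (1 + h.*2).+1 <= 2 * 4 ^ (1 + h.*2))%N =
   ('C(h.*2.+1, m) ^ 2 * h.*2.+2 <= 8 * 4 ^ h.*2)%N.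
  by rewrite !add1n (expnS 4) mulnA.
have le2 : ('C(h.*2.+1, m) <= 2 * 'C(h.*2, h))%N.
  case: m => [|m]; first by rewrite bin0 muln_gt0 bin_gt0 -addnn leq_addr.
  by rewrite binS mul2n -(addnn 'C(_, _)) leq_add// bin_le_central.
apply: (@leq_trans ((2 * 'C(h.*2, h)) ^ 2 * (h.*2.+1).*2)).
  by rewrite leq_mul ?leq_exp2r//; lia.
have := central_bin_sqr_le h; move: 'C(_, _) (4 ^ _)%N => c e H.
apply: (@leq_trans (8 * (c ^ 2 * h.*2.+1))); last by rewrite leq_mul2l H orbT.
by apply: eq_leq; rewrite -muln2 expnMn; ring.
Qed.

End CentralBinomial.

(** * Heat kernel bound by comparison with lazy walks *)

Section HeatKernel.
Variable R : realType.

(** Law at time [j] of the walk on the integers that stays or jumps by [k] with equal probabilities,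
    that is, of [k] times a binomial variable. *)
Fixpoint lazy_kernel (k : nat) (j : nat) (x : int) : R :=
  if j is i.+1 then (lazy_kernel k i x + lazy_kernel k i (x - k%:Z)) / 2
  else (x == 0)%:R.

Lemma lazy_kernel_ge0 k j x : 0 <= lazy_kernel k j x.
Proof.
elim: j x => [|j IH] x /=; first by rewrite ler0n.
by rewrite divr_ge0// addr_ge0.
Qed.

Lemma lazy_kernelE k j : (0 < k)%N ->
  (forall m : nat, lazy_kernel k j (k * m)%N%:Z = 'C(j, m)%:R / 2 ^+ j) /\
  (forall x, (forall m : nat, x != (k * m)%N%:Z) -> lazy_kernel k j x = 0).
Proof.
move=> k0; elim: j => [|j [IHm IH0]].
  split=> [m|x xm] /=; last by have /negPf := xm 0%N; rewrite muln0 => ->.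
  rewrite bin0n expr0 divr1 -(inj_eq (@intr_inj R)).
  by rewrite pnatr_eq0 muln_eq0 (gtn_eqF k0).
split => [m|x xm] /=.
  case: m => [|m].
    rewrite IHm IH0; last by move=> m; rewrite muln0; apply/eqP; lia.
    rewrite !bin0 exprS; field.
    by rewrite expf_eq0 pnatr_eq0 andbF.
  have -> : (k * m.+1)%N%:Z - k%:Z = (k * m)%N%:Z by rewrite mulnS; lia.
  rewrite !IHm binS natrD exprS; field.
  by rewrite expf_eq0 pnatr_eq0 andbF.
rewrite !IH0 ?addr0 ?mul0r// => m; apply/eqP => xk.
have /eqP := xm m.+1; apply; rewrite mulnS; lia.
Qed.

Lemma lazy_kernel_le k j x : (0 < k)%N ->
  lazy_kernel k j x <= 2 `^ 2^-1 * j.+1%:R `^ (- 2^-1).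
Proof.
move=> k0; have [Em E0] := lazy_kernelE j k0.
have [[m xm]|nm] := pselect (exists m : nat, x = (k * m)%N%:Z); last first.
  rewrite E0 ?mulr_ge0 ?powR_ge0// => m.
  by apply/eqP => xm; apply: nm; exists m.
rewrite xm Em; set b : R := _ / _; have b0 : 0 <= b by rewrite divr_ge0.
have -> : b = (b ^+ 2) `^ 2^-1.
  rewrite -powR_mulrn// -powRrM divff ?powRr1//.
have -> : j.+1%:R `^ (- 2^-1) = (j.+1%:R^-1) `^ 2^-1 :> R.
  by rewrite -[in RHS]powR_inv1// -powRrM mulN1r.
rewrite -powRM//; apply: ge0_ler_powR;
  rewrite ?nnegrE ?sqr_ge0 ?divr_ge0//.
rewrite expr_div_n ler_pdivrMr ?exprn_gt0// mulrAC ler_pdivlMr ?ltr0n//.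
rewrite -exprM mulnC exprM -[in leRHS](natrX _ 2 2) -!natrX -!natrM ler_nat.
exact: bin_sqr_le.
Qed.

Variable d : nat.

Definition lattice_corner (k : 'I_d -> nat) (e : {ffun 'I_d -> bool}) : Zd d :=
  (\row_i (if e i then (k i)%:Z else 0))%R.

Definition lazy_product (k : 'I_d -> nat) j (z : Zd d) : R :=
  \prod_(i < d) lazy_kernel (k i) j (Defs.coord z i).

Lemma coordB (x y : Zd d) i : Defs.coord (x - y) i = Defs.coord x i - Defs.coord y i.
Proof. by rewrite /Defs.coord !mxE. Qed.

Lemma coordD (x y : Zd d) i : Defs.coord (x + y) i = Defs.coord x i + Defs.coord y i.
Proof. by rewrite /Defs.coord !mxE. Qed.

Lemma coordN (x : Zd d) i : Defs.coord (- x) i = - Defs.coord x i.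
Proof. by rewrite /Defs.coord !mxE. Qed.

Lemma coord_inj (x y : Zd d) : Defs.coord x =1 Defs.coord y -> x = y.
Proof. by move=> xy; apply/rowP => i; exact: xy. Qed.

Lemma lattice_corner_inj k : (forall i, (0 < k i)%N) -> injective (lattice_corner k).
Proof.
move=> k0 e e' ee'; apply/ffunP => i; have := congr1 (fun z => Defs.coord z i) ee'.
rewrite /Defs.coord !mxE; have := k0 i.
by case: (e i); case: (e' i) => //; lia.
Qed.

Lemma lazy_product_ge0 k j z : 0 <= lazy_product k j z.
Proof. by apply: prodr_ge0 => i _; exact: lazy_kernel_ge0. Qed.

Lemma lazy_product0 k z : lazy_product k 0 z = (z == 0)%:R.
Proof.
rewrite /lazy_product /=; have [->|/eqP z0] := eqVneq z 0.
  by rewrite big1// => i _; rewrite /Defs.coord mxE eqxx.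
have [i zi] : exists i, Defs.coord z i != 0.
  apply: contrapT => nz; apply: z0; apply: coord_inj => i.
  by rewrite [RHS]mxE; apply/eqP/negP => zi; apply: nz; exists i; apply/negP.
by rewrite (bigD1 i)//= (negPf zi) mul0r.
Qed.

(** The coordinates of a uniform corner are independent lazy steps, so the sum over the corners
    factorizes over the coordinates. *)
Lemma lazy_productS k j z : \sum_e lazy_product k j (z - lattice_corner k e) =
  2 ^+ d * lazy_product k j.+1 z.
Proof.
have -> : 2 ^+ d * lazy_product k j.+1 z = \prod_(i < d)
    \sum_(b : bool) lazy_kernel (k i) j (Defs.coord z i - (if b then (k i)%:Z else 0)).
  rewrite -[X in 2 ^+ X]card_ord -prodr_const -big_split/=.
  apply: eq_bigr => i _; rewrite big_bool /= subr0; lra.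
rewrite bigA_distr_bigA/=; apply: eq_bigr => e _; apply: eq_bigr => i _.
by rewrite coordB {2}/Defs.coord mxE.
Qed.

Lemma lazy_product_le k j z : (forall i, (0 < k i)%N) ->
  lazy_product k j z <= (2 `^ 2^-1) ^+ d * j.+1%:R `^ (- (d%:R / 2)).
Proof.
move=> k0; have -> : j.+1%:R `^ (- (d%:R / 2)) = (j.+1%:R `^ (- 2^-1)) ^+ d :> R.
  rewrite -powR_mulrn ?powR_ge0// -powRrM; congr (_ `^ _); lra.
rewrite -exprMn -[X in _ ^+ X]card_ord -prodr_const.
by apply: ler_prod => i _; rewrite lazy_kernel_ge0 lazy_kernel_le.
Qed.

Section Decomposition.
Local Open Scope ereal_scope.
Variables (p : Zd d -> \bar R) (k : 'I_d -> nat) (c : R).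
Hypotheses (p_ge0 : forall z, 0 <= p z) (p_mass : total_mass p = 1).
Hypotheses (k_gt0 : forall i, (0 < k i)%N) (c_gt0 : (0 < c)%R).
Hypothesis p_corner : forall e, c%:E <= p (lattice_corner k e).

Let corners (y : Zd d) : \bar R := \sum_e (y == lattice_corner k e)%:R%:E * c%:E.
Let rest (y : Zd d) : \bar R := p y - corners y.

Let corners_ge0 y : 0 <= corners y.
Proof. by apply: sume_ge0 => e _; rewrite mule_ge0// lee_fin// ltW. Qed.

Let corners_le y : corners y <= p y.
Proof.
have [[e ye]|ny] := pselect (exists e, y = lattice_corner k e).
  rewrite /corners (bigD1 e)//= big1 ?adde0 ?ye ?eqxx ?mul1e// => e' e'e.
  by rewrite (inj_eq (lattice_corner_inj k_gt0)) eq_sym (negPf e'e) mul0e.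
rewrite /corners big1// => e _; rewrite (_ : _ == _ = false) ?mul0e//.
by apply/eqP => ye; apply: ny; exists e.
Qed.

Let p_fin y : p y \is a fin_num.
Proof.
rewrite ge0_fin_numE//; apply: le_lt_trans (ltry 1); rewrite -p_mass.
exact: mass_le_total.
Qed.

Let corners_fin y : corners y \is a fin_num.
Proof.
rewrite ge0_fin_numE//; apply: le_lt_trans (corners_le y) _.
by rewrite -ge0_fin_numE.
Qed.

Let rest_ge0 y : 0 <= rest y.
Proof. by rewrite /rest sube_ge0 ?corners_fin// corners_le. Qed.

Let split_p : p = fun y => rest y + corners y.
Proof. by apply/funext => y; rewrite /rest subeK. Qed.

Let convolution_corners (g : Zd d -> \bar R) z : (forall y, 0 <= g y) ->
  convolution corners g z = \sum_e c%:E * g (z - lattice_corner k e)%R.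
Proof.
move=> g0; transitivity (\esum_(y in [set: Zd d]) \sum_e
   ((y == lattice_corner k e)%:R%:E * (c%:E * g (z - y)%R))).
  apply: eq_esum => y _; rewrite /corners ge0_sume_distrl.
    by apply: eq_bigr => e _; rewrite muleA.
  by move=> e _; rewrite mule_ge0// lee_fin// ltW.
rewrite esum_sum; last first.
  by move=> y e _ _; rewrite !mule_ge0// lee_fin// ltW.
apply: eq_bigr => e _.
by rewrite (esum_indicator _ (a := fun y => c%:E * g (z - y)%R))// => y;
  rewrite mule_ge0// lee_fin ltW.
Qed.

(** Removing mass [c] at each of the [2^d] corners leaves a nonnegative measure [rho], because the
    corners are distinct; the removed part acts on [lazy_product] by advancing [j] to [j + 1]. *)
Lemma corner_decomposition : exists rho : Zd d -> \bar R,
  [/\ forall y, 0 <= rho y, total_mass rho = (1 - 2 ^+ d * c)%:E,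
     (2 ^+ d * c <= 1)%R &
     forall j z, convolution p (fun y => (lazy_product k j y)%:E) z =
       convolution rho (fun y => (lazy_product k j y)%:E) z +
       (2 ^+ d * c * lazy_product k j.+1 z)%:E].
Proof.
have mass_corners : total_mass corners = (2 ^+ d * c)%:E.
  rewrite /total_mass /corners esum_sum; last first.
    by move=> y e _ _; rewrite mule_ge0// lee_fin// ltW.
  rewrite (eq_bigr (fun=> c%:E)); last first.
    by move=> e _; rewrite (esum_indicator _ (a := fun=> c%:E))// => _; rewrite lee_fin ltW.
  rewrite sumEFin sumr_const card_ffun card_bool card_ord.
  by rewrite -[in LHS]mulr_natl natrX.
have mass_split : total_mass rest + (2 ^+ d * c)%:E = 1.
  by rewrite -mass_corners -p_mass split_p -esumD.
have rest_mass : total_mass rest = (1 - 2 ^+ d * c)%:E.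
  by rewrite EFinB -mass_split addeK.
exists rest; split => //.
  by rewrite -subr_ge0 -lee_fin -rest_mass; exact: total_mass_ge0.
move=> j z; have l0 y : 0 <= (lazy_product k j y)%:E by rewrite lee_fin lazy_product_ge0.
rewrite {1}split_p convolutionDl//; congr (_ + _).
rewrite convolution_corners//; under eq_bigr do rewrite -EFinM.
by rewrite sumEFin -mulr_sumr lazy_productS mulrA (mulrC c).
Qed.

Hypothesis d_gt1 : (1 < d)%N.

(* Let a(n, j) be the supremum of the convolution of [conv_power p n] and
   [lazy_product k j], and q = 2^d c. The decomposition of p gives
   a(n+1, j) <= (1 - q) a(n, j) + q a(n, j+1), a recursion for which
   (1 + j + q n / d)^(- d/2) is a supersolution. *)
Lemma heat_kernel_corner n z : conv_power p n z <=
  ((2 `^ 2^-1) ^+ d * (1 + 2 ^+ d * c / d%:R * n%:R) `^ (- (d%:R / 2)))%:E.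
Proof.
have [rho [rho0 rho_mass c_le1 p_rho]] := corner_decomposition.
set C := (_ ^+ d * c)%R in rho_mass c_le1 p_rho *.
have C0 : (0 < C)%R by rewrite mulr_gt0// exprn_gt0.
set K := (_ ^+ d)%R; have K0 : (0 <= K)%R by rewrite exprn_ge0// powR_ge0.
pose a (m j : nat) : R := ((1 + j%:R + C / d%:R * m%:R) `^ (- (d%:R / 2)))%R.
have lz0 j y : 0 <= (lazy_product k j y)%:E by rewrite lee_fin lazy_product_ge0.
have cp0 m y : 0 <= conv_power p m y by exact: conv_power_ge0.
(* At [j = 0] the lazy product is the unit mass, which gives the claim; the recursion itself has to
   carry all [j] at once. *)
suff main m j y : convolution (conv_power p m) (fun y => (lazy_product k j y)%:E) y
    <= (K * a m j)%:E.
  have := main n 0%N z; rewrite /a addr0; apply: le_trans.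
  rewrite [X in _ <= convolution _ X _](_ : _ = @unit_mass R d); last first.
    by apply/funext => y; rewrite lazy_product0.
  by rewrite convolutionC convolution_unit.
elim: m j y => [|m IH] j y.
  rewrite convolution_unit// /a mulr0 addr0 lee_fin.
  by rewrite nat1r; exact: lazy_product_le.
rewrite conv_powerSr// convolutionA//.
rewrite (eq_convolution (frefl _) (p_rho j)) convolutionC convolutionDl//; last 2 first.
- by move=> x; exact: convolution_ge0.
- by move=> x; rewrite lee_fin mulr_ge0 ?lazy_product_ge0// ltW.
have am0 i : (0 <= (K * a m i)%:E) by rewrite lee_fin mulr_ge0 ?powR_ge0.
have first_le : convolution
    (convolution rho (fun y => (lazy_product k j y)%:E)) (conv_power p m) y <=
    ((1 - C) * (K * a m j))%:E.
  rewrite convolutionA// EFinM -rho_mass; apply: convolution_le_sup => // x.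
  by rewrite convolutionC; exact: IH.
have second_le : convolution (fun y => (C * lazy_product k j.+1 y)%:E)
    (conv_power p m) y <= (C * (K * a m j.+1))%:E.
  rewrite convolutionC (eq_convolution (frefl _) (fun y => EFinM C _)).
  have CE0 : 0 <= C%:E by rewrite lee_fin ltW.
  rewrite (convolutionZr y CE0 (cp0 m) (lz0 j.+1)) [leRHS]EFinM.
  by apply: lee_wpmul2l => //; exact: IH.
apply: le_trans (leeD first_le second_le) _; rewrite -EFinD lee_fin.
have x1 : (1 <= 1 + j%:R + C / d%:R * m%:R :> R)%R.
  by rewrite -addrA lerDl addr_ge0// mulr_ge0// divr_ge0// ltW.
have q1 : (1 <= d%:R / 2 :> R)%R.
  by rewrite ler_pdivlMr// mul1r ler_nat.
have C01 : (0 < C <= 1)%R by rewrite C0.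
(* The recursion replaces [j] by [j + 1], that is [x] by [x + 1], with weight [C], and [x + C / d]
   is the argument at time [m + 1]. The exponent [q = d / 2] is at least 1 because [d > 1]. *)
have := powRN_supersolution C01 q1 x1.
rewrite -[(_ + 1)%R]addrA [(_ * m%:R + 1)%R]addrC addrA -[(1 + j%:R + 1)%R]addrA natr1.
rewrite -[(_ + C / (2 * _))%R]addrA.
have -> : (C / d%:R * m%:R + C / (2 * (d%:R / 2)) = C / d%:R * m.+1%:R :> R)%R.
  by rewrite -natr1; field; rewrite pnatr_eq0; lia.
rewrite -/(a m.+1 j) -/(a m j.+1) -/(a m j) => H.
rewrite mulrCA [(C * _)%R]mulrCA -mulrDr ler_wpM2l//.
by rewrite addrC.
Qed.

End Decomposition.

Lemma finite_gt0_lower_bound (I : finType) (f : I -> \bar R) :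
  (forall i, 0 < f i)%E -> exists2 c : R, 0 < c & forall i, (c%:E <= f i)%E.
Proof.
move=> f0; suff [c c0 cf] : exists2 c : R, 0 < c & forall i, i \in enum I -> (c%:E <= f i)%E.
  by exists c => // i; apply: cf; rewrite mem_enum.
elim: (enum I) => [|i s [c c0 cs]]; first by exists 1.
exists (Num.min c (if f i is r%:E then r else 1)).
  by rewrite lt_min c0/=; have := f0 i; case: (f i).
move=> j; rewrite inE => /orP[/eqP ->|/cs]; last first.
  by apply: le_trans; rewrite lee_fin ge_min lexx.
have := f0 i; case: (f i) => [r _|_|//]; last by rewrite leey.
by rewrite lee_fin ge_min lexx orbT.
Qed.

Section Irreducible.
Local Open Scope ereal_scope.
Variable nu : probability (Zd d) R.
Hypothesis nu_irr : irreducible_chain (walk_kernel nu).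
Hypothesis d_gt1 : (1 < d)%N.
Let p := mass_function nu.
Let p_ge0 z : 0 <= p z. Proof. exact: mass_function_ge0. Qed.

Let unit_vector (i : 'I_d) : Zd d := (\row_j (j == i)%:Z)%R.

Let multiple_gt0 m (z : Zd d) n : 0 < conv_power p m z ->
  0 < conv_power p (n * m) (z *+ n)%R.
Proof.
move=> pz; elim: n => [|n IH]; first by rewrite mulr0n /= /unit_mass eqxx lte_fin.
by rewrite mulSn mulrS; exact: conv_powerD_gt0.
Qed.

Let sum_gt0 m (I : Type) (s : seq I) (z : I -> Zd d) :
  (forall i, 0 < conv_power p m (z i)) ->
  0 < conv_power p (size s * m) (\sum_(i <- s) z i)%R.
Proof.
move=> pz; elim: s => [|i s IH]; first by rewrite big_nil /= /unit_mass eqxx lte_fin.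
by rewrite big_cons/= mulSn; exact: conv_powerD_gt0.
Qed.

Let exists_time (z : Zd d) : z != 0%R ->
  exists2 n, (0 < n)%N & 0 < conv_power p n z.
Proof.
move=> z0; have [[|n] pn] := irreducible_conv_power z nu_irr; last by exists n.+1.
by move: pn; rewrite /= /unit_mass (negPf z0) lte_fin ltxx.
Qed.

(** All corners must be reached at one common time. The unit vector [e_i] is reached at time [m i],
    and 0 at time [a = m i0 + b]. In time [M0], the product of [a] and all the [m i], the walk can
    either move [k i = M0 / m i] times by [e_i] or return [M0 / a] times to 0; [d] such blocks lead
    to any corner. *)
Lemma irreducible_corners : exists M (k : 'I_d -> nat),
  [/\ (0 < M)%N, forall i, (0 < k i)%N &
      forall e, 0 < conv_power p M (lattice_corner k e)].
Proof.
have ev0 i : unit_vector i != 0%R.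
  by apply/eqP => /rowP/(_ i); rewrite !mxE eqxx.
have /choice[m mP] : forall i, exists n, (0 < n)%N /\ 0 < conv_power p n (unit_vector i).
  by move=> i; have [n] := exists_time (ev0 i); exists n.
pose i0 : 'I_d := Ordinal (ltnW d_gt1).
have [b b0 pb] : exists2 n, (0 < n)%N & 0 < conv_power p n (- unit_vector i0)%R.
  by apply: exists_time; rewrite oppr_eq0.
have p0 : 0 < conv_power p (m i0 + b) 0%R.
  rewrite -(subrr (unit_vector i0)); apply: conv_powerD_gt0 => //.
  by case: (mP i0).
pose M0 := ((m i0 + b) * \prod_i m i)%N.
pose k i := ((m i0 + b) * \prod_(j | j != i) m j)%N.
have kM i : (k i * m i = M0)%N.
  by rewrite /M0 (bigD1 i)//= /k -mulnA (mulnC (m i)).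
have M0_gt0 : (0 < M0)%N.
  rewrite muln_gt0 addn_gt0 b0 orbT/=; apply: prodn_gt0 => i.
  by case: (mP i).
have k_gt0 i : (0 < k i)%N by move: M0_gt0; rewrite -(kM i) muln_gt0 => /andP[].
exists (size (enum 'I_d) * M0)%N, k; split => //.
  by rewrite muln_gt0 M0_gt0 -cardE card_ord (ltnW d_gt1).
move=> e.
have -> : lattice_corner k e =
    (\sum_(i <- enum 'I_d) if e i then unit_vector i *+ k i else 0)%R.
  rewrite big_enum/=; apply/rowP => j; rewrite mxE summxE (bigD1 j)//=.
  rewrite big1 ?addr0; last first.
    move=> i ij; case: (e i); rewrite ?mxE//.
    by rewrite mulmxnE mxE eq_sym (negPf ij) mul0rn.
  by case: (e j); rewrite ?mxE// mulmxnE mxE eqxx/= natz.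
apply: sum_gt0 => i; case: (e i).
  by rewrite -(kM i); apply: multiple_gt0; case: (mP i).
have := multiple_gt0 (\prod_i m i)%N p0.
by rewrite mul0rn mulnC.
Qed.

Lemma heat_kernel_bound : exists2 C : R, (0 < C)%R &
  forall n z, conv_power p n z <= (C * n.+1%:R `^ (- (d%:R / 2)))%:E.
Proof.
have [M [k [M_gt0 k_gt0 pM]]] := irreducible_corners.
have [c c0 cP] := finite_gt0_lower_bound pM.
have pM0 z : 0 <= conv_power p M z by exact: conv_power_ge0.
have pM_mass : total_mass (conv_power p M) = 1.
  by apply: total_mass_conv_power => //; exact: total_mass_mass_function.
have HM := heat_kernel_corner pM0 pM_mass k_gt0 c0 cP d_gt1.
set K := ((2 `^ 2^-1) ^+ d)%R in HM; set c' := (2 ^+ d * c / d%:R)%R in HM.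
have K0 : (0 < K)%R by rewrite exprn_gt0// powR_gt0.
have c'0 : (0 < c')%R.
  by rewrite divr_gt0 ?mulr_gt0 ?exprn_gt0// ltr0n (ltnW d_gt1).
(* With the integer quotient [n / M], [n + 1 <= M (n / M + 1) <= B (1 + c' (n / M))]. The remaining
   [n %% M] steps only average the kernel and preserve its supremum bound. *)
pose B : R := (M%:R * (1 + c'^-1))%R.
have B0 : (0 < B)%R by rewrite mulr_gt0 ?ltr0n// addr_gt0 ?invr_gt0.
exists (K * B^-1 `^ (- (d%:R / 2)))%R; first by rewrite mulr_gt0 ?powR_gt0// invr_gt0.
move=> n z; rewrite {1}(divn_eq n M) (mulnC _ M) conv_powerD//.
rewrite conv_powerM// convolutionC.
have q0 : (0 <= d%:R / 2 :> R)%R by rewrite divr_ge0.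
apply: (@le_trans _ _ (K * (1 + c' * (n %/ M)%:R) `^ (- (d%:R / 2)))%:E).
  rewrite -[leRHS]mul1e -(total_mass_conv_power (n %% M) p_ge0 (total_mass_mass_function nu)).
  apply: convolution_le_sup => [y|//|y]; first exact: conv_power_ge0.
    by rewrite lee_fin mulr_ge0 ?powR_ge0// ltW.
  exact: HM.
rewrite lee_fin -mulrA ler_pM2l// -powRM ?invr_ge0 ?(ltW B0)//.
apply: ler_powRN => //; first by rewrite mulr_gt0 ?invr_gt0.
rewrite mulrC ler_pdivrMr//.
have nM : (n.+1%:R <= M%:R * ((n %/ M)%:R + 1) :> R)%R.
  by rewrite natr1 -natrM ler_nat mulnC ltn_ceil.
apply: le_trans nM _; rewrite /B mulrCA ler_pM2l ?ltr0n//.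
have -> : ((1 + c' * (n %/ M)%:R) * (1 + c'^-1) =
   1 + (n %/ M)%:R + c'^-1 + c' * (n %/ M)%:R)%R by field; lra.
rewrite addrC -addrA lerDl addr_ge0 ?invr_ge0 ?mulr_ge0// ltW//.
Qed.

End Irreducible.
End HeatKernel.

(** * Green function and capacity *)

Section GreenFunction.
Local Open Scope ereal_scope.
Variables (R : realType) (d : nat).
Implicit Types (f g p : Zd d -> \bar R).

Lemma esum_nat_le (a : nat -> \bar R) (B : \bar R) : (forall n, 0 <= a n) ->
  (forall L, \sum_(m < L) a m <= B) -> \esum_(n in [set: nat]) a n <= B.
Proof.
move=> a0 aB; rewrite -nneseries_esumT//; apply: lime_le.
  by apply: is_cvg_nneseries => n _ _; exact: a0.
by apply: nearW => n; rewrite big_mkord.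
Qed.

Lemma esum_nat_ge (a : nat -> \bar R) L : (forall n, 0 <= a n) ->
  \sum_(m < L) a m <= \esum_(n in [set: nat]) a n.
Proof.
by move=> a0; rewrite -(big_mkord predT a); apply: esum_seq_le => //; exact: iota_uniq.
Qed.

Definition green p (z : Zd d) : \bar R := \esum_(n in [set: nat]) conv_power p n z.

Lemma green_ge0 p z : (forall y, 0 <= p y) -> 0 <= green p z.
Proof. by move=> p0; apply: esum_ge0 => n _; exact: conv_power_ge0. Qed.

Lemma green0_ge1 p : (forall y, 0 <= p y) -> 1 <= green p 0%R.
Proof.
move=> p0; have := esum_nat_ge 1 (fun n => conv_power_ge0 n 0%R p0).
by rewrite big_ord_recl big_ord0 adde0 /= /unit_mass eqxx.
Qed.

(** Convolution by [p] transports measures, while convolution by [reflected p] is the transition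
    operator [E f(x + S_1)] on functions. *)
Definition reflected p (z : Zd d) : \bar R := p (- z)%R.

Lemma conv_power_reflected p n z :
  conv_power (reflected p) n z = conv_power p n (- z)%R.
Proof.
elim: n z => [|n IH] z; first by rewrite /= /unit_mass oppr_eq0.
rewrite !conv_powerS /convolution (reindex_esumT _ (bijective_subr 0%R)).
apply: eq_esum => y _; rewrite sub0r /reflected opprK IH.
by rewrite opprD.
Qed.

Lemma green_reflected p z : green (reflected p) z = green p (- z)%R.
Proof. by apply: eq_esum => n _; rewrite conv_power_reflected. Qed.

Lemma total_mass_reflected p : total_mass (reflected p) = total_mass p.
Proof.
rewrite /total_mass (reindex_esumT _ (bijective_subr 0%R)).
by apply: eq_esum => y _; rewrite sub0r /reflected opprK.
Qed.

Lemma convolution_green p f z : (forall y, 0 <= p y) -> (forall y, 0 <= f y) ->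
  convolution (green p) f z =
  \esum_(n in [set: nat]) convolution (conv_power p n) f z.
Proof.
move=> p0 f0; have cp0 n y : 0 <= conv_power p n y by exact: conv_power_ge0.
rewrite /convolution -exchange_esum; last by move=> *; rewrite mule_ge0.
by apply: eq_esum => y _; rewrite -esumZr.
Qed.

(* Both factors of the convolution are spread out, at scales k and m: this gives
   the decay of the Green function averaged over k steps of another walk. *)
Lemma green_average_le p f (C s : R) k : (forall y, 0 <= p y) -> total_mass p = 1 ->
  (forall y, 0 <= f y) -> total_mass f = 1 -> (0 < s)%R -> (0 <= C)%R ->
  (forall n z, conv_power p n z <= (C * n.+1%:R `^ (- (1 + s)))%:E) ->
  (forall z, f z <= (C * k.+1%:R `^ (- (1 + s)))%:E) ->
  \esum_(z in [set: Zd d]) (f z * green p z) <=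
    (C * (1 + s^-1) * k.+1%:R `^ (- s))%:E.
Proof.
move=> p0 p1 f0 f1 s0 C0 pC fC.
have cp0 n y : 0 <= conv_power p n y by exact: conv_power_ge0.
have pf0 n : 0 <= \esum_(z in [set: Zd d]) (f z * conv_power p n z).
  by apply: esum_ge0 => z _; rewrite mule_ge0.
rewrite [leLHS](_ : _ = \esum_(n in [set: nat])
    \esum_(z in [set: Zd d]) (f z * conv_power p n z)); last first.
  rewrite -exchange_esum; last by move=> *; rewrite mule_ge0.
  by apply: eq_esum => z _; rewrite esumZl.
apply: esum_nat_le => // L; apply: (@le_trans _ _
   (\sum_(m < L) (C * (maxn k m).+1%:R `^ (- (1 + s)))%:E)); last first.
  by rewrite sumEFin lee_fin -mulr_sumr -mulrA ler_wpM2l// sum_powRN_max_le.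
apply: lee_sum => m _; have [km|mk] := leqP k m.
  rewrite -[leRHS]mul1e -f1; apply: le_trans (_ : \esum_(z in [set: Zd d])
      (f z * (C * m.+1%:R `^ (- (1 + s)))%:E) <= _).
    by apply: le_esum => z _; rewrite lee_wpmul2l.
  by rewrite esumZr// lee_fin mulr_ge0// powR_ge0.
rewrite -[leRHS]mule1 -(total_mass_conv_power m p0 p1).
rewrite /total_mass -esumZl//; last by rewrite lee_fin mulr_ge0// powR_ge0.
by apply: le_esum => z _; rewrite lee_wpmul2r.
Qed.

End GreenFunction.

(** * Last exit decomposition, maximum principle and energy *)

Section LastExit.
Local Open Scope ereal_scope.
Variables (R : realType) (d : nat) (p : Zd d -> \bar R) (A : set (Zd d)).
Hypotheses (p_ge0 : forall z, 0 <= p z) (p_mass : total_mass p = 1).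
Let r := reflected p.
Let r_ge0 z : 0 <= r z. Proof. exact: p_ge0. Qed.
Let r_mass : total_mass r = 1. Proof. by rewrite total_mass_reflected. Qed.

Definition inside (x : Zd d) : \bar R := (\1_A x)%:E.
Definition outside (x : Zd d) : \bar R := (\1_(~` A) x)%:E.

Lemma insideD_outside x : inside x + outside x = 1.
Proof.
by rewrite /inside /outside !indicE in_setC -EFinD; case: (x \in A); rewrite ?addr0 ?add0r.
Qed.

Lemma inside_ge0 x : 0 <= inside x.
Proof. by rewrite lee_fin indicE ler0n. Qed.

Lemma outside_ge0 x : 0 <= outside x.
Proof. by rewrite lee_fin indicE ler0n. Qed.

(** Probability that the walk from [x] is outside [A] at the times [1, .., m]; time 0 is free, as in
    the definition of capacity. *)
Fixpoint avoid m (x : Zd d) : \bar R :=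
  if m is n.+1 then convolution r (fun y => outside y * avoid n y) x else 1.

(** Sum over the time of the last visit to [A] among [0, .., m], the factor [avoid] being the
    probability of no later visit. *)
Fixpoint hit m (x : Zd d) : \bar R :=
  if m is n.+1 then inside x * avoid m x + convolution r (hit n) x else inside x.

Lemma avoid_ge0 m x : 0 <= avoid m x.
Proof.
elim: m x => [|m IH] x //=.
by apply: convolution_ge0 => // y; rewrite mule_ge0// outside_ge0.
Qed.

Lemma hit_ge0 m x : 0 <= hit m x.
Proof.
elim: m x => [|m IH] x; first exact: inside_ge0.
by rewrite /= adde_ge0 ?mule_ge0 ?inside_ge0//;
  [exact: (avoid_ge0 m.+1)|exact: convolution_ge0].
Qed.

(* Either A is hit at one of the times 0,..,m (and the last visit is counted
   by hit) or it is not. *)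
Lemma hitD_avoid m x : hit m x + outside x * avoid m x = 1.
Proof.
elim: m x => [|m IH] x; first by rewrite mule1 insideD_outside.
have oa0 y : 0 <= outside y * avoid m y by rewrite mule_ge0 ?outside_ge0 ?avoid_ge0.
rewrite [hit _ _]/(inside x * avoid m.+1 x + convolution r (hit m) x).
rewrite addeAC -ge0_muleDl ?inside_ge0 ?outside_ge0//.
rewrite insideD_outside mul1e /=.
rewrite -esumD; last 2 first.
  by move=> y _; rewrite mule_ge0.
  by move=> y _; rewrite mule_ge0// hit_ge0.
rewrite -[RHS]r_mass; apply: eq_esum => y _.
by rewrite -ge0_muleDr ?hit_ge0// [X in _ * X]addeC IH mule1.
Qed.

Lemma hit_le1 m x : hit m x <= 1.
Proof.
by rewrite -(hitD_avoid m x) leeDl// mule_ge0 ?outside_ge0 ?avoid_ge0.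
Qed.

Lemma hit_inside m x : A x -> hit m x = 1.
Proof.
move=> Ax; have := hitD_avoid m x.
by rewrite /outside indicE in_setC mem_set//= mul0e adde0.
Qed.

Lemma avoid_le1 m x : avoid m x <= 1.
Proof.
elim: m x => [|m IH] x //=; rewrite -(mule1 1) -{1}r_mass.
apply: convolution_le_sup => // y; rewrite -[leRHS]mul1e.
apply: lee_pmul => //; [exact: outside_ge0|exact: avoid_ge0|].
by rewrite lee_fin indicE lern1; case: (_ \in _).
Qed.

Lemma avoidS_le m x : avoid m.+1 x <= avoid m x.
Proof.
elim: m x => [|m IH] x; first exact: (avoid_le1 1).
apply: le_convolution => // y.
  by rewrite mule_ge0 ?outside_ge0//; exact: (avoid_ge0 m.+1).
by rewrite lee_wpmul2l ?outside_ge0//; exact: IH.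
Qed.

(** Whatever the horizon, a last visit at time [k] in the point [y] has probability at least [e y]
    times that of being in [y] at time [k]. Last visits at distinct times are disjoint events, so
    the truncated potential of [e] is at most [hit]. *)
Lemma last_exit_le e x : (forall y, 0 <= e y) ->
  (forall m y, e y <= inside y * avoid m y) ->
  convolution (green r) e x <= 1.
Proof.
move=> e0 e_avoid; have cr0 n y : 0 <= conv_power r n y by exact: conv_power_ge0.
rewrite convolution_green//; apply: esum_nat_le => [n|L].
  exact: convolution_ge0.
case: L => [|L]; first by rewrite big_ord0.
apply: le_trans (hit_le1 L x); elim: L x => [|L IH] x.
  rewrite big_ord_recl big_ord0 adde0 /= convolution_unit//.
  by have := e_avoid 0%N x; rewrite mule1.
rewrite big_ord_recl; apply: leeD.
  by rewrite [conv_power _ _]/= convolution_unit//; exact: e_avoid.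
rewrite (eq_bigr (fun i : 'I_L.+1 =>
    convolution r (convolution (conv_power r i) e) x)); last first.
  by move=> i _; rewrite [conv_power _ _]conv_powerS convolutionA.
rewrite -convolution_sumr//; last by move=> i y; exact: convolution_ge0.
apply: le_convolution => // y; apply: sume_ge0 => i _; exact: convolution_ge0.
Qed.

Lemma avoid_leq m n x : (m <= n)%N -> avoid n x <= avoid m x.
Proof.
move=> /subnKC <-; elim: (n - m)%N => [|k IH]; first by rewrite addn0.
by rewrite addnS; apply: le_trans IH; exact: avoidS_le.
Qed.

(** A last visit at a time [k < n] is followed by at least [j] steps off [A]; visits from time [n]
    on are left in the remainder. *)
Let hit_unroll j n x : hit (n + j) x <=
  \sum_(k < n) convolution (conv_power r k) (fun y => inside y * avoid j y) x +
  convolution (conv_power r n) (hit j) x.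
Proof.
have cr0 k y : 0 <= conv_power r k y by exact: conv_power_ge0.
have ia0 y : 0 <= inside y * avoid j y by rewrite mule_ge0 ?inside_ge0 ?avoid_ge0.
elim: n x => [|n IH] x.
  by rewrite big_ord0 add0e convolution_unit//; exact: hit_ge0.
rewrite addSn big_ord_recl -addeA; apply: leeD.
  rewrite [conv_power _ _]/= convolution_unit//.
  by rewrite lee_wpmul2l ?inside_ge0//; apply: (avoid_leq (n := (n + j).+1)); lia.
rewrite (eq_bigr (fun i : 'I_n => convolution r
    (convolution (conv_power r i) (fun y => inside y * avoid j y)) x)); last first.
  by move=> i _; rewrite [conv_power _ _]conv_powerS convolutionA.
have hj0 y : 0 <= hit j y by exact: hit_ge0.
rewrite conv_powerS convolutionA// -convolution_sumr//; last first.
  by move=> i y; exact: convolution_ge0.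
set g := fun y => \sum_(i < n) _; set h := convolution (conv_power r n) (hit j).
have g0 y : 0 <= g y by apply: sume_ge0 => i _; exact: convolution_ge0.
have h0 y : 0 <= h y by exact: convolution_ge0.
have -> : convolution r g x + convolution r h x = convolution r (fun y => g y + h y) x.
  by rewrite convolutionDr.
by apply: le_convolution => // y; exact: hit_ge0.
Qed.

(** Each of the times [0, .., j] contributes at most the mass of [A]. This finiteness is what makes
    the remainder of [hit_unroll] vanish. *)
Let total_mass_hit j : total_mass (hit j) <= j.+1%:R%:E * total_mass inside.
Proof.
have ins0 y : 0 <= inside y by exact: inside_ge0.
have hit0 k y : 0 <= hit k y by exact: hit_ge0.
elim: j => [|j IH]; first by rewrite mul1e.
have -> : total_mass (hit j.+1) =
    total_mass (fun y => inside y * avoid j.+1 y) + total_mass (convolution r (hit j)).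
  rewrite /total_mass -esumD//; first by move=> y _; rewrite mule_ge0//; exact: (avoid_ge0 j.+1).
  by move=> y _; exact: convolution_ge0.
rewrite total_mass_convolution// r_mass mul1e -natr1 EFinD ge0_muleDl ?lee_fin//.
rewrite mul1e addeC; apply: leeD => //.
apply: le_esum => y _; rewrite -[leRHS]mule1 lee_wpmul2l//.
exact: (avoid_le1 j.+1).
Qed.

(** From a point of [A] the hitting probability is 1, and the remainder of [hit_unroll] is at most
    the supremum of the kernel at time [n] times the finite mass of [hit j], which tends to 0 with
    [n]. *)
Lemma last_exit_ge j x (C s : R) : A x -> total_mass inside < +oo -> (0 < s)%R ->
  (forall n z, conv_power p n z <= (C * n.+1%:R `^ (- s))%:E) ->
  1 <= convolution (green r) (fun y => inside y * avoid j y) x.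
Proof.
move=> Ax finA s0 pC.
have cr0 k y : 0 <= conv_power r k y by exact: conv_power_ge0.
have ia0 y : 0 <= inside y * avoid j y by rewrite mule_ge0 ?inside_ge0 ?avoid_ge0.
have hj0 y : 0 <= hit j y by exact: hit_ge0.
set G := convolution _ _ x.
have mass_fin : total_mass (hit j) \is a fin_num.
  rewrite ge0_fin_numE; last exact: total_mass_ge0.
  apply: le_lt_trans (total_mass_hit j) _.
  by rewrite lte_mul_pinfty// lee_fin.
pose B := fine (total_mass (hit j)).
have bound n : 1 <= G + (B * (C * n.+1%:R `^ (- s)))%:E.
  rewrite -(hit_inside (n + j) Ax); apply: le_trans (hit_unroll j n x) _.
  apply: leeD.
    rewrite /G convolution_green//; apply: esum_nat_ge => k.
    exact: convolution_ge0.
  rewrite EFinM fineK// convolutionC; apply: convolution_le_sup => //.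
    by apply: le_trans (pC n 0%R); exact: conv_power_ge0.
  by move=> y; rewrite conv_power_reflected.
have G0 : 0 <= G by apply: convolution_ge0 => // y; exact: green_ge0.
have [->|Gfin] := eqVneq G +oo; first by rewrite leey.
have {}Gfin : G \is a fin_num by rewrite ge0_fin_numE// lt_neqAle Gfin leey.
rewrite -(fineK Gfin) in bound *; rewrite lee_fin.
apply: (@ler_powRN_vanishing _ _ _ (B * C)%R s s0) => n.
by have := bound n; rewrite -EFinD lee_fin mulrA.
Qed.

(* Integrating the last exit decomposition against a measure f on the starting
   points and using Fubini. *)
Lemma pairing_green f e : (forall y, 0 <= f y) -> (forall y, 0 <= e y) ->
  \esum_(x in [set: Zd d]) (f x * convolution (green r) e x) =
  \esum_(y in [set: Zd d]) (e y * convolution (green p) f y).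
Proof.
move=> f0 e0; have g0 y : 0 <= green p y by exact: green_ge0.
transitivity (\esum_(x in [set: Zd d]) \esum_(y in [set: Zd d])
   (e y * (green p (y - x)%R * f x))).
  apply: eq_esum => x _; rewrite convolutionC /convolution -esumZl//; last first.
    by move=> y; rewrite mule_ge0// green_reflected.
  apply: eq_esum => y _; rewrite green_reflected opprB.
  by rewrite muleCA [in RHS]muleCA muleA muleC.
rewrite exchange_esum; last by move=> *; rewrite !mule_ge0.
apply: eq_esum => y _; rewrite esumZl//; last by move=> x; rewrite mule_ge0.
congr (_ * _); rewrite convolutionC; apply: eq_esum => x _; exact: muleC.
Qed.

(** Pair [f] with the potential of [e], which is at most 1 everywhere: by Fubini this is also the
    integral against [e], carried by [A], of the potential of [f]. It yields the upper bounds on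
    capacities. *)
Lemma escape_mass_le e f (kappa : \bar R) : (forall y, 0 <= e y) ->
  (forall m y, e y <= inside y * avoid m y) -> (forall y, 0 <= f y) ->
  0 <= kappa -> (forall y, A y -> kappa <= convolution (green p) f y) ->
  kappa * total_mass e <= total_mass f.
Proof.
move=> e0 e_avoid f0 k0 fk; have g0 y : 0 <= green p y by exact: green_ge0.
apply: le_trans (_ : \esum_(x in [set: Zd d]) (f x * convolution (green r) e x) <= _).
  rewrite pairing_green// /total_mass -esumZl//.
  apply: le_esum => y _; rewrite muleC; have [Ay|nAy] := pselect (A y).
    by rewrite lee_wpmul2l// fk.
  have := e_avoid 0%N y; rewrite /inside indicE memNset//= mul0e => ey.
  by rewrite (_ : e y = 0) ?mul0e//; apply/eqP; rewrite eq_le ey e0.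
apply: le_esum => x _; rewrite -[leRHS]mule1 lee_wpmul2l//.
exact: last_exit_le.
Qed.

Definition point_count (L : seq (Zd d)) (x : Zd d) : \bar R :=
  \sum_(z <- L) (x == z)%:R%:E.

Lemma point_count_ge0 L x : 0 <= point_count L x.
Proof. by apply: sume_ge0 => z _; rewrite lee_fin. Qed.

Lemma esum_point_count L (a : Zd d -> \bar R) : (forall x, 0 <= a x) ->
  \esum_(x in [set: Zd d]) (point_count L x * a x) = \sum_(z <- L) a z.
Proof.
move=> a0; transitivity (\esum_(x in [set: Zd d]) \sum_(z <- L) ((x == z)%:R%:E * a x)).
  by apply: eq_esum => x _; rewrite ge0_sume_distrl// => z _; rewrite lee_fin.
rewrite esum_sum; last by move=> x z _ _; rewrite mule_ge0// lee_fin.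
by apply: eq_bigr => z _; rewrite esum_indicator.
Qed.

Lemma convolution_point_count L (g : Zd d -> \bar R) y : (forall x, 0 <= g x) ->
  convolution g (point_count L) y = \sum_(z <- L) g (y - z)%R.
Proof.
by move=> g0; rewrite convolutionC; exact: (esum_point_count L (fun x => g0 (y - x)%R)).
Qed.

(** Instead of stopping the walk on its entrance into [L], induct on the truncation of the
    potential: off [L] the term of order 0 vanishes, and the rest is an average over one step of the
    potential truncated one step earlier. *)
Lemma maximum_principle L (K : \bar R) : 0 <= K ->
  (forall y, y \in L -> convolution (green p) (point_count L) y <= K) ->
  forall y, convolution (green p) (point_count L) y <= K.
Proof.
move=> K0 LK y; have pc0 := point_count_ge0 L.
have cp0 n z : 0 <= conv_power p n z by exact: conv_power_ge0.
rewrite convolution_green//; apply: esum_nat_le => [n|m].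
  exact: convolution_ge0.
elim: m y => [|m IH] y; first by rewrite big_ord0.
have [yL|yL] := boolP (y \in L).
  apply: le_trans (LK y yL); rewrite convolution_green//; apply: esum_nat_ge => n.
  exact: convolution_ge0.
rewrite big_ord_recl [conv_power _ _]/= convolution_unit//.
have -> : point_count L y = 0.
  rewrite /point_count big_seq big1// => z zL; case: eqP => // yz.
  by move: yL; rewrite yz zL.
rewrite add0e (eq_bigr (fun i : 'I_m => convolution p
    (convolution (conv_power p i) (point_count L)) y)); last first.
  by move=> i _; rewrite [conv_power _ _]conv_powerS convolutionA.
rewrite -convolution_sumr//; last by move=> i x; exact: convolution_ge0.
rewrite -[leRHS]mul1e -p_mass; apply: convolution_le_sup => //.
Qed.

(* Half of the points of L have a potential at most twice the average one; by
   the maximum principle their potential is bounded everywhere. *)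
Lemma energy_le (L : seq (Zd d)) (E C s : R) j :
  (forall y, y \in L -> A y) -> total_mass inside < +oo -> (0 < s)%R ->
  (forall n z, conv_power p n z <= (C * n.+1%:R `^ (- s))%:E) ->
  \sum_(y <- L) \sum_(x <- L) green p (y - x)%R <= E%:E ->
  ((size L)%:R ^+ 2)%:E <=
    (4 * E)%:E * total_mass (fun y => inside y * avoid j y).
Proof.
move=> LA finA s0 pC LE; have g0 y : 0 <= green p y by exact: green_ge0.
have e0 y : 0 <= inside y * avoid j y by rewrite mule_ge0 ?inside_ge0 ?avoid_ge0.
have E0 : (0 <= E)%R.
  by rewrite -lee_fin; apply: le_trans LE; do 2 apply: sume_ge0 => ? _.
have [n0|n_gt0] := posnP (size L).
  by rewrite n0 expr0n/= mule_ge0 ?lee_fin ?mulr_ge0//; exact: total_mass_ge0.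
set n : R := (size L)%:R; have n0 : (0 < n)%R by rewrite ltr0n.
pose h y := \sum_(x <- L) green p (y - x)%R.
have h0 y : 0 <= h y by apply: sume_ge0 => x _.
have hE y : y \in L -> h y <= E%:E.
  move=> yL; apply: le_trans LE; rewrite (big_rem y)//= leeDl//.
  by apply: sume_ge0 => z _; exact: h0.
(* The diagonal terms [green p 0 >= 1] give [E >= n > 0], so that the threshold [K] below is
   positive. *)
have hge1 y : y \in L -> 1 <= h y.
  move=> yL; rewrite /h (big_rem y)//= subrr.
  apply: le_trans (green0_ge1 p_ge0) _; rewrite leeDl//.
  by apply: sume_ge0 => z _.
have nE : (n <= E)%R.
  rewrite -lee_fin; apply: le_trans LE.
  rewrite /n -sum1_size natr_sum -sumEFin big_seq [leRHS]big_seq.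
  by apply: lee_sum => y yL; exact: hge1.
pose K : R := (2 * E / n)%R.
have K0 : (0 < K)%R by rewrite divr_gt0// mulr_gt0//; lra.
pose L' := [seq y <- L | h y <= K%:E].
have size_L' : (n <= 2 * (size L')%:R)%R.
  pose b := (count (predC (fun y => h y <= K%:E)) L)%:R : R.
  have : (K * b)%:E <= E%:E.
    apply: le_trans LE; rewrite (bigID (fun y => h y <= K%:E))/=.
    apply: (@le_trans _ _ (\sum_(y <- L | ~~ (h y <= K%:E)) K%:E)).
      by rewrite sumEFin big_const_seq iter_addr_0 mulr_natr.
    apply: (@le_trans _ _ (\sum_(y <- L | ~~ (h y <= K%:E)) h y)).
      by apply: lee_sum => y; rewrite -ltNge => /ltW.
    rewrite leeDr//; apply: sume_ge0 => y _; exact: h0.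
  rewrite lee_fin /K mulrAC ler_pdivrMr// -mulrA => bn.
  have {}bn : (2 * b <= n)%R by move: bn; rewrite mulrCA ler_pM2l//; lra.
  have : (n = (size L')%:R + b)%R.
    by rewrite /n /b size_filter -natrD count_predC.
  lra.
have L'A y : y \in L' -> A y by rewrite mem_filter => /andP[_ /LA].
have pot y : convolution (green p) (point_count L') y <= K%:E.
  apply: maximum_principle; first by rewrite lee_fin ltW.
  move=> z; rewrite mem_filter => /andP[hz _]; apply: le_trans hz.
  rewrite convolution_point_count// /L' big_filter /h.
  rewrite [leRHS](bigID (fun y => h y <= K%:E))/= leeDl//.
  by apply: sume_ge0.
have cap_ge : ((size L')%:R)%:E <= K%:E * total_mass (fun y => inside y * avoid j y).
  apply: (@le_trans _ _ (\esum_(x in [set: Zd d]) (point_count L' x *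
      convolution (green r) (fun y => inside y * avoid j y) x))).
    rewrite esum_point_count; last first.
      by move=> x; apply: convolution_ge0 => // y; rewrite green_reflected.
    rewrite -sum1_size natr_sum -sumEFin big_seq [leRHS]big_seq.
    by apply: lee_sum => x xL'; apply: (last_exit_ge _ _ _ s0 pC) => //; exact: L'A.
  rewrite pairing_green//; last exact: point_count_ge0.
  rewrite /total_mass -esumZl ?lee_fin ?(ltW K0)//.
  by apply: le_esum => y _; rewrite muleC lee_wpmul2r.
have -> : (4 * E = 2 * n * K)%R by rewrite /K; field; rewrite gt_eqF.
rewrite (EFinM (2 * n) K) -muleA; apply: (@le_trans _ _ ((2 * n)%:E * ((size L')%:R)%:E)).
  by rewrite -EFinM lee_fin expr2 -mulrA mulrCA ler_pM2l.
by rewrite lee_pmul2l// lte_fin mulr_gt0.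
Qed.

End LastExit.

Section PreimageSigmaAlgebra.
Variables (dT dE : measure_display) (T : measurableType dT) (E : measurableType dE).

Lemma g_sigma_algebra_preimageP (f : T -> E) (B : set E) : measurable B ->
  g_sigma_algebra_preimage f (f @^-1` B).
Proof. by move=> mB; exists B => //; rewrite setTI. Qed.

Lemma g_sigma_algebra_preimage_measurable (f : {mfun T >-> E}) :
  g_sigma_algebra_preimage f `<=` measurable.
Proof.
by move=> _ [B mB <-]; rewrite setTI; exact: measurable_funPTI.
Qed.

Lemma g_sigma_algebra_preimage_setT (f : T -> E) : g_sigma_algebra_preimage f setT.
Proof. by exists setT => //; rewrite setTI preimage_setT. Qed.

Lemma g_sigma_algebra_preimage_setI (f : T -> E) :
  setI_closed (g_sigma_algebra_preimage f).
Proof.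
move=> _ _ [B mB <-] [C mC <-]; rewrite !setTI -preimage_setI.
by apply: g_sigma_algebra_preimageP; exact: measurableI.
Qed.

End PreimageSigmaAlgebra.

(** * Escape events of the walk and capacity *)

Section WalkCapacity.
Local Open Scope ereal_scope.
Variables (dT : measure_display) (T : measurableType dT) (R : realType) (d : nat).
Variables (P : probability T R) (eta : probability (Zd d) R).
Variable Y : nat -> {RV P >-> Zd d}.
Hypothesis hY : iid_jumps eta Y.
Variable A : set (Zd d).
Let p := mass_function eta.
Let p_ge0 z : 0 <= p z. Proof. exact: mass_function_ge0. Qed.
Let F (k : nat) := g_sigma_algebra_preimage (Y k).

(** The index [n] of the first increment shifts along the recursion, and splitting over the value
    [y] of that increment displays the event as a countable union of independent intersections. *)
Fixpoint avoiding m n (x : Zd d) : set T :=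
  if m is m'.+1 then
    [set w | exists2 y, ~ A (x + y)%R & (Y n @^-1` [set y] `&` avoiding m' n.+1 (x + y)%R) w]
  else setT.

Let avoiding_sigma m n x : joint_sigma F [set k | (n <= k)%N] (avoiding m n x).
Proof.
elim: m n x => [|m IH] n x; first exact: joint_sigma_setT.
apply: joint_sigma_exists => y _; apply: joint_sigma_setI.
  by apply: (joint_sigma_gen (i := n)) => //=; exact: g_sigma_algebra_preimageP.
by apply: joint_sigmaS (IH n.+1 _) => k /= /ltnW.
Qed.

Let F_measurable k : F k `<=` measurable.
Proof. exact: (@g_sigma_algebra_preimage_measurable _ _ T (Zd d) (Y k)). Qed.

Let avoiding_measurable m n x : measurable (avoiding m n x).
Proof. exact: (joint_sigma_measurable F_measurable (@avoiding_sigma m n x)). Qed.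

Let law_Y n z : P (Y n @^-1` [set z]) = p z.
Proof. by case: hY => law _; rewrite /p /mass_function -(law n). Qed.

Lemma probability_avoiding m n x : P (avoiding m n x) = avoid p A m x.
Proof.
elim: m n x => [|m IH] n x; first exact: probability_setT.
have mY z : measurable (Y n @^-1` [set z]) by exact: measurable_funPTI.
rewrite (measure_countable_partition P mY)// /=.
rewrite [RHS]/convolution [RHS](reindex_esumT _ (bijective_subr 0%R)).
apply: eq_esum => y _; rewrite sub0r /reflected !opprK.
have [Axy|nAxy] := pselect (A (x + y)%R).
  rewrite {1}/outside indicE memNset ?mul0e ?mule0; last by move=> /(_ Axy).
  rewrite (_ : _ `&` _ = set0) ?measure0//; apply/seteqP; split => // w.
  by move=> [[y' nA [/= Yy' _]] /= Yy]; apply: nA; rewrite -Yy' Yy.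
rewrite /outside indicE mem_set// mul1e -(IH n.+1) -(law_Y n).
have F_setT k : F k setT by exact: g_sigma_algebra_preimage_setT.
have F_setI k : setI_closed (F k) by exact: g_sigma_algebra_preimage_setI.
have disj : [set n] `&` [set k | (n.+1 <= k)%N] = set0.
  by apply/seteqP; split => // k [/= ->]; rewrite ltnn.
have nS : joint_sigma F [set n] (Y n @^-1` [set y]).
  by apply: (joint_sigma_gen (i := n)) => //; exact: g_sigma_algebra_preimageP.
rewrite -(joint_sigma_independent (proj2 hY) F_measurable F_setT F_setI disj nS
  (@avoiding_sigma m n.+1 (x + y)%R)).
congr (P _); apply/seteqP; split => w.
  by move=> [[y' _ [/= Yy' av]] /= Yy]; split => //=; rewrite -Yy Yy'.
by move=> [Yy av]; split => //; exists y.
Qed.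

Lemma avoidingE m n x w : avoiding m n x w <->
  forall k, (k < m)%N -> ~ A (x + \sum_(i < k.+1) Y (n + i)%N w)%R.
Proof.
elim: m n x => [|m IH] n x; first by split.
split=> [[y nA [/= Yy /IH av]] k|av].
  case: k => [_|k km]; first by rewrite big_ord_recl big_ord0 addr0 addn0 Yy.
  rewrite big_ord_recl addn0 Yy addrA; have := av k km.
  by congr (~ A (_ + _)%R); apply: eq_bigr => i _; rewrite addSnnS.
exists (Y n w); first by have := av 0%N isT; rewrite big_ord_recl big_ord0 addr0 addn0.
split => //; apply/IH => k km; have := av k.+1 km.
rewrite big_ord_recl addn0 addrA.
by congr (~ A (_ + _)%R); apply: eq_bigr => i _; rewrite addSnnS.
Qed.

Definition escape (x : Zd d) : set T :=
  [set w | forall n : nat, (1 <= n)%N -> ~ A (walk Y x n w)].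

Lemma escapeE x : escape x = \bigcap_m avoiding m 0 x.
Proof.
apply/seteqP; split => w.
  by move=> e m _; apply/avoidingE => k km; exact: (e k.+1).
move=> av [//|n] _; have /avoidingE/(_ n (ltnSn n)) := av n.+1 I.
by [].
Qed.

Lemma escape_measurable x : measurable (escape x).
Proof. by rewrite escapeE; apply: bigcapT_measurable => m; exact: avoiding_measurable. Qed.

Lemma escape_le_avoid m x : P (escape x) <= avoid p A m x.
Proof.
rewrite -(probability_avoiding m 0); apply: le_measure; rewrite ?inE.
- exact: escape_measurable.
- exact: avoiding_measurable.
- by rewrite escapeE; exact: bigcap_inf.
Qed.

Lemma avoid_cvg_escape x : avoid p A ^~ x @ \oo --> P (escape x).
Proof.
rewrite escapeE (_ : avoid p A ^~ x = P \o (fun m => avoiding m 0 x)); last first.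
  by apply/funext => m /=; rewrite probability_avoiding.
apply: nonincreasing_cvg_mu => //.
- by rewrite /= [X in X < _](probability_setT P) ltry.
- exact: bigcapT_measurable.
- move=> m n mn; apply/subsetPset => w /avoidingE av; apply/avoidingE => k km.
  by apply: av; exact: leq_trans mn.
Qed.

Lemma capacityE : capacity Y A = total_mass (fun y => inside R A y * P (escape y)).
Proof.
rewrite /capacity esum_mkcond; apply: eq_esum => y _.
by rewrite /inside indicE; case: (y \in A); rewrite ?mul1e ?mul0e.
Qed.

Lemma total_mass_inside (f : Zd d -> \bar R) : (forall y, 0 <= f y) ->
  total_mass (fun y => inside R A y * f y) = \esum_(y in A) f y.
Proof.
move=> f0; rewrite [RHS]esum_mkcond; apply: eq_esum => y _.
by rewrite /inside indicE; case: (y \in A); rewrite ?mul1e ?mul0e.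
Qed.

(** Lower bounds are available at every horizon [j]; as [A] is finite, the limit of [avoid j] can be
    taken inside the sum. *)
Lemma capacity_ge (k : R) (c : \bar R) : finite_set A -> (0 <= k)%R ->
  (forall j, c <= k%:E * total_mass (fun y => inside R A y * avoid p A j y)) ->
  c <= k%:E * capacity Y A.
Proof.
move=> finA k0 ck; rewrite capacityE total_mass_inside//.
rewrite esum_fset// fsbig_finite//=.
have {}ck j : c <= k%:E * \sum_(y <- finmap.enum_fset (fset_set A)) avoid p A j y.
  have := ck j; rewrite total_mass_inside; last by move=> y; exact: avoid_ge0.
  by rewrite esum_fset// ?fsbig_finite// => y _; exact: avoid_ge0.
have fin_av j y : avoid p A j y \is a fin_num.
  rewrite ge0_fin_numE; last exact: avoid_ge0.
  apply: le_lt_trans (ltry 1); apply: avoid_le1 => //.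
  exact: total_mass_mass_function.
have sum_cvg (s : seq (Zd d)) :
    \sum_(y <- s) avoid p A j y @[j --> \oo] --> \sum_(y <- s) P (escape y).
  elim: s => [|y s IH].
    by under eq_fun do rewrite big_nil; rewrite big_nil; exact: cvg_cst.
  under eq_fun do rewrite big_cons; rewrite big_cons.
  apply: cvgeD => //; last exact: avoid_cvg_escape.
  by rewrite fin_num_adde_defr// fin_num_measure//; exact: escape_measurable.
apply: (cvge_to_ge (_ : k%:E * \sum_(y <- finmap.enum_fset (fset_set A)) avoid p A j y @[j --> \oo] --> _)).
  by apply: cvgeZl => //; exact: sum_cvg.
by apply: nearW => j; exact: ck.
Qed.

End WalkCapacity.

(** * Second moments of the walk and capacity of cubes *)

Section SecondMoment.
Local Open Scope ereal_scope.
Variables (R : realType) (d : nat) (eta : probability (Zd d) R).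
Let p := mass_function eta.
Let p_ge0 z : 0 <= p z. Proof. exact: mass_function_ge0. Qed.

Lemma integral_mass_function (g : Zd d -> \bar R) : (forall z, 0 <= g z) ->
  \int[eta]_z g z = \esum_(z in [set: Zd d]) (p z * g z).
Proof.
move=> g0; have mid (z : Zd d) : measurable (id @^-1` [set z]) by [].
rewrite (integral_countable eta mid)//.
by apply: eq_esum => z _; rewrite setTI muleC.
Qed.

Variable i : 'I_d.
Hypothesis mean0 : \int[eta]_x ((Defs.coord x i)%:~R : R)%:E = 0.
Hypothesis finite_m2 : \int[eta]_x ((((Defs.coord x i)%:~R : R) ^+ 2)%R)%:E < +oo.

Definition second_moment : R := fine (\int[eta]_x ((((Defs.coord x i)%:~R : R) ^+ 2)%R)%:E).

Let c (z : Zd d) : R := (Defs.coord z i)%:~R.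

Let int_sqr : eta.-integrable setT (fun z => ((c z ^+ 2)%R)%:E).
Proof.
apply/integrableP; split => //; under eq_integral do rewrite gee0_abs ?lee_fin ?sqr_ge0//.
exact: finite_m2.
Qed.

(** Coordinates are integers, so the second moment alone makes them integrable. *)
Let norm_int_le_sqr (m : int) : (`|m%:~R| <= (m%:~R : R) ^+ 2)%R.
Proof.
rewrite -rmorphXn -intr_norm ler_int.
have [->|m0] := eqVneq m 0%R; first by [].
rewrite -real_normK ?num_real// expr2 ler_peMr//.
by rewrite -gtz0_ge1 normr_gt0.
Qed.

Let int_c : eta.-integrable setT (fun z => (c z)%:E).
Proof.
apply: le_integrable int_sqr => // z _.
by rewrite !abse_EFin lee_fin [leRHS]ger0_norm ?sqr_ge0// norm_int_le_sqr.
Qed.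

Let second_moment_shift (t : int) :
  \esum_(y in [set: Zd d]) (p y * (((c y + t%:~R) ^+ 2)%R)%:E) =
  (second_moment + t%:~R ^+ 2)%:E.
Proof.
rewrite -(integral_mass_function (g := fun y => ((c y + t%:~R) ^+ 2)%R%:E)); last first.
  by move=> z; rewrite lee_fin sqr_ge0.
have int_t : eta.-integrable setT (cst ((t%:~R ^+ 2)%R)%:E).
  exact: finite_measure_integrable_cst.
have int_lin : eta.-integrable setT (fun z => (2 * t%:~R)%R%:E * (c z)%:E).
  exact: integrableZl.
transitivity (\int[eta]_z (((c z ^+ 2)%R)%:E +
    ((2 * t%:~R)%R%:E * (c z)%:E + cst ((t%:~R ^+ 2)%R)%:E z))).
  apply: eq_integral => z _; rewrite -EFinM -!EFinD; congr EFin; ring.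
rewrite integralD//; last exact: integrableD.
rewrite integralD// integralZl// mean0 mule0 add0e integral_cst//.
rewrite [X in _ * X](probability_setT eta) mule1 EFinD; congr (_ + _).
by rewrite /second_moment fineK// ge0_fin_numE//; apply: integral_ge0 => z _; rewrite lee_fin sqr_ge0.
Qed.

Lemma second_moment_ge0 : (0 <= second_moment)%R.
Proof. by apply/fine_ge0/integral_ge0 => z _; rewrite lee_fin sqr_ge0. Qed.

(** Variances of independent steps add up; the cross term vanishes because the steps are
    centered. *)
Lemma second_moment_conv_power m :
  \esum_(z in [set: Zd d]) (conv_power p m z * (((Defs.coord z i)%:~R ^+ 2)%R)%:E) =
  (m%:R * second_moment)%:E.
Proof.
elim: m => [|m IH].
  rewrite mul0r esum1// => z _ /=; rewrite /unit_mass; case: eqP => [->|_]; last by rewrite mul0e.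
  by rewrite /Defs.coord mxE expr0n mule0.
have p1 : total_mass p = 1 by exact: total_mass_mass_function.
have cp0 z : 0 <= conv_power p m z by exact: conv_power_ge0.
rewrite conv_powerSr//.
rewrite (esum_convolution (k := fun z => (((Defs.coord z i)%:~R ^+ 2)%R)%:E))//; last first.
  by move=> z; rewrite lee_fin sqr_ge0.
transitivity (\esum_(y in [set: Zd d]) (conv_power p m y * second_moment%:E +
    conv_power p m y * (((Defs.coord y i)%:~R ^+ 2)%R)%:E)).
  apply: eq_esum => y _; rewrite -ge0_muleDr ?lee_fin ?sqr_ge0 ?second_moment_ge0//.
  rewrite -EFinD -second_moment_shift; congr (_ * _); apply: eq_esum => x _.
  by rewrite coordD intrD.
rewrite esumD; last 2 first.
  by move=> y _; rewrite mule_ge0// lee_fin second_moment_ge0.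
  by move=> y _; rewrite mule_ge0// lee_fin sqr_ge0.
rewrite IH esumZr ?lee_fin ?second_moment_ge0//.
rewrite [X in X * _](total_mass_conv_power m p_ge0 p1) mul1e -EFinD.
by congr EFin; rewrite -natr1; ring.
Qed.

End SecondMoment.

Section CubeCapacity.
Local Open Scope ereal_scope.
Variables (R : realType) (d : nat).

Definition cube (r : nat) : set (Zd d) := [set z | forall i, `|Defs.coord z i| <= r%:Z]%R.

Definition cube_point (r : nat) (e : {ffun 'I_d -> 'I_(2 * r).+1}) : Zd d :=
  (\row_i ((e i)%:Z - r%:Z))%R.

Lemma cube_pointP r z : cube r z -> exists e, z = cube_point (r := r) e.
Proof.
move=> zr; have lt i : (`|(Defs.coord z i + r%:Z)%R|%N < (2 * r).+1)%N.
  by have := zr i; lia.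
exists [ffun i => Ordinal (lt i)]; apply: coord_inj => i.
by rewrite [RHS]mxE ffunE /=; have := zr i; lia.
Qed.

Lemma finite_cube r : finite_set (cube r).
Proof.
apply: (sub_finite_set (B := range (@cube_point r))).
  by move=> z /cube_pointP[e ->]; exists e.
exact: finite_image.
Qed.

Lemma total_mass_cube r : total_mass (inside R (cube r)) <= (((2 * r).+1)%:R ^+ d)%:E.
Proof.
apply: (@le_trans _ _ (\esum_(z in [set: Zd d])
    \sum_(e : {ffun 'I_d -> 'I_(2 * r).+1}) ((z == cube_point e)%:R%:E * 1))).
  apply: le_esum => z _; rewrite /inside indicE.
  have [/set_mem/cube_pointP[e ->]|_] := boolP (z \in cube r).
    by rewrite (bigD1 e)//= eqxx mul1e leeDl// sume_ge0// => *; rewrite mule_ge0// lee_fin.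
  by apply: sume_ge0 => *; rewrite mule_ge0// lee_fin.
rewrite esum_sum; last by move=> *; rewrite mule_ge0// lee_fin.
rewrite (eq_bigr (fun=> 1)); last first.
  by move=> e _; rewrite (esum_indicator _ (a := fun=> 1)).
by rewrite sumEFin sumr_const card_ffun !card_ord natrX.
Qed.


Variables (dT : measure_display) (T : measurableType dT).
Variables (P : probability T R) (eta : probability (Zd d) R).
Variable Y : nat -> {RV P >-> Zd d}.
Hypothesis hY : iid_jumps eta Y.
Hypothesis d_ge2 : (2 <= d)%N.
Hypothesis mean0 : mean_zero eta.
Hypothesis finite_m2 : forall i,
  \int[eta]_x ((((Defs.coord x i)%:~R : R) ^+ 2)%R)%:E < +oo.
Let p := mass_function eta.
Let p_ge0 z : 0 <= p z. Proof. exact: mass_function_ge0. Qed.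
Let p_mass : total_mass p = 1. Proof. exact: total_mass_mass_function. Qed.

Let v : R := (\sum_i second_moment eta i)%R.
Let v_ge0 : (0 <= v)%R. Proof. by apply: sumr_ge0 => i _; exact: second_moment_ge0. Qed.

(** Chebyshev, summed over the coordinates: outside the cube some coordinate has a square at least
    [r^2]. *)
Let stay_in_cube m r : (0 < r)%N ->
  (1 - m%:R * v / r%:R ^+ 2)%:E <=
  \esum_(z in [set: Zd d]) (conv_power p m z * inside R (cube r) z).
Proof.
move=> r0; have cp0 z : 0 <= conv_power p m z by exact: conv_power_ge0.
have r2 : (0 < r%:R ^+ 2 :> R)%R by rewrite exprn_gt0// ltr0n.
have sq0 (z : Zd d) i : (0 <= ((Defs.coord z i)%:~R ^+ 2 : R) / r%:R ^+ 2)%R.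
  by rewrite divr_ge0 ?sqr_ge0// ltW.
have ins0 z : 0 <= inside R (cube r) z by exact: inside_ge0.
have total : 1 <= \esum_(z in [set: Zd d]) (conv_power p m z * inside R (cube r) z) +
    (m%:R * v / r%:R ^+ 2)%:E.
  have -> : (m%:R * v / r%:R ^+ 2)%:E = \esum_(z in [set: Zd d])
      (conv_power p m z * (\sum_i (Defs.coord z i)%:~R ^+ 2 / r%:R ^+ 2)%R%:E).
    transitivity (\esum_(z in [set: Zd d]) \sum_i (r%:R ^+ 2)^-1%:E *
       (conv_power p m z * (((Defs.coord z i)%:~R ^+ 2)%R)%:E)).
      rewrite esum_sum; last first.
        by move=> z i _ _; rewrite !mule_ge0// lee_fin ?sqr_ge0// invr_ge0 ltW.
      rewrite (eq_bigr (fun i => (m%:R * second_moment eta i / r%:R ^+ 2)%:E)).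
        by rewrite sumEFin -mulr_suml -mulr_sumr.
      move=> i _; rewrite esumZl; last 2 first.
        by rewrite lee_fin invr_ge0 ltW.
        by move=> z; rewrite mule_ge0// lee_fin sqr_ge0.
      by rewrite second_moment_conv_power// -EFinM mulrC.
    apply: eq_esum => z _; rewrite -sumEFin ge0_sume_distrr; last first.
      by move=> i _; rewrite lee_fin.
    by apply: eq_bigr => i _; rewrite muleCA -EFinM mulrC.
  rewrite -esumD; last 2 first.
    by move=> z _; rewrite mule_ge0.
    by move=> z _; rewrite mule_ge0// lee_fin sumr_ge0.
  rewrite -[leLHS](total_mass_conv_power m p_ge0 p_mass); apply: le_esum => z _.
  rewrite -ge0_muleDr// ?lee_fin ?sumr_ge0//.
  rewrite -[leLHS]mule1 lee_wpmul2l// /inside indicE -EFinD lee_fin.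
  have [/set_mem zr|zr] := boolP (z \in cube r).
    by rewrite lerDl sumr_ge0.
  rewrite add0r; have [i zi] : exists i, ~~ (`|Defs.coord z i| <= r%:Z)%R.
    apply: contrapT => nz; move/negP: zr; apply; apply/mem_set => i.
    by apply: contrapT => zi; apply: nz; exists i; apply/negP.
  rewrite (bigD1 i)//=; apply: (@le_trans _ _ ((Defs.coord z i)%:~R ^+ 2 / r%:R ^+ 2)%R).
    rewrite ler_pdivlMr// mul1r -[leRHS]real_normK ?num_real//.
    rewrite ler_pXn2r ?nnegrE//; move: zi; rewrite -ltNge -intr_norm => /ltW.
    by rewrite -(ler_int R).
  by rewrite lerDl sumr_ge0.
by rewrite EFinB leeBlDr.
Qed.

(** Up to a time of order [r^2] the time-reversed walk from a point of [A] is in the doubled cube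
    with probability at least 1/2, so the indicator of that cube has potential at least [kappa] on
    [A]. Its mass [O(r^d)] divided by [kappa] is [O(r^(d - 2))]. *)
Lemma capacity_cube_le : exists2 C : R, (0 < C)%R &
  forall (r : nat) (A : set (Zd d)), (0 < r)%N -> A `<=` cube r ->
    capacity Y A <= (C * r%:R ^+ (d - 2))%:E.
Proof.
(* For [m <= r^2 / D] the exit probability [m v / r^2] is at most 1/2; the summand 1 keeps [D]
   positive when [v = 0]. *)
pose D : R := (2 * v + 1)%R; have D0 : (0 < D)%R by rewrite ltr_wpDl// mulr_ge0.
exists (5 ^+ d * 2 * D)%R; first by rewrite !mulr_gt0// exprn_gt0.
move=> r A r0 Ar; have r2 : (0 < r%:R ^+ 2 :> R)%R by rewrite exprn_gt0// ltr0n.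
pose kappa : R := (r%:R ^+ 2 / (2 * D))%R.
have kappa0 : (0 < kappa)%R by rewrite divr_gt0// mulr_gt0.
pose f := inside R (cube (2 * r)%N).
have f0 y : 0 <= f y by exact: inside_ge0.
have potential y : A y -> kappa%:E <= convolution (green p) f y.
  move=> Ay; have cp0 n z : 0 <= conv_power p n z by exact: conv_power_ge0.
  rewrite convolution_green//.
  pose L := (Num.truncn (r%:R ^+ 2 / D : R)).+1.
  have rD0 : (0 <= r%:R ^+ 2 / D)%R by rewrite divr_ge0// ltW.
  apply: le_trans (esum_nat_ge L _); last by move=> n; exact: convolution_ge0.
  apply: (@le_trans _ _ (\sum_(m < L) (2^-1)%:E)).
    rewrite sumEFin sumr_const card_ord lee_fin -[leRHS]mulr_natl.
    have := @truncnS_gt _ (r%:R ^+ 2 / D : R); rewrite -/L => /ltW.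
    have -> : kappa = (r%:R ^+ 2 / D / 2)%R by rewrite /kappa; field; rewrite gt_eqF.
    by rewrite ler_pM2r.
  apply: lee_sum => m _.
  apply: (@le_trans _ _ (1 - m%:R * v / r%:R ^+ 2)%:E).
    have : (m%:R <= r%:R ^+ 2 / D)%R.
      apply: le_trans (_ : (Num.truncn (r%:R ^+ 2 / D : R))%:R <= _)%R.
        by rewrite ler_nat -ltnS ltn_ord.
      by rewrite truncn_le.
    rewrite lee_fin ler_pdivlMr// => mD.
    rewrite lerBrDr -lerBrDl ler_pdivrMr//.
    have : (2 * (m%:R * v) <= m%:R * D)%R.
      by rewrite /D mulrDr mulr1 mulrCA lerDl.
    have -> : ((1 - 2^-1) * r%:R ^+ 2 = r%:R ^+ 2 / 2 :> R)%R by field.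
    by rewrite ler_pdivlMr// mulrC => /le_trans; apply.
  apply: le_trans (stay_in_cube m r0) _; apply: le_esum => z _.
  apply: lee_wpmul2l => //; rewrite /f /inside !indicE lee_fin ler_nat.
  have [/set_mem zr|//] := boolP (z \in cube r).
  rewrite mem_set// => i; rewrite coordB.
  by have := Ar y Ay i; have := zr i; lia.
have e0 y : 0 <= inside R A y * P (escape Y A y) by rewrite mule_ge0 ?inside_ge0.
have := @escape_mass_le R d p A p_ge0 p_mass _ f kappa%:E e0 _ f0 _ potential.
rewrite -capacityE => H.
have {}H : kappa%:E * capacity Y A <= (((2 * (2 * r)).+1)%:R ^+ d)%:E.
  apply: le_trans (total_mass_cube (2 * r)%N); apply: H.
    by move=> m y; rewrite lee_wpmul2l ?inside_ge0// (escape_le_avoid hY).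
  by rewrite lee_fin ltW.
have kinv : kappa^-1%:E * (kappa%:E * capacity Y A) = capacity Y A.
  by rewrite muleA -EFinM mulVf ?gt_eqF// mul1e.
rewrite -kinv; apply: (@le_trans _ _ (kappa^-1%:E * (((2 * (2 * r)).+1)%:R ^+ d)%:E)).
  by rewrite lee_wpmul2l// lee_fin invr_ge0 ltW.
rewrite -EFinM lee_fin.
apply: (@le_trans _ _ (kappa^-1 * (5 * r%:R) ^+ d)%R).
  rewrite ler_wpM2l ?invr_ge0 ?(ltW kappa0)//.
  by rewrite lerXn2r ?nnegrE// -natrM ler_nat; lia.
rewrite le_eqVlt; apply/orP; left; apply/eqP.
have rd : (r%:R ^+ d = r%:R ^+ (d - 2) * r%:R ^+ 2 :> R)%R by rewrite -exprD subnK.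
rewrite exprMn rd /kappa invf_div; field.
by rewrite pnatr_eq0 -lt0n.
Qed.

End CubeCapacity.

(** * Laws of the branching walk *)

Section BranchingWalkLaws.
Local Open Scope ereal_scope.
Variables (dT : measure_display) (T : measurableType dT) (R : realType) (d : nat).
Variables (P : probability T R) (mu : probability nat R) (theta : probability (Zd d) R).
Variables (N : vertex -> {RV P >-> nat}) (X : vertex -> {RV P >-> Zd d}).
Hypothesis hNX : igw_brw mu theta N X.
Hypothesis theta_sym : symmetric_law theta.

Definition tree_field (i : vertex + vertex) : set (set T) :=
  match i with
  | inl v => g_sigma_algebra_preimage (N v)
  | inr v => g_sigma_algebra_preimage (X v)
  end.

Lemma tree_field_measurable i : tree_field i `<=` measurable.
Proof.
case: i => v; first exact: (@g_sigma_algebra_preimage_measurable _ _ T nat (N v)).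
exact: (@g_sigma_algebra_preimage_measurable _ _ T (Zd d) (X v)).
Qed.

Lemma tree_field_independent S S' (A B : set T) : S `&` S' = set0 ->
  joint_sigma tree_field S A -> joint_sigma tree_field S' B ->
  P (A `&` B) = P A * P B.
Proof.
apply: joint_sigma_independent; first by case: hNX.
- exact: tree_field_measurable.
- by case=> v; exact: g_sigma_algebra_preimage_setT.
- by case=> v; exact: g_sigma_algebra_preimage_setI.
Qed.

Lemma law_N v (A : set nat) : P (N v @^-1` A) = mu A.
Proof. by case: hNX => law _ _; rewrite -(law v). Qed.

Lemma law_X v (A : set (Zd d)) : P (X v @^-1` A) = theta A.
Proof. by case: hNX => _ law _; rewrite -(law v). Qed.

Definition signed_sum (s : seq (bool * vertex)) (w : T) : Zd d :=
  (\sum_(x <- s) (if x.1 then X x.2 w else - X x.2 w))%R.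

Lemma signed_sum_cons b v s w : signed_sum ((b, v) :: s) w =
  ((if b then X v w else - X v w) + signed_sum s w)%R.
Proof. by rewrite /signed_sum big_cons. Qed.

Let signed_sum_consE b v s z : signed_sum ((b, v) :: s) @^-1` [set z] =
  [set w | exists2 y, True & (X v @^-1` [set y] `&`
    signed_sum s @^-1` [set (z - (if b then y else - y))%R]) w].
Proof.
apply/seteqP; split => w /=; rewrite signed_sum_cons.
  by move=> <-; exists (X v w) => //; split => //; rewrite addrAC subrr add0r.
by move=> [y _ [<- ->]]; rewrite addrC subrK.
Qed.

Definition edge_indices (s : seq (bool * vertex)) : set (vertex + vertex) :=
  [set i | exists2 v, v \in [seq x.2 | x <- s] & i = inr v].

Lemma signed_sum_sigma s z :
  joint_sigma tree_field (edge_indices s) (signed_sum s @^-1` [set z]).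
Proof.
elim: s z => [|[b v] s IH] z.
  have [z0|z0] := eqVneq (0%R : Zd d) z.
    rewrite (_ : _ @^-1` _ = setT); first exact: joint_sigma_setT.
    by apply/seteqP; split => // w _ /=; rewrite /signed_sum big_nil.
  rewrite (_ : _ @^-1` _ = set0); first exact: joint_sigma_set0.
  apply/seteqP; split => // w /=; rewrite /signed_sum big_nil => zz.
  by move: z0; rewrite zz eqxx.
rewrite signed_sum_consE; apply: joint_sigma_exists => y _.
apply: joint_sigma_setI.
  apply: (joint_sigma_gen (i := inr v)) => /=.
    by exists v => //; rewrite inE eqxx.
  exact: g_sigma_algebra_preimageP.
apply: joint_sigmaS (IH _) => i [u us ->]; exists u => //.
by rewrite inE us orbT.
Qed.

Lemma signed_sum_measurable s z : measurable (signed_sum s @^-1` [set z]).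
Proof. exact: (joint_sigma_measurable tree_field_measurable (@signed_sum_sigma s z)). Qed.

(** By symmetry of [theta], an edge crossed backwards contributes the same law as one crossed
    forwards, so only the number of distinct edges matters. *)
Lemma probability_signed_sum s z : uniq [seq x.2 | x <- s] ->
  P (signed_sum s @^-1` [set z]) = conv_power (mass_function theta) (size s) z.
Proof.
elim: s z => [|[b v] s IH] z /=.
  move=> _; rewrite /unit_mass; have [->|z0] := eqVneq z 0%R.
    rewrite (_ : _ @^-1` _ = setT) ?probability_setT//.
    by apply/seteqP; split => // w _ /=; rewrite /signed_sum big_nil.
  rewrite (_ : _ @^-1` _ = set0) ?measure0//.
  apply/seteqP; split => // w /=; rewrite /signed_sum big_nil => zz.
  by move: z0; rewrite -zz eqxx.
move=> /andP[vs us].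
have mX y : measurable (X v @^-1` [set y]) by exact: measurable_funPTI.
rewrite (measure_countable_partition P mX); last exact: signed_sum_measurable.
transitivity (\esum_(y in [set: Zd d]) (mass_function theta y *
   conv_power (mass_function theta) (size s) (z - (if b then y else - y))%R)).
  apply: eq_esum => y _; rewrite -IH// /mass_function -(law_X v).
  rewrite -(@tree_field_independent [set inr v] (edge_indices s)).
  - congr (P _); apply/seteqP; split => w /=; rewrite signed_sum_cons.
      by move=> [<- <-]; split => //; rewrite addrAC subrr add0r.
    by move=> [-> ->]; split => //; rewrite addrC subrK.
  - apply/seteqP; split => // i [/= -> [u us' [uv]]].
    by move: vs; rewrite uv us'.
  - by apply: (joint_sigma_gen (i := inr v)) => //=; exact: g_sigma_algebra_preimageP.
  - exact: signed_sum_sigma.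
case: b => //; rewrite (reindex_esumT _ (bijective_subr 0%R)).
by apply: eq_esum => y _; rewrite sub0r opprK /mass_function -theta_sym.
Qed.

Definition offspring_indices : set (vertex + vertex) := [set i | exists v, i = inl v].

(** Displacements are independent of the offspring variables; this product formula plays the role of
    conditioning on the trees. *)
Lemma probability_signed_sum_on s z (B : set T) : uniq [seq x.2 | x <- s] ->
  joint_sigma tree_field offspring_indices B ->
  P (B `&` signed_sum s @^-1` [set z]) =
    P B * conv_power (mass_function theta) (size s) z.
Proof.
move=> us SB; rewrite -(probability_signed_sum z us).
apply: (tree_field_independent _ SB (@signed_sum_sigma s z)).
by apply/seteqP; split => // i [[v ->] [u _]].
Qed.

(** Probability that the child number [i] exists. These probabilities add up to the mean offspring,
    which bounds the total weight of the words of a given length. *)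
Definition tail (i : nat) : R := fine (mu [set k | (i < k)%N]).

Lemma tail_ge0 i : (0 <= tail i)%R.
Proof. exact/fine_ge0/measure_ge0. Qed.

Lemma probability_offspring_gt v i : P [set w | (i < N v w)%N] = (tail i)%:E.
Proof. by rewrite /tail fineK ?fin_num_measure// -(law_N v). Qed.

Definition weight (u : seq nat) : R := (\prod_(i <- u) tail i)%R.

Lemma weight_ge0 u : (0 <= weight u)%R.
Proof. by apply: prodr_ge0 => i _; exact: tail_ge0. Qed.

Lemma weight_cons i u : weight (i :: u) = (tail i * weight u)%R.
Proof. by rewrite /weight big_cons. Qed.

(** Event that [w ++ u] is a vertex once [w] is one; the prefix [w] lets the inductions descend the
    tree. *)
Fixpoint alive (j : nat) (w u : seq nat) : set T :=
  if u is i :: u' then [set t | (i < N (j, w) t)%N] `&` alive j (rcons w i) u'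
  else setT.

Lemma aliveE j w u t : alive j w u t <->
  forall k, (k < size u)%N -> (nth 0%N u k < N (j, w ++ take k u) t)%N.
Proof.
elim: u w => [|i u IH] w; first by split.
split => [[iN /IH av] [|k] ku /=|av].
- by rewrite /= cats0.
- by rewrite -cat_rcons; exact: av.
split; first by have := av 0%N isT; rewrite /= cats0.
by apply/IH => k ku; have := av k.+1 ku; rewrite /= -cat_rcons.
Qed.

Lemma alive_gw_tree j u t : alive j [::] u t <-> gw_tree (fun u => N (j, u) t) u.
Proof. exact: aliveE. Qed.

Definition subtree_indices (j : nat) (w : seq nat) : set (vertex + vertex) :=
  [set i | exists u, i = inl (j, w ++ u)].

Lemma subtree_offspring j w : subtree_indices j w `<=` offspring_indices.
Proof. by move=> i [u ->]; exists (j, w ++ u). Qed.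

Lemma subtree_rcons j w i : subtree_indices j (rcons w i) `<=` subtree_indices j w.
Proof. by move=> _ [u ->]; exists (i :: u); rewrite cat_rcons. Qed.

Lemma subtree_disjoint j w i i' : i != i' ->
  subtree_indices j (rcons w i) `&` subtree_indices j (rcons w i') = set0.
Proof.
move=> /eqP ii'; apply/seteqP; split => // _ [[u ->] [u' []]].
by rewrite !cat_rcons => /eqP; rewrite eqseq_cat// eqxx/= eqseq_cons => /andP[/eqP/ii'].
Qed.

Lemma root_subtree_disjoint j w i :
  [set inl (j, w)] `&` subtree_indices j (rcons w i) = set0.
Proof.
apply/seteqP; split => // _ [/= -> [u' []]] /(congr1 size).
by rewrite size_cat size_rcons; lia.
Qed.

Lemma offspring_gt_sigma j w i :
  joint_sigma tree_field [set inl (j, w)] [set t | (i < N (j, w) t)%N].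
Proof.
apply: (joint_sigma_gen (i := inl (j, w))) => //=.
exact: (@g_sigma_algebra_preimageP _ _ T nat (N (j, w)) [set k | (i < k)%N]).
Qed.

Lemma root_subtree j w : [set inl (j, w)] `<=` subtree_indices j w.
Proof. by move=> _ ->; exists [::]; rewrite cats0. Qed.

Lemma alive_sigma j w u : joint_sigma tree_field (subtree_indices j w) (alive j w u).
Proof.
elim: u w => [|i u IH] w; first exact: joint_sigma_setT.
apply: joint_sigma_setI.
  exact: joint_sigmaS (@root_subtree j w) _ (@offspring_gt_sigma j w i).
exact: joint_sigmaS (@subtree_rcons j w i) _ (IH _).
Qed.

Lemma probability_alive j w u : P (alive j w u) = (weight u)%:E.
Proof.
elim: u w => [|i u IH] w; first by rewrite /weight big_nil probability_setT.
rewrite /= (@tree_field_independent _ _ _ _ (@root_subtree_disjoint j w i)).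
- by rewrite probability_offspring_gt IH weight_cons EFinM.
- exact: offspring_gt_sigma.
- exact: alive_sigma.
Qed.

(** Common ancestors count once, and where the words part, with letters [i] and [i'], the parent
    needs more than [maxn i i'] children. Summing this last factor is what calls for the second
    moment of [mu]. *)
Fixpoint pair_weight (u v : seq nat) : R :=
  match u, v with
  | i :: u', i' :: v' => if i == i' then (tail i * pair_weight u' v')%R
      else (tail (maxn i i') * (weight u' * weight v'))%R
  | [::], _ => weight v
  | _, [::] => weight u
  end.

Lemma pair_weight_ge0 u v : (0 <= pair_weight u v)%R.
Proof.
elim: u v => [|i u IH] [|i' v]; try exact: weight_ge0.
by rewrite /=; case: ifP => _; rewrite !mulr_ge0 ?tail_ge0 ?weight_ge0.
Qed.

Lemma probability_alive_pair j w u v :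
  P (alive j w u `&` alive j w v) = (pair_weight u v)%:E.
Proof.
elim: u v w => [|i u IH] v w; first by rewrite setTI probability_alive.
case: v => [|i' v]; first by rewrite setIT probability_alive.
have [<-|ii'] := eqVneq i i'.
  rewrite [LHS](_ : _ = P ([set t | (i < N (j, w) t)%N] `&`
      (alive j (rcons w i) u `&` alive j (rcons w i) v))); last first.
    by congr (P _); apply/seteqP; split => t /=; tauto.
  rewrite (@tree_field_independent _ _ _ _ (@root_subtree_disjoint j w i)).
  - by rewrite probability_offspring_gt IH /= eqxx EFinM.
  - exact: offspring_gt_sigma.
  - by apply: joint_sigma_setI; exact: alive_sigma.
rewrite [LHS](_ : _ = P ([set t | (maxn i i' < N (j, w) t)%N] `&`
      (alive j (rcons w i) u `&` alive j (rcons w i') v))); last first.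
  congr (P _); apply/seteqP; split => t /=; rewrite gtn_max.
    by move=> [[-> ?] [-> ?]].
  by move=> [/andP[? ?] [? ?]].
rewrite (@tree_field_independent [set inl (j, w)]
  (subtree_indices j (rcons w i) `|` subtree_indices j (rcons w i'))).
- rewrite probability_offspring_gt /= (negPf ii') EFinM; congr (_ * _).
  rewrite (@tree_field_independent _ _ _ _ (@subtree_disjoint j w _ _ ii')).
  + by rewrite !probability_alive EFinM.
  + exact: alive_sigma.
  + exact: alive_sigma.
- by rewrite setIUr !root_subtree_disjoint setU0.
- exact: offspring_gt_sigma.
- apply: joint_sigma_setI.
    by apply: joint_sigmaS (@alive_sigma _ _ _) => k; left.
  by apply: joint_sigmaS (@alive_sigma _ _ _) => k; right.
Qed.

Lemma probability_alive_distinct j j' u v : j != j' ->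
  P (alive j [::] u `&` alive j' [::] v) = (weight u * weight v)%:E.
Proof.
move=> /eqP jj'; rewrite (@tree_field_independent (subtree_indices j [::]) (subtree_indices j' [::])).
- by rewrite !probability_alive EFinM.
- by apply/seteqP; split => // _ [[? ->] [? [/jj']]].
- exact: alive_sigma.
- exact: alive_sigma.
Qed.

End BranchingWalkLaws.

(** * Paths between two vertices *)

Section VertexDifferences.
Local Open Scope ereal_scope.
Variables (dT : measure_display) (T : measurableType dT) (R : realType) (d : nat).
Variables (P : probability T R) (mu : probability nat R) (theta : probability (Zd d) R).
Variables (N : vertex -> {RV P >-> nat}) (X : vertex -> {RV P >-> Zd d}).
Hypothesis hNX : igw_brw mu theta N X.
Hypothesis theta_sym : symmetric_law theta.

Fixpoint branch (j : nat) (w u : seq nat) : seq vertex :=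
  if u is i :: u' then (j, rcons w i) :: branch j (rcons w i) u' else [::].

(** The edge from [w_(i-1)] to [w_i] is stored at [w_i], hence the indices [j + 1, .., j + k]. *)
Definition spine (j k : nat) : seq vertex := [seq (j + i.+1, [::]) | i <- iota 0 k]%N.

Definition with_sign (b : bool) (s : seq vertex) : seq (bool * vertex) :=
  [seq (b, v) | v <- s].

(** The edges above the point where the words part cancel in the difference and are dropped, which
    leaves distinct edges, as independence requires. *)
Fixpoint tree_diff (j : nat) (w u v : seq nat) : seq (bool * vertex) :=
  match u, v with
  | i :: u', i' :: v' => if i == i' then tree_diff j (rcons w i) u' v'
      else with_sign false (branch j w u) ++ with_sign true (branch j w v)
  | [::], _ => with_sign true (branch j w v)
  | _, [::] => with_sign false (branch j w u)
  end.

Fixpoint tree_dist (u v : seq nat) : nat :=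
  match u, v with
  | i :: u', i' :: v' => if i == i' then tree_dist u' v' else (size u + size v)%N
  | [::], _ => size v
  | _, [::] => size u
  end.

(* The edges of the path from x to y, with the signs they have in V_y - V_x. *)
Definition vertex_diff (x y : vertex) : seq (bool * vertex) :=
  if x.1 == y.1 then tree_diff x.1 [::] x.2 y.2
  else with_sign (x.1 < y.1)%N (spine (minn x.1 y.1) (maxn x.1 y.1 - minn x.1 y.1)) ++
       with_sign false (branch x.1 [::] x.2) ++ with_sign true (branch y.1 [::] y.2).

Definition vertex_dist (x y : vertex) : nat :=
  if x.1 == y.1 then tree_dist x.2 y.2
  else (maxn x.1 y.1 - minn x.1 y.1 + (size x.2 + size y.2))%N.

Lemma size_branch j w u : size (branch j w u) = size u.
Proof. by elim: u w => //= i u IH w; rewrite IH. Qed.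

Lemma size_tree_diff j w u v : size (tree_diff j w u v) = tree_dist u v.
Proof.
elim: u v w => [|i u IH] [|i' v] w; rewrite ?size_map ?size_branch//=.
case: ifP => _; first exact: IH.
by rewrite /= size_cat /= !size_map !size_branch.
Qed.

Lemma size_vertex_diff x y : size (vertex_diff x y) = vertex_dist x y.
Proof.
rewrite /vertex_diff /vertex_dist; case: ifP => _; first exact: size_tree_diff.
by rewrite !size_cat !size_map !size_branch size_iota.
Qed.

Lemma mem_branch j w i u x : x \in branch j w (i :: u) ->
  exists y, x = (j, rcons w i ++ y).
Proof.
elim: u w i => [|i' u IH] w i; first by rewrite inE => /eqP ->; exists [::]; rewrite cats0.
rewrite [branch _ _ _]/= inE => /orP[/eqP ->|]; first by exists [::]; rewrite cats0.
by move=> /(IH (rcons w i) i')[y ->]; exists (i' :: y); rewrite cat_rcons.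
Qed.

Lemma uniq_branch j w u : uniq (branch j w u).
Proof.
elim: u w => //= i [|i' u] IH w //; rewrite IH andbT.
apply/negP => /mem_branch[y []] /(congr1 size).
by rewrite size_cat !size_rcons; lia.
Qed.

Lemma map_with_sign b s : [seq x.2 | x <- with_sign b s] = s.
Proof. by rewrite -map_comp map_id. Qed.

Lemma uniq_tree_diff j w u v : uniq [seq x.2 | x <- tree_diff j w u v].
Proof.
elim: u v w => [|i u IH] v w.
  by rewrite [tree_diff _ _ _ _]/(with_sign true (branch j w v)) map_with_sign uniq_branch.
case: v => [|i' v].
  have -> : tree_diff j w (i :: u) [::] = with_sign false (branch j w (i :: u)) by [].
  by rewrite map_with_sign uniq_branch.
rewrite [tree_diff _ _ _ _]/=; have [_|ii'] := eqVneq i i'; first exact: IH.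
rewrite -[_ :: _]/(with_sign false (branch j w (i :: u)) ++ with_sign true (branch j w (i' :: v))).
rewrite map_cat !map_with_sign cat_uniq.
rewrite (uniq_branch j w (i :: u)) (uniq_branch j w (i' :: v)) andbT.
apply/hasPn => x /mem_branch[y ->]; apply/negP => /mem_branch[y' []] /eqP.
by rewrite !cat_rcons eqseq_cat// eqxx/= eqseq_cons eq_sym (negPf ii').
Qed.

Lemma uniq_vertex_diff x y : uniq [seq z.2 | z <- vertex_diff x y].
Proof.
rewrite /vertex_diff; have [_|xy] := eqVneq x.1 y.1; first exact: uniq_tree_diff.
have branch_nonroot j u z : z \in branch j [::] u -> z.1 = j /\ z.2 != [::].
  by case: u => // i u /mem_branch[s ->].
rewrite !map_cat !map_with_sign !cat_uniq !uniq_branch andbT andTb.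
apply/andP; split; first by rewrite map_inj_uniq ?iota_uniq// => k k' []; lia.
apply/andP; split; last first.
  apply/hasPn => z /branch_nonroot[zy _]; apply/negP => /branch_nonroot[zx _].
  by move: xy; rewrite -zx zy eqxx.
apply/hasPn => z; rewrite mem_cat => zb; apply/negP => /mapP[k _ zk].
by case/orP: zb => /branch_nonroot[_]; rewrite zk.
Qed.

Lemma signed_sum_with_sign b s t : signed_sum X (with_sign b s) t =
  (if b then \sum_(e <- s) X e t else - \sum_(e <- s) X e t)%R.
Proof.
by rewrite /signed_sum big_map; case: b => //=; rewrite sumrN.
Qed.

Lemma signed_sum_cat s s' t :
  signed_sum X (s ++ s') t = (signed_sum X s t + signed_sum X s' t)%R.
Proof. by rewrite /signed_sum big_cat. Qed.

Lemma sum_branch j w u t : (\sum_(e <- branch j w u) X e t =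
  \sum_(0 <= k < size u) X (j, w ++ take k.+1 u) t)%R.
Proof.
elim: u w => [|i u IH] w; first by rewrite big_nil big_geq.
rewrite /= big_cons IH [RHS]big_nat_recl//= take0 cats1; congr (_ + _)%R.
by apply: eq_bigr => k _; rewrite cat_rcons.
Qed.

Lemma signed_sum_tree_diff j w u v t : signed_sum X (tree_diff j w u v) t =
  (\sum_(e <- branch j w v) X e t - \sum_(e <- branch j w u) X e t)%R.
Proof.
elim: u v w => [|i u IH] v w.
  have -> : tree_diff j w [::] v = with_sign true (branch j w v) by [].
  by rewrite signed_sum_with_sign big_nil subr0.
case: v => [|i' v].
  have -> : tree_diff j w (i :: u) [::] = with_sign false (branch j w (i :: u)) by [].
  by rewrite signed_sum_with_sign big_nil sub0r.
rewrite [tree_diff _ _ _ _]/=; have [<-|ii'] := eqVneq i i'.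
  by rewrite IH /= !big_cons opprD addrACA subrr add0r.
rewrite -[_ :: _]/(with_sign false (branch j w (i :: u)) ++ with_sign true (branch j w (i' :: v))).
by rewrite signed_sum_cat !signed_sum_with_sign addrC.
Qed.

Lemma positionE j u t : position X t (j, u) =
  (\sum_(1 <= k < j.+1) X (k, [::]) t + \sum_(e <- branch j [::] u) X e t)%R.
Proof. by rewrite /position sum_branch. Qed.

Lemma sum_spine j k t : (\sum_(1 <= i < (j + k).+1) X (i, [::]) t =
  \sum_(1 <= i < j.+1) X (i, [::]) t + \sum_(e <- spine j k) X e t)%R.
Proof.
elim: k => [|k IH]; first by rewrite addn0 big_nil addr0.
rewrite addnS big_nat_recr//= IH /spine -[k.+1]addn1 iotaD map_cat big_cat /=.
by rewrite big_seq1 addrA add0n addnS.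
Qed.

Lemma signed_sum_vertex_diff x y t :
  signed_sum X (vertex_diff x y) t = (position X t y - position X t x)%R.
Proof.
case: x y => [j u] [j' v]; rewrite /vertex_diff /=; have [<-|jj'] := eqVneq j j'.
  rewrite signed_sum_tree_diff !positionE opprD addrACA subrr add0r//.
rewrite !signed_sum_cat !signed_sum_with_sign !positionE /=.
have [lt|ge] := ltnP j j'.
  have := sum_spine j (j' - j) t; rewrite subnKC; last exact: ltnW.
  move=> ->.
  move: (\sum_(_ <- branch j _ _) _)%R (\sum_(_ <- branch j' _ _) _)%R
    (\sum_(_ <- spine _ _) _)%R (\sum_(1 <= _ < _) _)%R => a b c e.
  by rewrite opprD -[(e + c + b)%R]addrA addrACA subrr add0r -addrA [(b - a)%R]addrC.
have := sum_spine j' (j - j') t; rewrite subnKC// => ->.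
move: (\sum_(_ <- branch j _ _) _)%R (\sum_(_ <- branch j' _ _) _)%R
    (\sum_(_ <- spine _ _) _)%R (\sum_(1 <= _ < _) _)%R => a b c e.
rewrite -[(e + c + a)%R]addrA opprD addrACA subrr add0r opprD.
by rewrite addrA addrC.
Qed.

Definition alive_vertex (x : vertex) : set T := alive N x.1 [::] x.2.

Lemma alive_vertex_sigma x :
  joint_sigma (tree_field N X) offspring_indices (alive_vertex x).
Proof.
by apply: joint_sigmaS (@alive_sigma _ _ _ _ _ N X x.1 [::] x.2); exact: subtree_offspring.
Qed.

Lemma alive_vertex_measurable x : measurable (alive_vertex x).
Proof.
exact: (joint_sigma_measurable (@tree_field_measurable _ _ _ _ _ N X) (@alive_vertex_sigma x)).
Qed.

Definition vertex_pair_weight (x y : vertex) : R :=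
  if x.1 == y.1 then pair_weight mu x.2 y.2 else (weight mu x.2 * weight mu y.2)%R.

Lemma vertex_pair_weight_ge0 x y : (0 <= vertex_pair_weight x y)%R.
Proof.
rewrite /vertex_pair_weight; case: ifP => _; first exact: pair_weight_ge0.
by rewrite mulr_ge0 ?weight_ge0.
Qed.

Lemma probability_alive_vertices x y :
  P (alive_vertex x `&` alive_vertex y) = (vertex_pair_weight x y)%:E.
Proof.
rewrite /alive_vertex /vertex_pair_weight; have [->|xy] := eqVneq x.1 y.1.
  exact: (probability_alive_pair hNX).
exact: (probability_alive_distinct hNX).
Qed.

(** Independence of trees and displacements separates the probability that both vertices exist from
    a mean over the [theta]-walk at time [vertex_dist x y]. *)
Lemma expectation_vertices (g : Zd d -> \bar R) x y : (forall z, 0 <= g z) ->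
  \int[P]_(t in alive_vertex x `&` alive_vertex y)
     g (position X t y - position X t x)%R =
  (vertex_pair_weight x y)%:E * \esum_(z in [set: Zd d])
     (conv_power (mass_function theta) (vertex_dist x y) z * g z).
Proof.
move=> g0; have cp0 n z : 0 <= conv_power (mass_function theta) n z.
  by apply: conv_power_ge0 => ?; exact: mass_function_ge0.
have mS z : measurable (signed_sum X (vertex_diff x y) @^-1` [set z]).
  exact: (@signed_sum_measurable _ _ _ _ _ N).
under eq_integral do rewrite -signed_sum_vertex_diff.
rewrite (integral_countable P mS)//; last by apply: measurableI; exact: alive_vertex_measurable.
rewrite -esumZl ?lee_fin ?vertex_pair_weight_ge0//; last by move=> z; rewrite mule_ge0.
apply: eq_esum => z _.
have SB : joint_sigma (tree_field N X) offspring_indices (alive_vertex x `&` alive_vertex y).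
  by apply: joint_sigma_setI; exact: alive_vertex_sigma.
have E := probability_signed_sum_on hNX theta_sym z (uniq_vertex_diff x y) SB.
rewrite -probability_alive_vertices muleA -size_vertex_diff -E muleC.
by [].
Qed.

End VertexDifferences.

(** * First and second moments over the forest *)

Section WordSums.
Variables (R : realType) (mu : probability nat R).
Variable K : nat.

(* Bounding the letters by K keeps all sums finite. *)
Fixpoint words (a : nat) : seq (seq nat) :=
  if a is b.+1 then [seq i :: u | i <- iota 0 K, u <- words b] else [:: [::]].

Lemma sum_words (f : seq nat -> R) a : \sum_(u <- words a.+1) f u =
  \sum_(i <- iota 0 K) \sum_(u <- words a) f (i :: u).
Proof.
by rewrite /= big_flatten big_map; apply: eq_bigr => i _; rewrite big_map.
Qed.

Lemma size_words a u : u \in words a -> size u = a.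
Proof.
elim: a u => [|a IH] u; first by rewrite inE => /eqP ->.
by move=> /allpairsP[[i v] /= [_ va ->]] /=; rewrite (IH v).
Qed.

Definition letter_mass : R := \sum_(i <- iota 0 K) tail mu i.

Lemma letter_mass_ge0 : 0 <= letter_mass.
Proof. by apply: sumr_ge0 => i _; exact: tail_ge0. Qed.

Lemma sum_weight a : \sum_(u <- words a) weight mu u = letter_mass ^+ a.
Proof.
elim: a => [|a IH]; first by rewrite big_seq1 /weight big_nil.
rewrite sum_words exprS -IH mulr_suml; apply: eq_bigr => i _.
by rewrite mulr_sumr; apply: eq_bigr => u _; rewrite weight_cons.
Qed.

Variables (kappa : R) (g : nat -> R).
Hypothesis mass_le1 : letter_mass <= 1.
Hypothesis kappaP :
  \sum_(i <- iota 0 K) \sum_(i' <- iota 0 K) tail mu (maxn i i') <= kappa.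
Hypothesis g_ge0 : forall n, 0 <= g n.
Hypothesis g_noninc : forall m n, (m <= n)%N -> g n <= g m.

Let kappa_ge0 : 0 <= kappa.
Proof. by apply: le_trans kappaP; do 2 apply: sumr_ge0 => ? _; exact: tail_ge0. Qed.

Let mass_pow a : 0 <= letter_mass ^+ a <= 1.
Proof. by rewrite exprn_ge0 ?letter_mass_ge0// exprn_ile1// letter_mass_ge0. Qed.

Definition pair_sum a b : R := \sum_(u <- words a) \sum_(v <- words b)
  pair_weight mu u v * g (tree_dist u v).

Let pair_sum0r b : pair_sum 0 b <= g b.
Proof.
rewrite /pair_sum big_seq1 (_ : \sum_(v <- _) _ = letter_mass ^+ b * g b).
  by rewrite ler_piMl//; case/andP: (mass_pow b).
rewrite -sum_weight mulr_suml big_seq [RHS]big_seq; apply: eq_bigr => v vb.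
by rewrite /= (size_words vb).
Qed.

Let pair_sumr0 a : pair_sum a 0 <= g a.
Proof.
rewrite /pair_sum (_ : \sum_(u <- _) _ = letter_mass ^+ a * g a).
  by rewrite ler_piMl//; case/andP: (mass_pow a).
rewrite -sum_weight mulr_suml big_seq [RHS]big_seq; apply: eq_bigr => u ua.
by rewrite big_seq1 -(size_words ua); case: u {ua}.
Qed.

(** Split by the first letters. Equal letters recurse, with total weight [letter_mass <= 1].
    Distinct letters leave two independent subtrees and have total weight at most [kappa]; there the
    distance [a + b + 2] is lowered to [a + b], which only increases [g]. *)
Let pair_sumSS a b : pair_sum a.+1 b.+1 <= pair_sum a b + kappa * g (a + b).
Proof.
have split_sum : pair_sum a.+1 b.+1 =
   \sum_(i <- iota 0 K) \sum_(i' <- iota 0 K)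
     (if i == i' then tail mu i * pair_sum a b
      else tail mu (maxn i i') * (letter_mass ^+ a * letter_mass ^+ b * g (a.+1 + b.+1))).
  rewrite /pair_sum sum_words; apply: eq_bigr => i _.
  under eq_bigr do rewrite sum_words.
  rewrite exchange_big; apply: eq_bigr => i' _ /=.
  have [_|_] := eqVneq i i'.
    rewrite mulr_sumr; apply: eq_bigr => u _; rewrite mulr_sumr.
    by apply: eq_bigr => v _; rewrite mulrA.
  rewrite -!sum_weight [in RHS]mulr_suml [in RHS]mulr_suml mulr_sumr.
  rewrite big_seq [RHS]big_seq; apply: eq_bigr => u ua.
  rewrite mulr_sumr mulr_suml mulr_sumr big_seq [RHS]big_seq; apply: eq_bigr => v vb.
  by rewrite (size_words ua) (size_words vb) !mulrA.
have psge0 : 0 <= pair_sum a b.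
  do 2 apply: sumr_ge0 => ? _; rewrite mulr_ge0//; exact: pair_weight_ge0.
rewrite split_sum; apply: (@le_trans _ _ (\sum_(i <- iota 0 K)
   (tail mu i * pair_sum a b + \sum_(i' <- iota 0 K) tail mu (maxn i i') * g (a + b)))).
  rewrite big_seq [leRHS]big_seq; apply: ler_sum => i iK.
  rewrite (bigD1_seq i)//= ?iota_uniq// eqxx lerD2l.
  rewrite [leRHS](bigD1_seq i)//= ?iota_uniq// -[leLHS]add0r lerD//.
    by rewrite mulr_ge0// tail_ge0.
  apply: ler_sum => i' ii'; rewrite eq_sym (negPf ii') ler_wpM2l ?tail_ge0//.
  apply: (@le_trans _ _ (g (a.+1 + b.+1))); last by apply: g_noninc; lia.
  rewrite ler_piMl// mulr_ile1//; try by case/andP: (mass_pow a).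
    by case/andP: (mass_pow b).
  by case/andP: (mass_pow b).
rewrite big_split /= -mulr_suml lerD//; first by rewrite ler_piMl.
under eq_bigr do rewrite -mulr_suml.
by rewrite -mulr_suml ler_wpM2r.
Qed.

(** Passing from [h] to [h + 1] adds a row and a column, where one of the vertices is the root, and
    one [kappa] term: at most [2 + kappa] double sums for each possible depth of the last common
    ancestor. *)
Lemma tree_pair_sum_le H : \sum_(a < H) \sum_(b < H) pair_sum a b <=
  H%:R * ((2 + kappa) * \sum_(a < H) \sum_(b < H) g (a + b)).
Proof.
set D := \sum_(a < H) \sum_(b < H) g (a + b).
have D0 : 0 <= D by do 2 apply: sumr_ge0 => ? _.
have row h : (h <= H)%N -> \sum_(b < h) g b <= D.
  case: H @D D0 => [|H'] D D0 hH; first by rewrite leqn0 in hH; rewrite (eqP hH) big_ord0.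
  apply: (@le_trans _ _ (\sum_(b < H'.+1) g b)).
    rewrite -(big_mkord predT g) -(big_mkord predT g) (big_cat_nat (n := h) (p := H'.+1))//=.
    by rewrite lerDl sumr_ge0.
  rewrite /D [leRHS]big_ord_recl /= lerDl.
  by do 2 apply: sumr_ge0 => ? _.
have block h : (h <= H)%N -> \sum_(a < h) \sum_(b < h) g (a + b) <= D.
  have widen (f : nat -> R) n : (n <= H)%N -> (forall k, 0 <= f k) ->
      \sum_(k < n) f k <= \sum_(k < H) f k.
    move=> nH f0; rewrite -(big_mkord predT f) -(big_mkord predT f).
    by rewrite (big_cat_nat (n := n) (p := H))//= lerDl sumr_ge0.
  move=> hH; apply: (@le_trans _ _ (\sum_(a < h) \sum_(b < H) g (a + b))).
    by apply: ler_sum => a _; exact: (widen (fun b => g (a + b))).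
  by apply: (widen (fun a => \sum_(b < H) g (a + b))) => // a; exact: sumr_ge0.
suff main h : (h <= H)%N ->
    \sum_(a < h) \sum_(b < h) pair_sum a b <= h%:R * ((2 + kappa) * D) by exact: main.
elim: h => [|h IH] hH; first by rewrite big_ord0 mul0r.
rewrite big_ord_recl; under [X in _ + X]eq_bigr do rewrite big_ord_recl.
rewrite big_split /=.
have row0 : \sum_(b < h.+1) pair_sum 0 b <= D.
  by apply: le_trans (row _ hH); apply: ler_sum => b _; exact: pair_sum0r.
have col0 : \sum_(a < h) pair_sum (bump 0 a) 0 <= D.
  apply: le_trans (row _ (ltnW hH)); apply: ler_sum => a _.
  by apply: le_trans (pair_sumr0 _) _; apply: g_noninc; rewrite /bump; lia.
have rest : \sum_(a < h) \sum_(b < h) pair_sum (bump 0 a) (bump 0 b) <=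
    h%:R * ((2 + kappa) * D) + kappa * D.
  apply: (@le_trans _ _ (\sum_(a < h) \sum_(b < h) (pair_sum a b + kappa * g (a + b)))).
    by do 2 apply: ler_sum => ? _; exact: pair_sumSS.
  under eq_bigr do rewrite big_split /= -mulr_sumr.
  rewrite big_split /= -mulr_sumr lerD ?IH ?(ltnW hH)//.
  by rewrite ler_wpM2l// block// ltnW.
apply: le_trans (lerD row0 (lerD col0 rest)) _.
by rewrite -[h.+1%:R]natr1 le_eqVlt; apply/orP; left; apply/eqP; ring.
Qed.

End WordSums.

Section ForestSums.
Variables (R : realType) (mu : probability nat R) (K n h : nat).

Definition vertices : seq vertex :=
  [seq (j, u) | j <- iota 0 n, u <- flatten [seq words K a | a <- iota 0 h]].

Lemma mem_vertices x : x \in vertices -> (x.1 < n)%N.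
Proof. by move=> /allpairsP[[j u] /= [+ _ ->]]; rewrite mem_iota. Qed.

Lemma sum_vertices (f : vertex -> R) : \sum_(x <- vertices) f x =
  \sum_(j < n) \sum_(a < h) \sum_(u <- words K a) f (val j, u).
Proof.
rewrite /vertices big_flatten big_map -(big_mkord predT (fun j =>
  \sum_(a < h) \sum_(u <- words K a) f (j, u))) /index_iota subn0.
apply: eq_bigr => j _; rewrite big_map big_flatten big_map.
by rewrite -(big_mkord predT (fun a => \sum_(u <- words K a) f (j, u))) /index_iota subn0.
Qed.

Definition forest_mean : R := n%:R * \sum_(a < h) letter_mass mu K ^+ a.

Lemma sum_vertices_weight : \sum_(x <- vertices) weight mu x.2 = forest_mean.
Proof.
rewrite sum_vertices (eq_bigr (fun=> \sum_(a < h) letter_mass mu K ^+ a)); last first.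
  by move=> j _; apply: eq_bigr => a _; rewrite /= sum_weight.
by rewrite sumr_const card_ord /forest_mean mulr_natl.
Qed.

Variables (kappa : R) (g : nat -> R).
Hypothesis mass_le1 : letter_mass mu K <= 1.
Hypothesis kappaP :
  \sum_(i <- iota 0 K) \sum_(i' <- iota 0 K) tail mu (maxn i i') <= kappa.
Hypothesis g_ge0 : forall n, 0 <= g n.
Hypothesis g_noninc : forall m n, (m <= n)%N -> g n <= g m.

Definition forest_pair_sum : R := \sum_(x <- vertices) \sum_(y <- vertices)
  vertex_pair_weight mu x y * g (vertex_dist x y).

(** Pairs taken in two trees whose roots are at distance [k] on the spine; by independence the
    weights factorize. *)
Let off (k : nat) : R := \sum_(a < h) \sum_(b < h)
  letter_mass mu K ^+ a * letter_mass mu K ^+ b * g (k + (a + b)).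

Let off_ge0 k : 0 <= off k.
Proof.
by do 2 apply: sumr_ge0 => ? _; rewrite !mulr_ge0// exprn_ge0// letter_mass_ge0.
Qed.

Lemma forest_pair_sum_split : forest_pair_sum <=
  n%:R * (h%:R * ((2 + kappa) * \sum_(a < h) \sum_(b < h) g (a + b))) +
  \sum_(j < n) \sum_(j' < n) off (maxn j j' - minn j j').
Proof.
have diag (j : 'I_n) : \sum_(a < h) \sum_(u <- words K a) \sum_(b < h) \sum_(v <- words K b)
   vertex_pair_weight mu (val j, u) (val j, v) * g (vertex_dist (val j, u) (val j, v)) <=
   h%:R * ((2 + kappa) * \sum_(a < h) \sum_(b < h) g (a + b)).
  apply: le_trans (tree_pair_sum_le mass_le1 kappaP g_ge0 g_noninc h).
  apply: ler_sum => a _; rewrite exchange_big; apply: ler_sum => b _.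
  apply: ler_sum => u _; apply: ler_sum => v _.
  by rewrite /vertex_pair_weight /vertex_dist /= eqxx.
have offd (j j' : 'I_n) : j != j' ->
   \sum_(a < h) \sum_(u <- words K a) \sum_(b < h) \sum_(v <- words K b)
   vertex_pair_weight mu (val j, u) (val j', v) * g (vertex_dist (val j, u) (val j', v)) =
   off (maxn j j' - minn j j').
  move=> jj'; apply: eq_bigr => a _; rewrite exchange_big; apply: eq_bigr => b _ /=.
  rewrite -!sum_weight -[RHS]mulrA [RHS]mulr_suml.
  rewrite big_seq [RHS]big_seq; apply: eq_bigr => u ua.
  rewrite mulr_suml mulr_sumr big_seq [RHS]big_seq; apply: eq_bigr => v vb.
  rewrite /vertex_pair_weight /vertex_dist /= (negPf (_ : val j != val j'))//.
  by rewrite (size_words ua) (size_words vb) mulrA.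
rewrite /forest_pair_sum sum_vertices.
apply: (@le_trans _ _ (\sum_(j < n)
   (h%:R * ((2 + kappa) * \sum_(a < h) \sum_(b < h) g (a + b)) +
    \sum_(j' < n) off (maxn j j' - minn j j')))); last first.
  by rewrite big_split /= lerD2r sumr_const card_ord -[leLHS]mulr_natl.
apply: ler_sum => j _.
rewrite [leLHS](_ : _ = \sum_(j' < n) \sum_(a < h) \sum_(u <- words K a) \sum_(b < h)
   \sum_(v <- words K b)
   vertex_pair_weight mu (val j, u) (val j', v) * g (vertex_dist (val j, u) (val j', v))).
  rewrite (bigD1 j)//= lerD ?diag// [leRHS](bigD1 j)//= -[leLHS]add0r lerD//.
  by apply: ler_sum => j' jj'; rewrite offd// eq_sym.
rewrite [RHS]exchange_big; apply: eq_bigr => a _; rewrite [RHS]exchange_big.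
by apply: eq_bigr => u _; rewrite sum_vertices.
Qed.

End ForestSums.

Section PowerDecaySums.
Variables (R : realType) (C s : R).
Hypotheses (C_ge0 : 0 <= C) (s_gt0 : 0 < s) (s_lt2 : s < 2).
Let g (k : nat) : R := C * k.+1%:R `^ (- s).

Let sum_pow (t : R) (m : nat) : 0 < t < 1 ->
  \sum_(k < m) k.+1%:R `^ (- t) <= 2 / (1 - t) * m%:R `^ (1 - t) :> R.
Proof.
move=> /andP[t0 t1]; have t' : 0 < 1 - t <= 1 by apply/andP; split; lra.
have := sum_powRN_le m t'.
by rewrite (_ : 1 - t - 1 = - t)//; lra.
Qed.

(** Since [(a + 1) (b + 1) <= (a + b + 1)^2], the summand is at most a product of two powers of
    exponent [- s / 2]; the double sum factorizes, and [s < 2] keeps these exponents above [- 1]. *)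
Lemma double_sum_powRN_le (m : nat) : \sum_(a < m) \sum_(b < m) g (a + b) <=
  C * ((2 / (1 - s / 2)) ^+ 2 * m%:R `^ (2 - s)).
Proof.
have s0 := s_gt0; have s2 := s_lt2.
have t01 : 0 < s / 2 < 1 by apply/andP; split; lra.
apply: (@le_trans _ _ (C * (\sum_(a < m) a.+1%:R `^ (- (s / 2))) ^+ 2)).
  rewrite expr2 mulr_suml mulr_sumr; apply: ler_sum => a _.
  rewrite mulr_sumr mulr_sumr; apply: ler_sum => b _.
  rewrite ler_wpM2l// -powRM// (_ : - s = 2 * (- (s / 2))); last by field.
  rewrite powRrM; apply: ler_powRN; [by rewrite !mulr_gt0| |by case/andP: t01 => /ltW].
  rewrite powR_mulrn// -!natrM -natrX ler_nat; nia.
rewrite ler_wpM2l//; have -> : m%:R `^ (2 - s) = (m%:R `^ (1 - s / 2)) ^+ 2 :> R.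
  by rewrite -powR_mulrn ?powR_ge0// -powRrM; congr (_ `^ _); field.
rewrite -exprMn lerXn2r ?nnegrE ?sum_pow//.
  by apply: sumr_ge0 => *; exact: powR_ge0.
by rewrite mulr_ge0 ?powR_ge0// divr_ge0//; lra.
Qed.

(** The same factorization, now from [(k + 1) (a + 1) (b + 1) <= (k + a + b + 1)^3]. *)
Lemma triple_sum_powRN_le (m : nat) : \sum_(k < m) \sum_(a < m) \sum_(b < m) g (k + (a + b)) <=
  C * ((2 / (1 - s / 3)) ^+ 3 * m%:R `^ (3 - s)).
Proof.
have s0 := s_gt0; have s2 := s_lt2.
have t01 : 0 < s / 3 < 1 by apply/andP; split; lra.
apply: (@le_trans _ _ (C * (\sum_(a < m) a.+1%:R `^ (- (s / 3))) ^+ 3)).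
  rewrite (exprS _ 2) expr2 mulr_suml mulr_sumr; apply: ler_sum => k _.
  rewrite mulr_suml !mulr_sumr; apply: ler_sum => a _.
  rewrite !mulr_sumr; apply: ler_sum => b _.
  rewrite ler_wpM2l// -!powRM ?mulr_ge0// (_ : - s = 3 * (- (s / 3))); last by field.
  rewrite powRrM; apply: ler_powRN; [by rewrite !mulr_gt0| |by case/andP: t01 => /ltW].
  rewrite powR_mulrn// -!natrM -natrX ler_nat.
  rewrite !expnS expn0 muln1; apply: leq_mul; first lia.
  by apply: leq_mul; lia.
rewrite ler_wpM2l//; have -> : m%:R `^ (3 - s) = (m%:R `^ (1 - s / 3)) ^+ 3 :> R.
  by rewrite -powR_mulrn ?powR_ge0// -powRrM; congr (_ `^ _); field.
rewrite -exprMn lerXn2r ?nnegrE ?sum_pow//.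
  by apply: sumr_ge0 => *; exact: powR_ge0.
by rewrite mulr_ge0 ?powR_ge0// divr_ge0//; lra.
Qed.

End PowerDecaySums.

Section ForestBounds.
Variables (R : realType) (mu : probability nat R) (K n h : nat) (kappa : R).
Hypothesis mass_le1 : letter_mass mu K <= 1.
Hypothesis kappaP :
  \sum_(i <- iota 0 K) \sum_(i' <- iota 0 K) tail mu (maxn i i') <= kappa.

Let kappa_ge0 : 0 <= kappa.
Proof. by apply: le_trans kappaP; do 2 apply: sumr_ge0 => ? _; exact: tail_ge0. Qed.

(** With [g = 1], pairs in distinct trees give at most the squared mean. Each tree contributes [h]
    depths of the last common ancestor times [h^2] pairs of relative heights, whence [h^3]. *)
Lemma forest_second_moment_le :
  forest_pair_sum mu K n h (fun=> 1) <=
  forest_mean mu K n h ^+ 2 + (2 + kappa) * n%:R * h%:R ^+ 3.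
Proof.
apply: le_trans (forest_pair_sum_split n h mass_le1 kappaP _ _) _ => //.
rewrite addrC lerD//.
  rewrite (eq_bigr (fun=> n%:R * (\sum_(a < h) letter_mass mu K ^+ a) ^+ 2)); last first.
    move=> j _; rewrite (eq_bigr (fun=> (\sum_(a < h) letter_mass mu K ^+ a) ^+ 2)); last first.
      move=> j' _; rewrite expr2 mulr_suml; apply: eq_bigr => a _.
      by rewrite mulr_sumr; apply: eq_bigr => b _; rewrite mulr1.
    by rewrite sumr_const card_ord mulr_natl.
  by rewrite sumr_const card_ord -[leLHS]mulr_natl mulrA -expr2 -exprMn.
rewrite (eq_bigr (fun=> h%:R)); last by move=> a _; rewrite sumr_const card_ord.
rewrite sumr_const card_ord -[h%:R *+ h]mulr_natl le_eqVlt; apply/orP; left.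
by apply/eqP; ring.
Qed.

Lemma sum_dist_le (c : nat -> R) (j : 'I_n) : (forall k, 0 <= c k) ->
  \sum_(j' < n) c (maxn j j' - minn j j')%N <= 2 * \sum_(k < n) c k.
Proof.
move=> c0; have widen m : (m <= n)%N -> \sum_(0 <= k < m) c k <= \sum_(k < n) c k.
  move=> mn; rewrite -(big_mkord predT c) (big_cat_nat (n := m) (p := n))//=.
  by rewrite lerDl sumr_ge0.
rewrite -(big_mkord predT (fun j' => c (maxn j j' - minn j j')%N)).
rewrite (big_cat_nat (n := j))//=; last exact: ltnW.
rewrite mulr_natl mulr2n; apply: lerD.
  rewrite big_nat_rev add0n; apply: le_trans (widen j.+1 (ltn_ord j)).
  rewrite [leRHS]big_nat_recl//= -[leLHS]add0r lerD// big_nat_cond [leRHS]big_nat_cond.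
  apply: ler_sum => k /andP[/andP[_ kj] _].
  by rewrite (_ : (maxn j (j - k.+1) - minn j (j - k.+1))%N = k.+1)//; lia.
apply: le_trans (widen (n - j)%N (leq_subr _ _)).
rewrite -{1}(add0n (val j)) big_addn big_nat_cond [leRHS]big_nat_cond.
apply: ler_sum => k _.
by rewrite (_ : (maxn j (k + j) - minn j (k + j))%N = k)//; lia.
Qed.

Variables (C s : R).
Hypotheses (C_ge0 : 0 <= C) (s_gt0 : 0 < s) (s_lt2 : s < 2).
Hypotheses (h_gt0 : (0 < h)%N) (h_le : (h <= n)%N).

Let g (k : nat) : R := C * k.+1%:R `^ (- s).

(** The first summand stands for pairs in one tree, the second for pairs in two trees, where the
    leading 2 comes from [sum_dist_le]. *)
Definition energy_constant : R :=
  C * ((2 + kappa) * (2 / (1 - s / 2)) ^+ 2 + 2 * (2 / (1 - s / 3)) ^+ 3).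

(** One tree costs [h h^(2 - s)]; a fixed tree paired with all the others costs [n^(3 - s)]. As
    [h <= n], both become [O(n^(4 - s))] after summation over the [n] trees. *)
Lemma forest_energy_le :
  forest_pair_sum mu K n h g <= energy_constant * n%:R `^ (4 - s).
Proof.
have g_ge0 k : 0 <= g k by rewrite mulr_ge0 ?powR_ge0.
have g_noninc k l : (k <= l)%N -> g l <= g k.
  by move=> kl; rewrite ler_wpM2l// ler_powRN ?ltr0n ?ler_nat ?ltW.
have n0 : (0 < n)%N by exact: leq_trans h_le.
have nR0 : 0 < (n%:R : R) by rewrite ltr0n.
have npow (r : R) : n%:R * n%:R `^ r = n%:R `^ (1 + r) :> R.
  by rewrite powRD ?powRr1// ?(gt_eqF nR0) ?implybT.
have grow (f : nat -> R) m : (m <= n)%N -> (forall k, 0 <= f k) ->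
    \sum_(k < m) f k <= \sum_(k < n) f k.
  move=> mn f0; rewrite -(big_mkord predT f) -(big_mkord predT f).
  by rewrite (big_cat_nat (n := m) (p := n))//= lerDl sumr_ge0.
have powh r : 0 <= r -> h%:R `^ r <= n%:R `^ r :> R.
  by move=> r0; rewrite ge0_ler_powR ?nnegrE// ler_nat.
apply: le_trans (forest_pair_sum_split n h mass_le1 kappaP g_ge0 g_noninc) _.
have -> : energy_constant * n%:R `^ (4 - s) =
    n%:R * (n%:R * ((2 + kappa) * (C * ((2 / (1 - s / 2)) ^+ 2 * n%:R `^ (2 - s))))) +
    n%:R * (2 * (C * ((2 / (1 - s / 3)) ^+ 3 * n%:R `^ (3 - s)))).
  have -> : 4 - s = 1 + (3 - s) by lra.
  rewrite -npow; have -> : 3 - s = 1 + (2 - s) by lra.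
  by rewrite -npow /energy_constant; ring.
have k2 : 0 <= 2 + kappa by rewrite addr_ge0.
apply: lerD.
  rewrite ler_pM2l//; apply: ler_pM => //; last 1 first.
  - rewrite ler_wpM2l//; apply: le_trans (double_sum_powRN_le C_ge0 s_gt0 s_lt2 h) _.
    by rewrite ler_wpM2l// ler_wpM2l ?sqr_ge0// powh// subr_ge0 ltW.
  - by rewrite mulr_ge0//; do 2 apply: sumr_ge0 => ? _.
  - by rewrite ler_nat.
rewrite [leRHS](_ : _ = \sum_(j < n) (2 * (C * ((2 / (1 - s / 3)) ^+ 3 * n%:R `^ (3 - s)))));
  last by rewrite sumr_const card_ord mulr_natl.
apply: ler_sum => j _.
pose off k := \sum_(a < h) \sum_(b < h)
  letter_mass mu K ^+ a * letter_mass mu K ^+ b * g (k + (a + b)).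
apply: le_trans (sum_dist_le (c := off) j _) _.
  by move=> k; do 2 apply: sumr_ge0 => ? _; rewrite !mulr_ge0// exprn_ge0// letter_mass_ge0.
rewrite ler_wpM2l//; apply: le_trans (triple_sum_powRN_le C_ge0 s_gt0 s_lt2 n); apply: ler_sum => k _.
have mass0 := letter_mass_ge0 mu K.
apply: (@le_trans _ _ (\sum_(a < h) \sum_(b < h) g (k + (a + b)))).
  do 2 apply: ler_sum => ? _; rewrite ler_piMl// mulr_ile1// ?exprn_ge0//;
  by rewrite exprn_ile1.
apply: (@le_trans _ _ (\sum_(a < h) \sum_(b < n) g (k + (a + b)))).
  by apply: ler_sum => a _; exact: (grow (fun b => g (k + (a + b)))).
by apply: (grow (fun a => \sum_(b < n) g (k + (a + b)))) => // a; exact: sumr_ge0.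
Qed.

End ForestBounds.

(** * Number of points below a given height and their mean energy *)

Section LowerEvent.
Local Open Scope ereal_scope.
Variables (dT : measure_display) (T : measurableType dT) (R : realType) (d : nat).
Variables (P : probability T R) (mu : probability nat R) (theta : probability (Zd d) R).
Variables (N : vertex -> {RV P >-> nat}) (X : vertex -> {RV P >-> Zd d}).
Hypothesis hNX : igw_brw mu theta N X.
Hypothesis theta_sym : symmetric_law theta.

Lemma markov_ge (f : T -> \bar R) (c : R) : measurable_fun setT f ->
  (forall t, 0 <= f t) -> (0 <= c)%R ->
  measurable [set t | c%:E <= f t] /\ c%:E * P [set t | c%:E <= f t] <= \int[P]_t f t.
Proof.
move=> mf f0 c0; have mB : measurable [set t | c%:E <= f t].
  by rewrite -[X in measurable X]setTI; exact: emeasurable_fun_c_infty.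
split=> //; rewrite -(integral_cst P mB).
apply: le_trans (_ : \int[P]_(t in [set t | c%:E <= f t]) f t <= _).
  by apply: ge0_le_integral => //; exact: measurable_funTS.
exact: ge0_subset_integral.
Qed.

Variables (K n h : nat).
Let V := vertices K n h.
Let A x := alive_vertex N x.

Let mA x : measurable (A x).
Proof. exact: (@alive_vertex_measurable _ _ _ _ _ N X). Qed.

Definition alive_count (t : T) : R := (\sum_(x <- V) \1_(A x) t)%R.

Lemma alive_count_ge0 t : (0 <= alive_count t)%R.
Proof. by apply: sumr_ge0 => x _; rewrite indicE. Qed.

Let measurable_count : measurable_fun setT alive_count.
Proof. by apply: measurable_sum => x; exact: measurable_indic. Qed.

Let int_count : \int[P]_t (alive_count t)%:E = (forest_mean mu K n h)%:E.
Proof.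
under eq_integral do rewrite -sumEFin.
rewrite ge0_integral_sum//; last first.
  by move=> x; apply/measurable_EFinP; exact: measurable_indic.
rewrite -sum_vertices_weight -sumEFin; apply: eq_bigr => x _.
by rewrite integral_indic// setIT; exact: (probability_alive hNX).
Qed.

Let int_count2 : \int[P]_t ((alive_count t ^+ 2)%R)%:E =
  (forest_pair_sum mu K n h (fun=> 1%R))%:E.
Proof.
have sqrE t : ((alive_count t ^+ 2)%R)%:E =
    \sum_(x <- V) \sum_(y <- V) (\1_(A x `&` A y) t)%:E.
  rewrite expr2 /alive_count mulr_suml -sumEFin; apply: eq_bigr => x _.
  by rewrite mulr_sumr -sumEFin; apply: eq_bigr => y _; rewrite indicI.
have mI x y : measurable_fun setT (fun t => (\1_(A x `&` A y) t)%:E : \bar R).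
  by apply/measurable_EFinP; apply: measurable_indic; exact: measurableI.
under eq_integral do rewrite sqrE.
rewrite ge0_integral_sum//; last first.
- by move=> x t _; apply: sume_ge0 => y _; rewrite lee_fin indicE.
- by move=> x; apply: emeasurable_sum => y; exact: mI.
rewrite /forest_pair_sum -sumEFin; apply: eq_bigr => x _.
rewrite ge0_integral_sum// -sumEFin; apply: eq_bigr => y _.
rewrite integral_indic//; last exact: measurableI.
by rewrite setIT mulr1; exact: (probability_alive_vertices hNX).
Qed.

Variable kappa : R.
Hypothesis mass_le1 : (letter_mass mu K <= 1)%R.
Hypothesis kappaP :
  (\sum_(i <- iota 0 K) \sum_(i' <- iota 0 K) tail mu (maxn i i') <= kappa)%R.

Let m := forest_mean mu K n h.

Let m_ge0 : (0 <= m)%R.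
Proof. by rewrite mulr_ge0// sumr_ge0// => a _; rewrite exprn_ge0// letter_mass_ge0. Qed.

Lemma alive_count_variance_le :
  \int[P]_t (((alive_count t - m) ^+ 2)%R)%:E <= ((2 + kappa) * n%:R * h%:R ^+ 3)%:E.
Proof.
have mdev : measurable_fun setT (fun t => (((alive_count t - m) ^+ 2)%R)%:E).
  by apply/measurable_EFinP; apply: measurable_funX; apply: measurable_funB.
have mc : measurable_fun setT (fun t => (alive_count t)%:E) by exact/measurable_EFinP.
have mc2 : measurable_fun setT (fun t => ((alive_count t ^+ 2)%R)%:E).
  by apply/measurable_EFinP; exact: measurable_funX.
set V2 := \int[P]_t _.
(* Stated as an addition, so that nothing is subtracted in the extended reals before [V2] is known
   to be finite. *)
have : V2 + (2 * m * m)%:E = (forest_pair_sum mu K n h (fun=> 1%R) + m ^+ 2)%:E.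
  rewrite EFinD -int_count2 [in LHS]EFinM -int_count -ge0_integralZl//; last 2 first.
    by move=> t _; rewrite lee_fin alive_count_ge0.
    by rewrite lee_fin mulr_ge0.
  have -> : ((m ^+ 2)%R)%:E = \int[P]_t (cst ((m ^+ 2)%R)%:E t).
    by rewrite integral_cst// [X in _ * X](probability_setT P) mule1.
  have lin0 t : [set: T] t -> 0 <= (2 * m)%:E * (alive_count t)%:E.
    move=> _; apply: mule_ge0; rewrite lee_fin.
    exact: mulr_ge0.
  exact: alive_count_ge0.
  rewrite -!ge0_integralD//; try exact: measurable_funeM;
    try by move=> t _; rewrite lee_fin sqr_ge0.
  by apply: eq_integral => t _; rewrite -EFinM -!EFinD; congr EFin; ring.
have V20 : 0 <= V2 by apply: integral_ge0 => t _; rewrite lee_fin sqr_ge0.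
case: V2 V20 => [v| |]//= _; rewrite -EFinD => -[vE].
rewrite lee_fin; have := forest_second_moment_le n h mass_le1 kappaP.
rewrite -/m; move: (forest_pair_sum _ _ _ _ _) vE => Q vE.
have -> : v = (Q - m ^+ 2)%R by rewrite -[v](addrK (2 * m * m)%R) vE; ring.
by rewrite lerBlDl.
Qed.

(** Chebyshev at distance [m / 2] from the mean, whence the factor 4. *)
Lemma alive_count_small : (0 < m)%R ->
  exists2 B : set T, measurable B /\
    P B <= (4 * ((2 + kappa) * n%:R * h%:R ^+ 3) / m ^+ 2)%:E &
    forall t, ~ B t -> (m / 2 <= alive_count t)%R.
Proof.
move=> m0; have mdev : measurable_fun setT (fun t => (((alive_count t - m) ^+ 2)%R)%:E).
  by apply/measurable_EFinP; apply: measurable_funX; apply: measurable_funB.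
have c0 : (0 < m ^+ 2 / 4)%R by rewrite divr_gt0// exprn_gt0.
have [t|] := markov_ge mdev _ (ltW c0); first by rewrite lee_fin sqr_ge0.
set B := [set t | _] => mB PB; exists B; first split => //.
  have := le_trans PB alive_count_variance_le.
  rewrite muleC -lee_pdivlMr// -EFinM => /le_trans; apply; rewrite lee_fin.
  by rewrite le_eqVlt; apply/orP; left; apply/eqP; field; rewrite gt_eqF.
move=> t nB; rewrite leNgt; apply/negP => lt; apply: nB; rewrite /B /= lee_fin.
have -> : (m ^+ 2 / 4 = (m / 2) ^+ 2)%R by field.
rewrite -[leRHS]real_normK ?num_real// lerXn2r ?nnegrE ?divr_ge0//.
rewrite distrC; apply: le_trans (ler_norm _); rewrite lerBrDr -lerBrDl.
by apply: le_trans (ltW lt) _; rewrite le_eqVlt; apply/orP; left; apply/eqP; field.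
Qed.

Variables (G : Zd d -> \bar R) (C s : R).
Hypothesis G_ge0 : forall z, 0 <= G z.
Hypotheses (C_ge0 : (0 <= C)%R) (s_gt0 : (0 < s)%R) (s_lt2 : (s < 2)%R).
Hypotheses (h_gt0 : (0 < h)%N) (h_le : (h <= n)%N).
Hypothesis G_average : forall k,
  \esum_(z in [set: Zd d]) (conv_power (mass_function theta) k z * G z) <=
  (C * k.+1%:R `^ (- s))%:E.

Definition alive_points (t : T) : seq (Zd d) :=
  [seq position X t x | x <- [seq x <- V | `[< A x t >]]].

Lemma size_alive_points t : (size (alive_points t))%:R = alive_count t :> R.
Proof.
rewrite /alive_points size_map size_filter -sum1_count natr_sum big_mkcond.
rewrite /alive_count; apply: eq_bigr => x _; rewrite indicE.
have [Ax|nAx] := asboolP (A x t); first by rewrite mem_set.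
by rewrite memNset.
Qed.

(** [W] rewrites the energy of a random list as a finite sum, over fixed pairs of labels, of
    functions restricted to the event that both labels are vertices; this gives measurability and
    the integral. *)
Lemma alive_points_energy : exists2 W : T -> \bar R,
  [/\ measurable_fun setT W, forall t, 0 <= W t &
      \int[P]_t W t <= (energy_constant kappa C s * n%:R `^ (4 - s))%:E] &
  forall t, \sum_(y <- alive_points t) \sum_(x <- alive_points t) G (y - x)%R = W t.
Proof.
pose f x y := (fun t => G (position X t y - position X t x)%R) \_ (A x `&` A y).
have f0 x y t : 0 <= f x y t by rewrite /f patchE; case: ifP.
have mf x y : measurable_fun setT (f x y).
  apply/(measurable_restrict _ (measurableI _ _ (mA x) (mA y)) measurableT) => //.
  apply: measurable_funTS.
  have -> : (fun t => G (position X t y - position X t x)%R) =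
      G \o signed_sum X (vertex_diff x y).
    by apply/funext => t /=; rewrite signed_sum_vertex_diff.
  move=> _ B _; rewrite setTI.
  apply: (@preimage_countable_measurable _ _ _ _ _ (G @^-1` B)) => z.
  exact: (@signed_sum_measurable _ _ _ _ _ N).
exists (fun t => \sum_(y <- V) \sum_(x <- V) f x y t); first split.
- by apply: emeasurable_sum => y; apply: emeasurable_sum => x; exact: mf.
- by move=> t; do 2 apply: sume_ge0 => ? _.
- rewrite ge0_integral_sum//; last first.
  + by move=> y t _; apply: sume_ge0 => x _.
  + by move=> y; apply: emeasurable_sum => x; exact: mf.
  apply: le_trans (_ : (forest_pair_sum mu K n h (fun k => (C * k.+1%:R `^ (- s))%R))%:E <= _);
    last by rewrite lee_fin forest_energy_le.
  rewrite /forest_pair_sum exchange_big /= -sumEFin; apply: lee_sum => y _.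
  rewrite ge0_integral_sum// -sumEFin; apply: lee_sum => x _.
  rewrite -integral_mkcond (expectation_vertices hNX theta_sym)// EFinM.
  by rewrite lee_wpmul2l// lee_fin vertex_pair_weight_ge0.
move=> t; rewrite /alive_points big_map big_filter big_mkcond; apply: eq_bigr => y _.
have [Ay|nAy] := asboolP (A y t).
  rewrite big_map big_filter big_mkcond; apply: eq_bigr => x _ /=.
  have [Ax|nAx] := asboolP (A x t); first by rewrite /f patchE mem_set.
  by rewrite /f patchE memNset// => -[].
by rewrite big1// => x _; rewrite /f patchE memNset// => -[].
Qed.

End LowerEvent.

Lemma sum_iota_lt (R : pzSemiRingType) K k : (\sum_(i <- iota 0 K) (i < k)%N%:R = (minn k K)%:R :> R)%R.
Proof.
elim: K => [|K IH]; first by rewrite big_nil minn0.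
rewrite -addn1 iotaD big_cat /= big_seq1 IH add0n -natrD.
by congr (_%:R)%R; case: (ltnP K k) => /= Kk; lia.
Qed.

(** * Survival and displacement *)

Section Offspring.
Local Open Scope ereal_scope.
Variables (R : realType) (mu : probability nat R).
Hypothesis mu_mean : offspring_mean mu = 1.
Hypothesis mu_variance : offspring_variance mu < +oo.

Lemma integral_nat (g : nat -> \bar R) : (forall k, 0 <= g k) ->
  \int[mu]_k g k = \esum_(k in [set: nat]) (mu [set k] * g k).
Proof.
move=> g0; have mid (k : nat) : measurable (id @^-1` [set k]) by [].
rewrite (integral_countable mu mid)//.
by apply: eq_esum => z _; rewrite setTI muleC.
Qed.

Lemma mean_esum : \esum_(k in [set: nat]) (mu [set k] * (k%:R)%:E) = 1.
Proof. by rewrite -mu_mean /offspring_mean integral_nat// => k; rewrite lee_fin. Qed.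

Lemma measure_nat_esum (A : set nat) :
  mu A = \esum_(k in [set: nat]) (mu [set k] * (\1_A k)%:E).
Proof.
rewrite -integral_nat; last by move=> k; rewrite lee_fin indicE.
by rewrite integral_indic// setIT.
Qed.

Lemma second_moment_nat_finite :
  \esum_(k in [set: nat]) (mu [set k] * ((k%:R ^+ 2)%R)%:E) < +oo.
Proof.
apply: (@le_lt_trans _ _ (\esum_(k in [set: nat])
  ((2%:E * (mu [set k] * (((k%:R - 1) ^+ 2)%R)%:E)) + mu [set k] * 2%:E))).
  apply: le_esum => k _.
  rewrite muleCA -ge0_muleDr ?mule_ge0 ?lee_fin ?sqr_ge0//.
  rewrite lee_wpmul2l// -EFinM -EFinD lee_fin.
  (* [k^2 <= 2 (k - 1)^2 + 2] amounts to [(k - 2)^2 >= 0]; as the mean is 1, the variance controls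
     [(k - 1)^2]. *)
  by have := sqr_ge0 (k%:R - 2 : R)%R; nra.
rewrite esumD; last 2 first.
  by move=> k _; rewrite !mule_ge0// lee_fin ?sqr_ge0.
  by move=> k _; rewrite mule_ge0// lee_fin.
rewrite esumZl ?lee_fin//; last by move=> k; rewrite mule_ge0// lee_fin sqr_ge0.
rewrite -!integral_nat; last 2 first.
  by move=> k; rewrite lee_fin.
  by move=> k; rewrite lee_fin sqr_ge0.
move: mu_variance; rewrite /offspring_variance mu_mean /= => v.
rewrite lte_add_pinfty ?lte_mul_pinfty ?lee_fin//.
by rewrite (integral_cst mu)// lte_mul_pinfty ?lee_fin// [X in X < _](probability_setT mu) ltry.
Qed.

Definition offspring_second_moment : R :=
  fine (\esum_(k in [set: nat]) (mu [set k] * ((k%:R ^+ 2)%R)%:E)).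

Let tailE i : (tail mu i)%:E = \esum_(k in [set: nat]) (mu [set k] * ((i < k)%N%:R)%:E).
Proof.
rewrite /tail fineK ?fin_num_measure// measure_nat_esum.
apply: eq_esum => k _; rewrite indicE; congr (_ * (_%:R)%:E).
by have [ik|ik] := boolP (i < k)%N; [rewrite mem_set|rewrite memNset//; exact/negP].
Qed.

Lemma letter_massE K : (letter_mass mu K)%:E =
  \esum_(k in [set: nat]) (mu [set k] * ((minn k K)%:R)%:E).
Proof.
rewrite /letter_mass -sumEFin (eq_bigr _ (fun i _ => tailE i)).
rewrite -esum_sum; last by move=> k i _ _; rewrite mule_ge0// lee_fin.
apply: eq_esum => k _; rewrite -ge0_sume_distrr; last by move=> i _; rewrite lee_fin.
by rewrite sumEFin sum_iota_lt.
Qed.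

Lemma letter_mass_le1 K : (letter_mass mu K <= 1)%R.
Proof.
rewrite -lee_fin letter_massE -mean_esum; apply: le_esum => k _.
by rewrite lee_wpmul2l// lee_fin ler_nat geq_minl.
Qed.

(** Finitely many values already carry more than [1 - e] of the mean; a bound on these values serves
    as [K]. *)
Lemma letter_mass_near1 (e : R) : (0 < e)%R -> exists K, (1 - e <= letter_mass mu K)%R.
Proof.
move=> e0; have : (1 - e)%:E < \esum_(k in [set: nat]) (mu [set k] * (k%:R)%:E).
  by rewrite mean_esum lte_fin gtrBl.
move=> /ereal_sup_gt[_ [Y [finY _] <-]] lt.
have [M MY] : exists M, forall k, Y k -> (k <= M)%N.
  exists (\max_(k <- finmap.enum_fset (fset_set Y)) k)%N => k Yk.
  by apply: leq_bigmax_seq => //; rewrite in_fset_set// inE.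
exists M; rewrite -lee_fin letter_massE; apply: le_trans (ltW lt) _.
rewrite -esum_fset//; last by move=> k _; rewrite mule_ge0// lee_fin.
apply: (@le_trans _ _ (\esum_(k in Y) (mu [set k] * ((minn k M)%:R)%:E))).
  by apply: le_esum => k Yk; rewrite lee_wpmul2l// lee_fin ler_nat leq_min leqnn MY.
by apply: esum_sub => // k _; rewrite mule_ge0// lee_fin.
Qed.

(** There are [(minn k K)^2] pairs [i, i' < K] with maximum below [k], so the double sum is a
    truncated second moment. *)
Lemma tail_maxn_le K :
  (\sum_(i <- iota 0 K) \sum_(i' <- iota 0 K) tail mu (maxn i i') <=
     offspring_second_moment)%R.
Proof.
rewrite -lee_fin /offspring_second_moment fineK; last first.
  rewrite ge0_fin_numE ?second_moment_nat_finite//.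
  by apply: esum_ge0 => k _; rewrite mule_ge0// lee_fin sqr_ge0.
rewrite [leLHS](_ : _ = \esum_(k in [set: nat]) (mu [set k] * (((minn k K)%:R ^+ 2)%R)%:E)).
  apply: le_esum => k _; rewrite lee_wpmul2l// lee_fin lerXn2r ?nnegrE//.
  by rewrite ler_nat geq_minl.
rewrite -sumEFin; under eq_bigr do rewrite -sumEFin.
under eq_bigr do (under eq_bigr do rewrite tailE).
under eq_bigr do (rewrite -esum_sum; last by move=> *; rewrite mule_ge0// lee_fin).
rewrite -esum_sum; last by move=> *; apply: sume_ge0 => *; rewrite mule_ge0// lee_fin.
apply: eq_esum => k _.
under eq_bigr do (rewrite -ge0_sume_distrr; last by move=> *; rewrite lee_fin).
rewrite -ge0_sume_distrr; last by move=> *; apply: sume_ge0 => *; rewrite lee_fin.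
congr (_ * _); rewrite expr2 -sum_iota_lt mulr_suml -sumEFin; apply: eq_bigr => i _.
rewrite mulr_sumr -sumEFin; apply: eq_bigr => i' _.
by rewrite -natrM gtn_max mulnb.
Qed.

Hypothesis mu_nontrivial : (mu : set nat -> \bar R) <> \d_1%N.

(** A law of mean 1 without mass above 1 carries all its mean, hence all its mass, at 1. *)
Lemma branching_gt0 : (0 < tail mu 1)%R.
Proof.
rewrite lt0r tail_ge0 andbT; apply/eqP => t0; apply: mu_nontrivial.
have mu2 : mu [set k | (1 < k)%N] = 0.
  by have := congr1 EFin t0; rewrite /tail fineK ?fin_num_measure.
have mu_k k : (1 < k)%N -> mu [set k] = 0.
  move=> k1; apply/eqP; rewrite eq_le measure_ge0 andbT -mu2.
  by apply: le_measure; rewrite ?inE// => _ /= ->.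
have mu1 : mu [set 1%N] = 1.
  rewrite -mean_esum (esumID [set 1%N])/=; last by move=> k _; rewrite mule_ge0// lee_fin.
  rewrite setTI esum_set1 ?mule_ge0 ?lee_fin// mule1 esum1 ?adde0// => -[|[|k]] [_ /= k1].
  - by rewrite mule0.
  - by [].
  - by rewrite mu_k// mul0e.
apply/funext => A; rewrite diracE; have [A1|A1] := boolP (1%N \in A).
  apply/eqP; rewrite eq_le probability_le1// -mu1; apply: le_measure; rewrite ?inE//.
  by move=> _ ->; rewrite -inE.
apply/eqP; rewrite eq_le measure_ge0 andbT.
apply: (@le_trans _ _ (mu (~` [set 1%N]))).
  by apply: le_measure; rewrite ?inE// => k Ak /= k1; move: A1; rewrite -k1 mem_set.
by rewrite probability_setC// mu1 subee.
Qed.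

End Offspring.

(** * Survival probability up to a given height *)

Section Extinction.
Local Open Scope ereal_scope.
Variables (dT : measure_display) (T : measurableType dT) (R : realType) (d : nat).
Variables (P : probability T R) (mu : probability nat R) (theta : probability (Zd d) R).
Variables (N : vertex -> {RV P >-> nat}) (X : vertex -> {RV P >-> Zd d}).
Hypothesis hNX : igw_brw mu theta N X.

(** Fixing the number [k] of children displays the event as a countable union of finite
    intersections over independent subtrees. *)
Fixpoint extinct (H j : nat) (w : seq nat) : set T :=
  if H is H'.+1 then
    [set t | exists2 k, True & (N (j, w) @^-1` [set k] `&`
       \bigcap_(i in [set i | (i < k)%N]) extinct H' j (rcons w i)) t]
  else set0.

Lemma extinctP H j w t : extinct H j w t -> forall u, size u = H -> ~ alive N j w u t.
Proof.
elim: H w => [|H IH] w //= [k _ [/= Nk ext]] [|i u] //= [uH] [iN].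
by apply: IH => //; apply: ext; rewrite /= -Nk.
Qed.

Let field := tree_field N X.

Let extinct_sigma H j w : joint_sigma field (subtree_indices j w) (extinct H j w).
Proof.
elim: H w => [|H IH] w; first exact: joint_sigma_set0.
apply: joint_sigma_exists => k _; apply: joint_sigma_setI.
  apply: (joint_sigma_gen (i := inl (j, w))); first exact: root_subtree.
  exact: (@g_sigma_algebra_preimageP _ _ T nat (N (j, w)) [set k]).
apply: joint_sigma_bigcap => i _.
by apply: joint_sigmaS (IH (rcons w i)); exact: subtree_rcons.
Qed.

Lemma extinct_measurable H j w : measurable (extinct H j w).
Proof.
exact: (joint_sigma_measurable (@tree_field_measurable _ _ _ _ _ N X) (@extinct_sigma H j w)).
Qed.

(** The iterates, started at 0, of the generating function of [mu]. *)
Fixpoint extinction_probability (H : nat) : R :=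
  if H is H'.+1 then
    fine (\esum_(k in [set: nat]) (mu [set k] * ((extinction_probability H' ^+ k)%R)%:E))
  else 0%R.

Lemma probability_extinct H j w : P (extinct H j w) = (extinction_probability H)%:E.
Proof.
elim: H w => [|H IH] w; first exact: measure0.
pose children k := \bigcap_(i in [set i | (i < k)%N]) extinct H j (rcons w i).
pose child_indices k := [set a | exists2 i, (i < k)%N & subtree_indices j (rcons w i) a].
have children_sigma k : joint_sigma field (child_indices k) (children k).
  apply: joint_sigma_bigcap => i /= ik.
  by apply: joint_sigmaS (@extinct_sigma H j (rcons w i)) => a; exists i.
have P_children k : P (children k) = ((extinction_probability H ^+ k)%R)%:E.
  elim: k => [|k IHk].
    by rewrite /children (_ : \bigcap_(_ in _) _ = setT) ?probability_setT// -subTset => t _ i.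
  rewrite (_ : children k.+1 = children k `&` extinct H j (rcons w k)); last first.
    apply/seteqP; split => t.
      move=> ch; split; last exact: (ch k (ltnSn k)).
      by move=> i /= ik; apply: ch; exact: ltnW.
    by move=> [ch chk] i /=; rewrite ltnS leq_eqVlt => /predU1P[->//|/ch].
  rewrite (tree_field_independent hNX _ (@children_sigma k) (@extinct_sigma H j (rcons w k))).
    by rewrite IHk IH -EFinM exprSr.
  apply/seteqP; split => // a [[i ik ai] ak].
  have := @subtree_disjoint j w i k; rewrite (ltn_eqF ik) => /(_ isT) dis.
  have : (subtree_indices j (rcons w i) `&` subtree_indices j (rcons w k)) a by [].
  by rewrite dis.
have mN k : measurable (N (j, w) @^-1` [set k]) by exact: measurable_funPTI.
have value : P (extinct H.+1 j w) =
    \esum_(k in [set: nat]) (mu [set k] * ((extinction_probability H ^+ k)%R)%:E).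
  rewrite (measure_countable_partition P mN); last exact: extinct_measurable.
  apply: eq_esum => k _; rewrite -P_children -(law_N hNX (j, w)).
  rewrite -(tree_field_independent hNX (S := [set inl (j, w)]) (S' := child_indices k)).
  - congr (P _); apply/seteqP; split => t /=.
      by move=> [[k' _ [Nk' ch]] Nk]; split => //; rewrite -Nk Nk'.
    by move=> [Nk ch]; split => //; exists k.
  - apply/seteqP; split => // a [/= -> [i ik ai]].
    have : ([set inl (j, w)] `&` subtree_indices j (rcons w i)) (inl (j, w)) by [].
    by rewrite root_subtree_disjoint.
  - apply: (joint_sigma_gen (i := inl (j, w))) => //.
    exact: (@g_sigma_algebra_preimageP _ _ T nat (N (j, w)) [set k]).
  - exact: children_sigma.
by rewrite value /= fineK// -value fin_num_measure//; exact: extinct_measurable.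
Qed.

Hypothesis mu_mean : offspring_mean mu = 1.

Let q (H : nat) : R := (1 - extinction_probability H)%R.

Let q01 H : (0 <= q H <= 1)%R.
Proof.
have := probability_extinct H 0 [::]; set e := extinction_probability H => eP.
have : 0 <= e%:E <= 1 by rewrite -eP measure_ge0 probability_le1//; exact: extinct_measurable.
by rewrite !lee_fin /q -/e => /andP[e0 e1]; rewrite subr_ge0 e1 gerBl e0.
Qed.

(** Bernoulli's inequality with the gain [x^2] from [k = 2] on, where it is an equality. *)
Let bernoulli_ineq (x : R) k : (0 <= x <= 1)%R ->
  (1 + x ^+ 2 * (1 < k)%N%:R <= (1 - x) ^+ k + x * k%:R)%R.
Proof.
move=> /andP[x0 x1]; elim: k => [|[|k] IH].
- by rewrite ltn0 mulr0 addr0 expr0 mulr0 addr0.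
- by rewrite ltnn mulr0 addr0 expr1 mulr1 subrK.
- have [k0|k0] := posnP k; first by rewrite k0 /= mulr1; nra.
  have le1 : ((1 - x) ^+ k.+1 <= 1)%R by rewrite exprn_ile1//; lra.
  rewrite [(1 < k.+2)%N](_ : _ = true)// mulr1 (exprS (1 - x) k.+1) -[(k.+2)%:R]natr1.
  move: IH; rewrite [(1 < k.+1)%N](_ : _ = true)// mulr1.
  by move: ((1 - x) ^+ k.+1)%R le1 (k.+1%:R : R) => y le1 z IH; nra.
Qed.

(** Integrate [bernoulli_ineq] against [mu]: the mean being 1, the linear term has coefficient
    exactly 1, and the gain is weighted by the probability of at least two children. *)
Lemma survival_decrease H : (q H.+1 <= q H - tail mu 1 * q H ^+ 2)%R.
Proof.
have /andP[x0 x1] := q01 H; set x := q H in x0 x1 *.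
have eH : extinction_probability H = (1 - x)%R by rewrite /x /q; ring.
have fin : \esum_(k in [set: nat]) (mu [set k] * ((extinction_probability H ^+ k)%R)%:E) =
    (extinction_probability H.+1)%:E.
  rewrite /= fineK// ge0_fin_numE; last first.
    by apply: esum_ge0 => k _; rewrite mule_ge0// lee_fin exprn_ge0// eH; lra.
  apply: le_lt_trans (ltry 1); rewrite -(probability_setT mu) measure_nat_esum.
  apply: le_esum => k _; rewrite lee_wpmul2l// lee_fin indicT exprn_ile1// eH; lra.
have : (1 + tail mu 1 * x ^+ 2)%:E <= (extinction_probability H.+1 + x)%:E.
  rewrite [leRHS]EFinD -fin -[x%:E]mule1 -(mean_esum mu_mean).
  rewrite -esumZl ?lee_fin//; last by move=> k; rewrite mule_ge0// lee_fin.
  rewrite -esumD; last 2 first.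
    by move=> k _; rewrite mule_ge0// lee_fin exprn_ge0// eH; lra.
    by move=> k _; rewrite !mule_ge0// lee_fin.
  have -> : (1 + tail mu 1 * x ^+ 2)%:E =
      \esum_(k in [set: nat]) (mu [set k] * ((1 + x ^+ 2 * (1 < k)%N%:R)%R)%:E).
    transitivity (\esum_(k in [set: nat]) (mu [set k] * (\1_[set: nat] k)%:E +
       mu [set k] * (\1_[set k | (1 < k)%N] k)%:E * ((x ^+ 2)%R)%:E)).
      rewrite esumD; last 2 first.
        by move=> k _; rewrite mule_ge0// lee_fin indicE.
        by move=> k _; rewrite !mule_ge0// lee_fin ?indicE ?sqr_ge0.
      rewrite esumZr ?lee_fin ?sqr_ge0//; last by move=> k; rewrite mule_ge0// lee_fin indicE.
      rewrite -!measure_nat_esum [X in _ = X + _](probability_setT mu).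
      by rewrite /tail EFinD EFinM fineK ?fin_num_measure.
    apply: eq_esum => k _; rewrite indicT -muleA -ge0_muleDr ?lee_fin//; last first.
      by rewrite mulr_ge0 ?sqr_ge0// indicE.
    rewrite -EFinM -EFinD indicE mulrC; congr (_ * (1 + _ * (_%:R))%:E).
    by have [k1|k1] := boolP (1 < k)%N; [rewrite mem_set|rewrite memNset//; exact/negP].
  apply: le_esum => k _; rewrite muleCA -ge0_muleDr ?mule_ge0 ?lee_fin//; last first.
    by rewrite exprn_ge0// eH; lra.
  by rewrite lee_wpmul2l// -EFinM -EFinD lee_fin eH bernoulli_ineq// x0.
rewrite lee_fin /q; lra.
Qed.

(** The recursion [y <= x - c x^2] increases [1 / q] by at least [c] per generation; the product
    form covers a vanishing [q]. *)
Lemma survival_le H : (q H * (1 + tail mu 1 * H%:R) <= 1)%R.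
Proof.
have c0 := tail_ge0 mu 1; elim: H => [|H IH].
  by rewrite mulr0 addr0 mulr1; case/andP: (q01 0).
have /andP[x0 x1] := q01 H; have := survival_decrease H.
have c1 : (tail mu 1 <= 1)%R.
  by rewrite -lee_fin /tail fineK ?fin_num_measure// probability_le1.
move: (q H) (q H.+1) (tail mu 1) x0 x1 IH c0 c1 => x y c x0 x1 IH c0 c1 yx.
rewrite -natr1; have H0 : (0 <= H%:R :> R)%R by [].
move: (H%:R)%R H0 IH => z z0 IH.
have cz : (0 <= c * z)%R by exact: mulr_ge0.
apply: (@le_trans _ _ ((x - c * x ^+ 2) * (1 + c * (z + 1)))%R).
  by rewrite ler_wpM2r// addr_ge0// mulr_ge0// addr_ge0.
have : (x * (1 + c * z) * (1 - c * x) <= 1 - c * x)%R.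
  by rewrite ler_piMl//; nra.
have cx : (0 <= c * x * (c * x))%R by rewrite mulr_ge0// mulr_ge0.
nra.
Qed.

End Extinction.

(** * Exponential moments and large displacements *)

Section ExponentialTails.
Local Open Scope ereal_scope.
Variables (R : realType) (d : nat) (theta : probability (Zd d) R).
Hypothesis theta_sym : symmetric_law theta.

Lemma abs_coord_le_enorm (z : Zd d) i : (`|(Defs.coord z i)%:~R| <= enorm R z)%R.
Proof.
rewrite -sqrtr_sqr ler_sqrt; last by apply: sumr_ge0 => j _; exact: sqr_ge0.
by rewrite (bigD1 i)//= lerDl sumr_ge0// => j _; exact: sqr_ge0.
Qed.

Lemma enorm_ge0 (z : Zd d) : (0 <= enorm R z)%R.
Proof. exact: sqrtr_ge0. Qed.

(** For [y >= 0], [e^y + e^(-y) - 2 = (1 - e^(-y))^2 e^y] and [1 - e^(-y) <= y]. *)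
Lemma expR_addN_le (y : R) : (expR y + expR (- y) <= 2 + y ^+ 2 * expR `|y|)%R.
Proof.
wlog y0 : y / (0 <= y)%R.
  have [y0|/ltW y0] := leP 0%R y => main; first exact: main.
  by have := main (- y)%R; rewrite opprK normrN sqrrN addrC; apply; rewrite oppr_ge0.
rewrite ger0_norm//; have := expR_ge1Dx (- y); have := expR_gt0 y.
have E : (expR y * expR (- y) = 1)%R by rewrite -expRD subrr expR0.
have e1 : (expR (- y) <= 1)%R by rewrite -expR0 ler_expR oppr_le0.
move: (expR y) (expR (- y)) E e1 => a b ab b1 a0 by1.
have : ((1 - b) ^+ 2 <= y ^+ 2)%R by rewrite ler_pXn2r ?nnegrE ?subr_ge0//; lra.
rewrite -(ler_pM2r a0) => h; apply: (@le_trans _ _ (2 + (1 - b) ^+ 2 * a)%R); last by rewrite lerD2l.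
rewrite (_ : (1 - b) ^+ 2 * a = a - 2 * (a * b) + (a * b) * b)%R; last by ring.
by rewrite ab; lra.
Qed.

Lemma sqr_le_expR (x : R) : (0 <= x)%R -> (x ^+ 2 <= 4 * expR x)%R.
Proof.
move=> x0; have := expR_ge1Dx (x / 2); have h := expRD (x / 2) (x / 2).
have -> : (expR x = expR (x / 2) * expR (x / 2))%R by rewrite -h -splitr.
by move: (expR (x / 2)) => a xa; nra.
Qed.

(** One half of the exponent [b n] absorbs [n^2] through [sqr_le_expR], the other half bounds
    [e^|l c|]. *)
Lemma expR_addN_exponential_le (b l c n : R) : (0 < b)%R -> (`|l| <= b / 2)%R ->
  (`|c| <= n)%R ->
  (expR (l * c) + expR (- (l * c)) <= 2 + 16 / b ^+ 2 * l ^+ 2 * expR (b * n))%R.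
Proof.
move=> b0 lb cn; have n0 : (0 <= n)%R by exact: le_trans cn.
apply: le_trans (expR_addN_le _) _; rewrite lerD2l.
apply: (@le_trans _ _ (l ^+ 2 * n ^+ 2 * expR (b / 2 * n))%R).
  have s0 : (0 <= l ^+ 2 * c ^+ 2)%R by rewrite mulr_ge0 ?exprn_even_ge0.
  rewrite exprMn; apply: ler_pM; rewrite ?expR_ge0//.
    by rewrite ler_wpM2l ?sqr_ge0// -[leLHS]real_normK ?num_real// ler_pXn2r ?nnegrE.
  by rewrite ler_expR normrM ler_pM.
have bn : (0 <= b / 2 * n)%R by rewrite mulr_ge0// divr_ge0// ltW.
rewrite (_ : b * n = b / 2 * n + b / 2 * n)%R; last by field.
rewrite expRD; have := sqr_le_expR bn; have := expR_gt0 (b / 2 * n).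
move: (expR (b / 2 * n)) => E E0 nE.
have n2 : (n ^+ 2 <= 16 / b ^+ 2 * E)%R.
  rewrite (_ : 16 / b ^+ 2 * E = (2 / b) ^+ 2 * (4 * E))%R; last by field; rewrite gt_eqF.
  rewrite (_ : n ^+ 2 = (2 / b) ^+ 2 * (b / 2 * n) ^+ 2)%R; last by field; rewrite gt_eqF.
  by rewrite ler_wpM2l// sqr_ge0.
rewrite (_ : 16 / b ^+ 2 * l ^+ 2 * (E * E) = l ^+ 2 * (16 / b ^+ 2 * E) * E)%R; last by ring.
by rewrite ler_wpM2r ?(ltW E0)// ler_wpM2l// sqr_ge0.
Qed.

Definition mgf (l : R) (i : 'I_d) : \bar R :=
  \esum_(z in [set: Zd d]) (mass_function theta z * (expR (l * (Defs.coord z i)%:~R))%:E).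

(** By symmetry [mgf] is even in [l], so its double is the mean of [e^(l c) + e^(- l c)], which has
    no linear term. The form [exp (C l^2)] is chosen because it multiplies along convolution
    powers. *)
Lemma mgf_le : exponential_moment theta -> exists2 l0 : R, (0 < l0)%R &
  exists2 C : R, (0 <= C)%R & forall l i, (`|l| <= l0)%R ->
    mgf l i <= (expR (C * l ^+ 2))%:E.
Proof.
move=> [b b0 fin]; exists (b / 2)%R; first exact: divr_gt0.
set M := esum _ _ in fin.
have M0 : 0 <= M by apply: esum_ge0 => z _; rewrite mule_ge0// lee_fin expR_ge0.
have Mfin : M \is a fin_num by rewrite ge0_fin_numE.
exists (8 / b ^+ 2 * fine M)%R.
  by rewrite mulr_ge0 ?fine_ge0// divr_ge0// sqr_ge0.
move=> l i lb.
have t0 c z : 0 <= mass_function theta z * (expR (c * (Defs.coord z i)%:~R))%:E.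
  by rewrite mule_ge0 ?mass_function_ge0// lee_fin expR_ge0.
have symm : mgf (- l) i = mgf l i.
  rewrite /mgf (reindex_esumT _ (bijective_subr 0%R)).
    apply: eq_esum => z _; rewrite sub0r coordN rmorphN/= mulrNN /mass_function.
    by rewrite -theta_sym.
have two : mgf l i + mgf l i <= (2 + 16 / b ^+ 2 * l ^+ 2 * fine M)%:E.
  rewrite -{2}symm /mgf -esumD; [|by move=> *; exact: t0|by move=> *; exact: t0].
  apply: (@le_trans _ _ (\esum_(z in [set: Zd d]) (2%:E * mass_function theta z +
     (16 / b ^+ 2 * l ^+ 2)%:E * ((expR (b * enorm R z))%:E * theta [set z])))).
    apply: le_esum => z _; rewrite -ge0_muleDr ?lee_fin ?expR_ge0//.
    rewrite [2%:E * _]muleC [(expR _)%:E * theta _]muleC [(_ * l ^+ 2)%:E * _]muleCA.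
    rewrite -[theta [set z]]/(mass_function theta z) -ge0_muleDr ?lee_fin//; last first.
      by apply: mulr_ge0 (expR_ge0 _); apply: mulr_ge0 (sqr_ge0 _); exact: divr_ge0 (sqr_ge0 _).
    rewrite lee_wpmul2l ?mass_function_ge0// -EFinD lee_fin mulNr.
    exact: expR_addN_exponential_le (abs_coord_le_enorm _ _).
  have c0 : 0 <= (16 / b ^+ 2 * l ^+ 2)%:E.
    by rewrite lee_fin; apply: mulr_ge0 (sqr_ge0 _); exact: divr_ge0 (sqr_ge0 _).
  have e0 z : 0 <= (expR (b * enorm R z))%:E * theta [set z].
    by rewrite mule_ge0// lee_fin expR_ge0.
  rewrite esumD; last 2 first.
    by move=> z _; rewrite mule_ge0 ?mass_function_ge0// lee_fin.
    by move=> z _; rewrite mule_ge0.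
  rewrite (@esumZl R (Zd d) setT 2%:E (mass_function theta)) ?lee_fin//.
  rewrite esumZl// -/M.
  rewrite [X in _ * X + _](total_mass_mass_function theta) mule1.
  by rewrite -[X in _ * X](fineK Mfin) -EFinM.
suff : mgf l i <= (1 + 8 / b ^+ 2 * fine M * l ^+ 2)%:E.
  by move=> /le_trans; apply; rewrite lee_fin expR_ge1Dx.
case: (mgf l i) two => [r| |]//; last by move=> _; rewrite leNye.
rewrite -EFinD !lee_fin.
rewrite (_ : 2 + _ = (1 + 8 / b ^+ 2 * fine M * l ^+ 2) + (1 + 8 / b ^+ 2 * fine M * l ^+ 2))%R.
  by move: (1 + _)%R => x; rewrite -!mulr2n lerMn2r.
by ring.
Qed.

Variables (l0 C : R).
Hypothesis C_ge0 : (0 <= C)%R.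
Hypothesis mgf_bound : forall l i, (`|l| <= l0)%R -> mgf l i <= (expR (C * l ^+ 2))%:E.

Lemma mgf_conv_power_le k l i : (`|l| <= l0)%R ->
  \esum_(z in [set: Zd d]) (conv_power (mass_function theta) k z *
     (expR (l * (Defs.coord z i)%:~R))%:E) <= (expR (C * l ^+ 2 * k%:R))%:E.
Proof.
move=> ll; have p0 z : 0 <= mass_function theta z by exact: mass_function_ge0.
have e0 z : 0 <= (expR (l * (Defs.coord z i)%:~R))%:E by rewrite lee_fin expR_ge0.
have cp0 n z : 0 <= conv_power (mass_function theta) n z by exact: conv_power_ge0.
elim: k => [|k IH].
  rewrite mulr0 expR0 (_ : esum _ _ = (expR (l * (Defs.coord (0 : Zd d)%R i)%:~R))%:E).
    by rewrite /Defs.coord mxE mulr0 expR0.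
  by rewrite -(esum_indicator 0%R e0).
rewrite conv_powerS esum_convolution//.
apply: (@le_trans _ _ (\esum_(y in [set: Zd d])
   (mass_function theta y * (expR (l * (Defs.coord y i)%:~R))%:E *
     (expR (C * l ^+ 2 * k%:R))%:E))).
  apply: le_esum => y _; rewrite -muleA lee_wpmul2l//.
  apply: le_trans (lee_wpmul2l (e0 y) IH); rewrite -esumZl//; last by move=> z; rewrite mule_ge0.
  apply: le_esum => z _; rewrite muleCA -EFinM -expRD coordD rmorphD/= mulrDr addrC.
  by [].
rewrite esumZr ?lee_fin ?expR_ge0//; last by move=> z; rewrite mule_ge0.
rewrite -[k.+1%:R]natr1 mulrDr mulr1 addrC expRD EFinM.
by rewrite lee_wpmul2r ?lee_fin ?expR_ge0// mgf_bound.
Qed.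

(** Pointwise Chernoff bound: outside the cube, one coordinate and one sign of the tilt give a term
    at least 1. *)
Lemma indic_outside_cube_le (l : R) r (z : Zd d) : (0 <= l)%R ->
  (\1_(~` cube r) z <= \sum_(i < d) (expR (l * (Defs.coord z i)%:~R) * expR (- (l * r%:R)) +
     expR (- l * (Defs.coord z i)%:~R) * expR (- (l * r%:R))))%R.
Proof.
move=> l0'; have t0 (i : 'I_d) : (0 <= expR (l * (Defs.coord z i)%:~R) * expR (- (l * r%:R)) +
     expR (- l * (Defs.coord z i)%:~R) * expR (- (l * r%:R)))%R.
  by rewrite addr_ge0// mulr_ge0 ?expR_ge0.
rewrite indicE; have [zr|zr] := boolP (z \in _); last exact: sumr_ge0.
have [i zi] : exists i, ~~ (`|Defs.coord z i| <= r%:Z)%R.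
  move: zr; rewrite inE /= => nz; apply: contrapT => nx; apply: nz => i.
  by apply: contrapT => zi; apply: nx; exists i; apply/negP.
rewrite (bigD1 i)//=; apply: (@le_trans _ _ (expR 0 + 0)%R); first by rewrite expR0 addr0.
apply: lerD; last exact: sumr_ge0.
have rz : (r%:R <= `|(Defs.coord z i)%:~R| :> R)%R.
  by move: zi; rewrite -ltNge => /ltW; rewrite -(ler_int R) intr_norm.
rewrite -!expRD; move: rz; case: (leP 0%R ((Defs.coord z i)%:~R : R)) => [c0|/ltW c0].
  rewrite ger0_norm// => rz; apply: (@le_trans _ _ (expR (l * (Defs.coord z i)%:~R - l * r%:R)))%R.
    by rewrite ler_expR subr_ge0 ler_wpM2l.
  by rewrite lerDl expR_ge0.
rewrite ler0_norm// => rz; apply: (@le_trans _ _ (expR (- l * (Defs.coord z i)%:~R - l * r%:R)))%R.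
  by rewrite ler_expR subr_ge0 mulNr -mulrN ler_wpM2l.
by rewrite lerDr expR_ge0.
Qed.

Lemma conv_power_outside_cube_le k l r : (0 <= l <= l0)%R ->
  \esum_(z in [set: Zd d]) (conv_power (mass_function theta) k z * (\1_(~` cube r) z)%:E) <=
    (d.*2%:R * expR (C * l ^+ 2 * k%:R - l * r%:R))%:E.
Proof.
move=> /andP[l_ge0 ll0].
have cp0 n z : 0 <= conv_power (mass_function theta) n z.
  by apply: conv_power_ge0 => ?; exact: mass_function_ge0.
pose t c (i : 'I_d) (z : Zd d) : \bar R := conv_power (mass_function theta) k z *
  (expR (c * (Defs.coord z i)%:~R))%:E * (expR (- (l * r%:R)))%:E.
have t0 c i z : 0 <= t c i z by rewrite !mule_ge0// lee_fin expR_ge0.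
apply: (@le_trans _ _ (\esum_(z in [set: Zd d]) \sum_(i < d) (t l i z + t (- l)%R i z))).
  apply: le_esum => z _.
  apply: le_trans (lee_wpmul2l (cp0 k z) (_ : _ <= (_ : R)%:E)) _.
    by rewrite lee_fin; exact: (indic_outside_cube_le r z l_ge0).
  rewrite -sumEFin ge0_sume_distrr; last first.
    by move=> i _; rewrite lee_fin addr_ge0// mulr_ge0 ?expR_ge0.
  apply: lee_sum => i _; rewrite EFinD ge0_muleDr ?lee_fin ?mulr_ge0 ?expR_ge0//.
  by rewrite /t !EFinM !muleA.
rewrite esum_sum; last by move=> *; rewrite adde_ge0.
apply: (@le_trans _ _ (\sum_(i < d) (2 * expR (C * l ^+ 2 * k%:R - l * r%:R))%:E)).
  apply: lee_sum => i _; rewrite esumD; [|by move=> *; exact: t0|by move=> *; exact: t0].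
  rewrite mulr2n mulrDl mul1r EFinD expRD EFinM.
  have e0 c z : 0 <= conv_power (mass_function theta) k z *
      (expR (c * (Defs.coord z i)%:~R))%:E by rewrite mule_ge0// lee_fin expR_ge0.
  apply: leeD; rewrite esumZr ?lee_fin ?expR_ge0//; rewrite lee_wpmul2r ?lee_fin ?expR_ge0//.
    by apply: mgf_conv_power_le; rewrite ger0_norm.
  by rewrite -[(l ^+ 2)%R]sqrrN; apply: mgf_conv_power_le; rewrite normrN ger0_norm.
rewrite sumEFin sumr_const card_ord lee_fin -muln2 natrM -[leLHS]mulr_natl.
by rewrite mulrA.
Qed.

End ExponentialTails.

(** * Vertices leaving a cube *)

Section Exceedance.
Local Open Scope ereal_scope.
Variables (dT : measure_display) (T : measurableType dT) (R : realType) (d : nat).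
Variables (P : probability T R) (mu : probability nat R) (theta : probability (Zd d) R).
Variables (N : vertex -> {RV P >-> nat}) (X : vertex -> {RV P >-> Zd d}).
Hypothesis hNX : igw_brw mu theta N X.
Hypothesis theta_sym : symmetric_law theta.
Hypothesis mass_le1 : forall K, (letter_mass mu K <= 1)%R.
Variables (l C : R) (n H r : nat).
Hypothesis C_ge0 : (0 <= C)%R.
Hypothesis outside : forall k,
  \esum_(z in [set: Zd d]) (conv_power (mass_function theta) k z * (\1_(~` cube r) z)%:E) <=
    (d.*2%:R * expR (C * l ^+ 2 * k%:R - l * r%:R))%:E.

Definition far (x : vertex) : set T :=
  alive_vertex N x `&` [set t | ~ cube r (position X t x)].

Let position_root t : position X t (0%N, [::]) = 0%R.
Proof. by rewrite /position !big_geq// addr0. Qed.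

Let S x := signed_sum X (vertex_diff (0%N, [::]) x).

Let positionS x t : S x t = position X t x.
Proof. by rewrite /S signed_sum_vertex_diff position_root subr0. Qed.

Let mS x z : measurable (S x @^-1` [set z]).
Proof. exact: (@signed_sum_measurable _ _ _ _ _ N X). Qed.

Lemma far_measurable x : measurable (far x).
Proof.
apply: measurableI; first exact: (@alive_vertex_measurable _ _ _ _ _ N X).
rewrite (_ : [set t | _] = S x @^-1` (~` cube r)).
  exact: (preimage_countable_measurable (@mS x)).
by apply/seteqP; split => t /=; rewrite positionS.
Qed.

Lemma probability_far_le x :
  P (far x) <= (weight mu x.2 * (d.*2%:R *
     expR (C * l ^+ 2 * (x.1 + size x.2)%:R - l * r%:R)))%:E.
Proof.
have cp0 n' z : 0 <= conv_power (mass_function theta) n' z.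
  by apply: conv_power_ge0 => ?; exact: mass_function_ge0.
rewrite (measure_countable_partition P (@mS x)); last exact: far_measurable.
apply: (@le_trans _ _ (\esum_(z in [set: Zd d]) ((weight mu x.2)%:E *
   (conv_power (mass_function theta) (x.1 + size x.2) z * (\1_(~` cube r) z)%:E)))).
  apply: le_esum => z _; have [zr|zr] := pselect (cube r z).
    rewrite (_ : far x `&` _ = set0) ?measure0 ?mule_ge0 ?lee_fin ?weight_ge0 ?indicE//.
    by rewrite -subset0 => t [[_ far_t] /= St]; apply: far_t; rewrite -positionS St.
  rewrite indicE mem_set// mule1.
  have -> : (x.1 + size x.2 = size (vertex_diff (0, [::]) x))%N.
    by rewrite size_vertex_diff /vertex_dist /=; case: x => -[|j] u.
  rewrite -(probability_alive hNX x.1 [::]).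
  rewrite -(probability_signed_sum_on hNX theta_sym z (uniq_vertex_diff _ _)); last first.
    exact: alive_vertex_sigma.
  apply: le_measure; rewrite ?inE.
  - by apply: measurableI; [exact: far_measurable|exact: mS].
  - by apply: measurableI; [exact: (@alive_vertex_measurable _ _ _ _ _ N X x)|exact: mS].
  - by move=> t [[]].
rewrite esumZl ?lee_fin ?weight_ge0//; last by move=> z; rewrite mule_ge0// lee_fin indicE.
by rewrite [leRHS]EFinM lee_wpmul2l ?lee_fin ?weight_ge0.
Qed.

Definition exceed : set T :=
  [set t | exists x, [/\ (x.1 < n)%N, (size x.2 < H)%N & far x t]].

Let exceedK K : set T := \big[setU/set0]_(x <- vertices K n H) far x.

Let bound : R := (n%:R * H%:R * (d.*2%:R * expR (C * l ^+ 2 * (n + H)%:R - l * r%:R)))%R.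

Let mem_verticesE K x : x \in vertices K n H <->
  [/\ (x.1 < n)%N, (size x.2 < H)%N & all (fun i => (i < K)%N) x.2].
Proof.
have mem_words a u : (u \in words K a) = (size u == a) && all (fun i => (i < K)%N) u.
  elim: a u => [|a IH] [|i u]; rewrite ?inE//=.
    by apply/negbTE/allpairsP => -[[? ?] []].
  apply/allpairsP/andP => [[[i' v] /= [+ + [-> ->]]]|[su /andP[iK uK]]].
    by rewrite mem_iota IH => /= iK /andP[/eqP-> ->]; rewrite eqxx iK.
  by exists (i, u); rewrite mem_iota IH add0n -(eqn_add2r 1) !addn1 su iK uK.
split => [/allpairsP[[j u] /= [jn /flattenP[s /mapP[a aH ->]] + ->]]|].
  move: jn aH; rewrite mem_words !mem_iota !add0n => /= jn aH /andP[/eqP ua uK].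
  by rewrite ua.
case: x => [j u] /= [jn uH uK]; apply/allpairsP; exists (j, u); split => //=.
  by rewrite mem_iota.
apply/flattenP; exists (words K (size u)); last by rewrite mem_words eqxx.
by apply/mapP; exists (size u); rewrite ?mem_iota.
Qed.

(** Labels have unbounded letters. With letters below [K] the union is finite; [K] tends to infinity
    only in [probability_exceed_le]. *)
Let exceedKP K t : exceedK K t <-> exists2 x, x \in vertices K n H & far x t.
Proof.
rewrite /exceedK; elim: (vertices K n H) => [|y s IH].
  by rewrite big_nil; split => // -[].
rewrite big_cons; split => [[yt|/IH[x xs xt]]|[x]].
- by exists y => //; rewrite inE eqxx.
- by exists x => //; rewrite inE xs orbT.
- rewrite inE => /predU1P[-> yt|xs xt]; first by left.
  by right; apply/IH; exists x.
Qed.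

Let exceedK_measurable K : measurable (exceedK K).
Proof. by apply: bigsetU_measurable => x _; exact: far_measurable. Qed.

(** Union bound: for each tree and height the weights add up to at most 1, so the estimate is
    uniform in [K]. *)
Let probability_exceedK K : P (exceedK K) <= bound%:E.
Proof.
apply: (@le_trans _ _ (\sum_(x <- vertices K n H) P (far x))).
  rewrite /exceedK; elim: (vertices K n H) => [|y s IH]; first by rewrite !big_nil measure0.
  rewrite !big_cons; apply: le_trans (leeD2l _ IH).
  apply: measureU2; first exact: far_measurable.
  by apply: bigsetU_measurable => x _; exact: far_measurable.
apply: (@le_trans _ _ (\sum_(x <- vertices K n H) (weight mu x.2 * (d.*2%:R *
     expR (C * l ^+ 2 * (n + H)%:R - l * r%:R)))%:E)).
  rewrite big_seq [leRHS]big_seq; apply: lee_sum => x /mem_verticesE[xn xH _].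
  apply: le_trans (probability_far_le x) _; rewrite lee_fin.
  rewrite ler_wpM2l ?weight_ge0// ler_wpM2l// ler_expR lerD2r.
  have Cl : (0 <= C * l ^+ 2)%R by exact: mulr_ge0 (sqr_ge0 _).
  by rewrite ler_wpM2l// ler_nat leq_add// ltnW.
rewrite sumEFin -mulr_suml sum_vertices_weight lee_fin /bound.
rewrite ler_wpM2r ?mulr_ge0 ?expR_ge0// ler_wpM2l//.
rewrite (_ : H%:R = \sum_(a < H) 1)%R; last by rewrite sumr_const card_ord.
by apply: ler_sum => a _; rewrite exprn_ile1// ?letter_mass_ge0.
Qed.

Lemma exceedE : exceed = \bigcup_K exceedK K.
Proof.
apply/seteqP; split => [t [x [xn xH xt]]|t [K _ /exceedKP[x /mem_verticesE[xn xH _] xt]]].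
  exists (\max_(i <- x.2) i).+1 => //; apply/exceedKP; exists x => //.
  apply/mem_verticesE; split => //; apply/allP => i ix; rewrite ltnS.
  exact: leq_bigmax_seq.
by exists x.
Qed.

Lemma exceed_measurable : measurable exceed.
Proof. by rewrite exceedE; apply: bigcupT_measurable => K; exact: exceedK_measurable. Qed.

Lemma probability_exceed_le : P exceed <=
  (n%:R * H%:R * (d.*2%:R * expR (C * l ^+ 2 * (n + H)%:R - l * r%:R)))%:E.
Proof.
rewrite exceedE; have inc : nondecreasing_seq exceedK.
  move=> K K' KK'; apply/subsetPset => t /exceedKP[x /mem_verticesE[xn xH xK] xt].
  apply/exceedKP; exists x => //; apply/mem_verticesE; split => //.
  by apply: sub_all xK => i iK; exact: leq_trans KK'.
have cv := nondecreasing_cvg_mu (mu := P) exceedK_measurable (bigcupT_measurable _ exceedK_measurable) inc.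
rewrite -(cvg_lim _ cv)//; apply: lime_le; first by apply/cvg_ex; eexists; exact: cv.
by apply: nearW => K; exact: probability_exceedK.
Qed.

End Exceedance.

(** * Almost sure exponents *)

Section EventsAtOneScale.
Local Open Scope ereal_scope.
Variables (R : realType) (d : nat).

(** A nonzero integer coordinate has absolute value at least 1, so its square is at most its power
    [d + 1]. *)
Lemma finite_second_moment (eta : probability (Zd d) R) i : (1 <= d)%N ->
  finite_moment d.+1 eta ->
  \int[eta]_x ((((Defs.coord x i)%:~R : R) ^+ 2)%R)%:E < +oo.
Proof.
move=> d1; apply: le_lt_trans.
have c0 (z : Zd d) : 0 <= (((Defs.coord z i)%:~R ^+ 2)%R)%:E :> \bar R by rewrite lee_fin sqr_ge0.
have e0 (z : Zd d) : 0 <= ((enorm R z ^+ d.+1)%R)%:E by rewrite lee_fin exprn_ge0// enorm_ge0.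
rewrite !integral_mass_function//; apply: le_esum => z _.
rewrite lee_wpmul2l ?mass_function_ge0// lee_fin.
have := abs_coord_le_enorm R z i; set c := Defs.coord z i => cn.
have [->|c_neq0] := eqVneq c 0%R; first by rewrite expr0n/= exprn_ge0// enorm_ge0.
have c1 : (1 <= `|c%:~R| :> R)%R by rewrite -intr_norm (ler_int R 1); lia.
rewrite -real_normK ?num_real//; apply: le_trans (lerXn2r d.+1 _ _ cn); rewrite ?nnegrE ?enorm_ge0//.
exact: ler_weXn2l.
Qed.

Lemma bernoulli_le (e : R) n : (0 <= e <= 1)%R -> (1 - n%:R * e <= (1 - e) ^+ n)%R.
Proof.
move=> /andP[e0 e1]; elim: n => [|n IH]; first by rewrite mul0r subr0 expr0.
rewrite exprS -natr1; apply: (@le_trans _ _ ((1 - e) * (1 - n%:R * e))%R); last first.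
  by rewrite ler_wpM2l// subr_ge0.
have n0 : (0 <= n%:R :> R)%R by []; have := mulr_ge0 n0 (sqr_ge0 e).
by move: (n%:R : R)%R => x; nra.
Qed.

Section Capacity.
Variables (dS : measure_display) (S : measurableType dS) (Q : probability S R).
Variables (eta : probability (Zd d) R) (Y : nat -> {RV Q >-> Zd d}).
Hypothesis hY : iid_jumps eta Y.
Hypothesis eta_irreducible : irreducible_chain (walk_kernel eta).
Hypothesis d_gt1 : (1 < d)%N.

(** The cube certifies that [A] is finite; its side leaves no trace in the bound. *)
Lemma capacity_ge_energy r (A : set (Zd d)) (L : seq (Zd d)) (E : R) :
  A `<=` cube r -> (forall y, y \in L -> A y) -> (0 <= E)%R ->
  \sum_(y <- L) \sum_(x <- L) green (mass_function eta) (y - x)%R <= E%:E ->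
  ((size L)%:R ^+ 2)%:E <= (4 * E)%:E * capacity Y A.
Proof.
move=> Ar LA E0 LE; have [C C0 heat] := heat_kernel_bound eta_irreducible d_gt1.
apply: (capacity_ge hY); [|by rewrite mulr_ge0|].
  by apply: (sub_finite_set Ar); exact: finite_cube.
move=> j; apply: (@energy_le R d (mass_function eta) A _ _ L E C (d%:R / 2)) => //.
- exact: total_mass_mass_function.
- apply: (@le_lt_trans _ _ (total_mass (inside R (cube r)))); last first.
    exact: le_lt_trans (total_mass_cube R d r) (ltry _).
  apply: le_esum => z _; rewrite /inside lee_fin !indicE ler_nat.
  by have [zA|//] := boolP (z \in A); rewrite mem_set//; apply: Ar; rewrite -inE.
- by rewrite divr_gt0// ltr0n; lia.
Qed.

End Capacity.

Variables (dT : measure_display) (T : measurableType dT).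
Variables (P : probability T R) (mu : probability nat R) (theta : probability (Zd d) R).
Variables (N : vertex -> {RV P >-> nat}) (X : vertex -> {RV P >-> Zd d}).
Hypothesis hNX : igw_brw mu theta N X.
Hypothesis theta_sym : symmetric_law theta.
Hypothesis mu_mean : offspring_mean mu = 1.
Hypothesis mu_variance : offspring_variance mu < +oo.

Definition survive (n H : nat) : set T :=
  [set t | exists2 j, (j < n)%N & ~ extinct N H j [::] t].

Lemma probability_survive_le n H : (0 < tail mu 1)%R -> (0 < H)%N ->
  measurable (survive n H) /\ P (survive n H) <= (n%:R / (tail mu 1 * H%:R))%:E.
Proof.
move=> c0 H0; elim: n => [|n [mS PS]].
  rewrite (_ : survive 0 H = set0); first by rewrite measure0 mul0r.
  by rewrite -subset0 => t [].
have mE : measurable (extinct N H n [::]) by exact: (@extinct_measurable _ _ _ d P N X).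
have -> : survive n.+1 H = survive n H `|` ~` extinct N H n [::].
  apply/seteqP; split => t.
    by move=> [j]; rewrite ltnS leq_eqVlt => /predU1P[->|jn] ?; [right|left; exists j].
  by move=> [[j jn ?]|?]; [exists j => //; exact: ltnW|exists n].
split; first by apply: measurableU => //; exact: measurableC.
apply: le_trans (measureU2 _ _ _) _ => //; first exact: measurableC.
rewrite -natr1 mulrDl EFinD; apply: leeD => //.
have PE : P (~` extinct N H n [::]) = (1 - extinction_probability mu H)%:E.
  by rewrite EFinB -(probability_extinct hNX H n [::]); exact: probability_setC.
apply: (@le_trans _ _ (1 - extinction_probability mu H)%:E); first by rewrite -PE.
rewrite lee_fin mul1r.
have := survival_le hNX mu_mean H; set q := (1 - _)%R => qH.
have H0' : (0 < H%:R :> R)%R by rewrite ltr0n.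
rewrite -[leRHS]mul1r ler_pdivlMr ?mulr_gt0//; apply: le_trans qH.
rewrite mulrDr mulr1 lerDr /q subr_ge0 -lee_fin -(probability_extinct hNX H 0 [::]).
by apply: probability_le1; exact: (@extinct_measurable _ _ _ d P N X).
Qed.

Lemma visited_sub_cube n H r t : ~ survive n H t -> ~ exceed N X n H r t ->
  visited N X n t `<=` cube r.
Proof.
move=> nS nE z [[j u] /= [jn ju] <-]; apply: contrapT => zr.
have aju : alive N j [::] u t by exact/alive_gw_tree.
have [uH|Hu] := ltnP (size u) H; first by apply: nE; exists (j, u); split.
(* A vertex of height at least [H] has an ancestor of height exactly [H], the prefix [take H u],
   which contradicts extinction. *)
apply: nS; exists j => // /extinctP/(_ (take H u)); apply; first by rewrite size_takel.
apply/aliveE => k; rewrite size_takel// => kH; rewrite nth_take// take_takel; last exact: ltnW.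
by move/aliveE: aju; apply; exact: leq_trans Hu.
Qed.

Variables (G : Zd d -> \bar R) (C s : R).
Hypothesis G_ge0 : forall z, 0 <= G z.
Hypotheses (C_gt0 : (0 < C)%R) (s_gt0 : (0 < s)%R) (s_lt2 : (s < 2)%R).
Hypothesis G_average : forall k,
  \esum_(z in [set: Zd d]) (conv_power (mass_function theta) k z * G z) <=
  (C * k.+1%:R `^ (- s))%:E.

Let kappa := offspring_second_moment mu.

Lemma offspring_second_moment_ge0 : (0 <= offspring_second_moment mu)%R.
Proof.
by apply/fine_ge0/esum_ge0 => k _; rewrite mule_ge0// lee_fin sqr_ge0.
Qed.

Let EC := energy_constant kappa C s.

Lemma energy_constant_gt0 : (0 < energy_constant kappa C s)%R.
Proof.
have s0 := s_gt0; have s2 := s_lt2; have k0 := offspring_second_moment_ge0.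
rewrite mulr_gt0// ltr_wpDl//.
  by apply: mulr_ge0 (sqr_ge0 _); rewrite addr_ge0.
by rewrite mulr_gt0// exprn_gt0// divr_gt0// subr_gt0; lra.
Qed.

(** Chebyshev for the number of points, Markov at level [a] times the mean bound for their
    energy. *)
Lemma many_points n h (a : R) : (0 < h <= n)%N -> (0 < a)%R ->
  exists2 B : set T, measurable B /\
    P B <= (16 * (2 + kappa) * h%:R / n%:R + a^-1)%:E &
    forall t, ~ B t -> exists2 L : seq (Zd d),
      (forall y, y \in L -> visited N X n t y) &
      (n%:R * h%:R / 4 <= (size L)%:R :> R)%R /\
      \sum_(y <- L) \sum_(x <- L) G (y - x)%R <= (a * (EC * n%:R `^ (4 - s)))%:E.
Proof.
move=> /andP[h0 hn] a0; have hR : (0 < h%:R :> R)%R by rewrite ltr0n.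
have n0 : (0 < n)%N by exact: leq_trans hn.
have nR : (0 < n%:R :> R)%R by rewrite ltr0n.
have k0 : (0 <= kappa)%R := offspring_second_moment_ge0.
have h1 : (1 <= h%:R :> R)%R by rewrite ler1n.
(* Then [(1 - e)^h >= 1/2] by Bernoulli: restricting the letters to [K] loses at most half of the
   mean in each generation below [h]. *)
pose e : R := ((2 * h%:R)^-1)%R.
have e0 : (0 < e)%R by rewrite invr_gt0 mulr_gt0.
have e1 : (e <= 1)%R by rewrite invf_le1 ?mulr_gt0//; lra.
have [K Ke] := letter_mass_near1 mu_mean e0.
have mass1 := letter_mass_le1 mu_mean K.
have m0 := letter_mass_ge0 mu K.
have massh : (2^-1 <= letter_mass mu K ^+ h)%R.
  apply: le_trans (lerXn2r h _ _ Ke); rewrite ?nnegrE ?subr_ge0//.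
  apply: le_trans (bernoulli_le h _); last by rewrite ltW.
  by rewrite le_eqVlt; apply/orP; left; apply/eqP; rewrite /e; field; rewrite gt_eqF.
pose m := forest_mean mu K n h.
have mnh : (n%:R * h%:R / 2 <= m)%R.
  rewrite /m /forest_mean -mulrA ler_wpM2l//.
  apply: (@le_trans _ _ (\sum_(i < h) 2^-1)%R); first by rewrite sumr_const card_ord mulr_natl.
  apply: ler_sum => i _; apply: le_trans massh _.
  by rewrite ler_wiXn2l// ltnW.
have m_gt0 : (0 < m)%R by apply: lt_le_trans mnh; rewrite divr_gt0// mulr_gt0.
have [B1 [mB1 PB1] B1P] := alive_count_small hNX mass1 (tail_maxn_le mu_mean mu_variance K) m_gt0.
have [W [mW W0 intW] WP] := alive_points_energy hNX theta_sym mass1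
  (tail_maxn_le mu_mean mu_variance K) G_ge0 (ltW C_gt0) s_gt0 s_lt2 h0 hn G_average.
have EC0 : (0 < EC * n%:R `^ (4 - s))%R by rewrite mulr_gt0 ?energy_constant_gt0 ?powR_gt0.
have [mB2 PB2] := markov_ge P mW W0 (ltW (mulr_gt0 a0 EC0)).
set B2 := [set t | _] in mB2 PB2.
exists (B1 `|` B2); first split; first exact: measurableU.
  apply: le_trans (measureU2 _ mB1 mB2) _; rewrite EFinD; apply: leeD.
    apply: le_trans PB1 _; rewrite lee_fin.
    apply: (@le_trans _ _ (4 * ((2 + kappa) * n%:R * h%:R ^+ 3) / (n%:R * h%:R / 2) ^+ 2))%R.
      rewrite ler_wpM2l//.
        by rewrite mulr_ge0// mulr_ge0// ?exprn_ge0// mulr_ge0// addr_ge0.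
      rewrite lef_pV2 ?posrE ?exprn_gt0//; last by rewrite divr_gt0// mulr_gt0.
      by apply: lerXn2r mnh; rewrite nnegrE ?(ltW m_gt0)// divr_ge0// mulr_ge0.
    by rewrite le_eqVlt; apply/orP; left; apply/eqP; field; rewrite !gt_eqF.
  have := le_trans PB2 intW; rewrite muleC -lee_pdivlMr ?(mulr_gt0 a0 EC0)//.
  move=> /le_trans; apply; rewrite -EFinM lee_fin invfM mulrCA divff ?mulr1//.
  by rewrite gt_eqF.
move=> t nB; exists (alive_points N X K n h t).
  move=> y /mapP[[j u] + ->]; rewrite mem_filter => /andP[/asboolP Ax /mem_vertices jn].
  by exists (j, u) => //; split => //; exact/alive_gw_tree.
split.
  rewrite size_alive_points; apply: le_trans (B1P t _); last by move=> ?; apply: nB; left.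
  by rewrite (_ : n%:R * h%:R / 4 = n%:R * h%:R / 2 / 2)%R; [rewrite ler_pM2r|field].
rewrite WP leNgt; apply/negP => /ltW lt; apply: nB; right; exact: lt.
Qed.

End EventsAtOneScale.

(** * From polylogarithmic bounds to the exponent *)

Section Exponents.
Variable R : realType.

Lemma cubic_bounded (a b c : R) : 0 <= a -> 0 <= b -> 0 < c ->
  exists D, forall x, 0 <= x -> a * x + b * x ^+ 2 - c * x ^+ 3 <= D.
Proof.
move=> a0 b0 c0; pose M := (a + b) / c + 1.
have M1 : 1 <= M by rewrite lerDr divr_ge0 ?addr_ge0// ltW.
have cM : a + b <= c * M by rewrite /M mulrDr mulrC divfK ?gt_eqF// mulr1 lerDl ltW.
exists (a * M + b * M ^+ 2) => x x0; have [xM|/ltW Mx] := leP x M.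
  have x3 : 0 <= c * x ^+ 3 by rewrite mulr_ge0 ?exprn_ge0// ltW.
  have M0 : 0 <= M by exact: le_trans x0 xM.
  have : x ^+ 2 <= M ^+ 2 by rewrite lerXn2r.
  by move=> /(ler_wpM2l b0); have := ler_wpM2l a0 xM; lra.
have x1 : 1 <= x by exact: le_trans Mx.
have D0 : 0 <= a * M + b * M ^+ 2.
  by have M0 : 0 <= M by [exact: le_trans M1]; rewrite addr_ge0 ?mulr_ge0 ?exprn_ge0.
apply: le_trans D0.
have : (a + b) * x ^+ 2 <= c * x * x ^+ 2.
  by rewrite ler_wpM2r ?sqr_ge0//; apply: le_trans cM _; rewrite ler_wpM2l// ltW.
have : a * x <= a * x ^+ 2 by rewrite ler_wpM2l// expr2 ler_peMr.
rewrite (_ : c * x ^+ 3 = c * x * x ^+ 2); last by ring.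
rewrite mulrDl; lra.
Qed.

Lemma ln_le_linear (e x : R) : 0 < e -> 0 < x -> ln x <= e * x + e^-1.
Proof.
move=> e0 x0; have ex : 0 < e * x by exact: mulr_gt0.
have -> : x = e * x * e^-1 by rewrite mulrAC divff ?mul1r// gt_eqF.
rewrite lnM ?posrE ?invr_gt0// mulrA [e * (e * x)]mulrC mulfK ?gt_eqF//.
have le_id (y : R) : 0 < y -> ln y <= y.
  move=> y0; have := expR_ge1Dx (ln y); rewrite lnK ?posrE//; lra.
by apply: lerD; rewrite le_id ?invr_gt0.
Qed.

(** At scale [k], [ln n] is at least [k ln 4] while the logarithm of the error factor is [O(ln k)].
    The shift in [k.+3] leaves room for using the scale [k + 1]. *)
Lemma polylog_exponent (s C : R) (m k0 : nat) (f : nat -> R) : 0 < C ->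
  (forall k n, (k0 <= k)%N -> (4 ^ k <= n <= 4 ^ k.+1)%N ->
     n%:R `^ s <= C * k.+3%:R ^+ m * f n /\ f n <= C * k.+3%:R ^+ m * n%:R `^ s) ->
  (ln (f n) / ln n%:R - s @[n --> \oo] --> (0 : R)) /\
  \forall n \near \oo, f n = n%:R `^ (s + (ln (f n) / ln n%:R - s)).
Proof.
move=> C0 fP.
have scale n : (4 ^ k0 <= n)%N -> exists2 k, (k0 <= k)%N & (4 ^ k <= n <= 4 ^ k.+1)%N.
  move=> kn; have n0 : (0 < n)%N by apply: leq_trans kn; rewrite expn_gt0.
  have /andP[ge lt] := trunc_log_bounds (isT : (1 < 4)%N) n0.
  by exists (trunc_log 4 n); rewrite ?ge ?(ltnW lt)//; exact: trunc_log_max.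
have f_gt0 n : (4 ^ k0 <= n)%N -> 0 < f n.
  move=> kn; have [k k0k kn'] := scale n kn; have [lo _] := fP k n k0k kn'.
  have n0 : 0 < (n%:R : R) by rewrite ltr0n; apply: leq_trans kn; rewrite expn_gt0.
  rewrite -(pmulr_rgt0 _ (_ : 0 < C * k.+3%:R ^+ m)); last by rewrite mulr_gt0// exprn_gt0.
  by apply: lt_le_trans lo; exact: powR_gt0.
have ln4 : 0 < ln (4 : R) by rewrite ln_gt0// ltr1n.
split; last first.
  (* From this index on [n > 1], so that [ln n] can be divided by. *)
  exists (4 ^ k0.+1)%N => // n /= kn.
  have n1 : 1 < (n%:R : R).
    by rewrite ltr1n; apply: leq_trans kn; rewrite -{1}(expn0 4) ltn_exp2l.
  rewrite addrC subrK powR_expR ?(lt_trans _ n1)// divfK ?gt_eqF ?ln_gt0// lnK// posrE.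
  by apply: f_gt0; apply: leq_trans kn; rewrite leq_exp2l.
apply/cvgrPdist_le => e e0.
have e' : 0 < e * ln 4 by exact: mulr_gt0.
(* Used as slope in [ln_le_linear], [b] spends at most half of the margin [e ln 4] per unit of [k];
   [j] is then taken so large that the constant part [B] fits into the other half. *)
pose b : R := e * ln 4 / (2 * m.+1%:R).
have b0 : 0 < b by rewrite divr_gt0// mulr_gt0.
pose B := `|ln C| + m%:R * (b * 3 + b^-1).
have [j Bj] : exists j : nat, B <= e * ln 4 / 2 * j%:R.
  exists (Num.truncn (B / (e * ln 4 / 2))).+1.
  rewrite -ler_pdivrMl ?divr_gt0// mulrC; apply: ltW; exact: truncnS_gt.
exists (4 ^ (k0 + j).+1)%N => // n /= kn.
have kn0 : (4 ^ k0 <= n)%N by apply: leq_trans kn; rewrite leq_exp2l// -addnS leq_addr.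
have n0 : (0 < n)%N by apply: leq_trans kn; rewrite expn_gt0.
have /andP[ge lt] := trunc_log_bounds (isT : (1 < 4)%N) n0.
have := trunc_log_max (isT : (1 < 4)%N) kn; move: (trunc_log 4 n) ge lt => k ge lt kk.
have k0k : (k0 <= k)%N by exact: leq_trans (leq_addr _ _) (ltnW kk).
have [lo hi] : _ /\ _ := fP k n k0k (introT andP (conj ge (ltnW lt))).
have nR : 0 < (n%:R : R) by rewrite ltr0n.
have Lk : 0 < C * k.+3%:R ^+ m :> R by rewrite mulr_gt0// exprn_gt0.
have fn := f_gt0 n kn0.
have lnn : k%:R * ln 4 <= ln n%:R :> R.
  rewrite mulr_natl -lnXn// ler_ln ?posrE ?exprn_gt0//.
  by rewrite -natrX ler_nat.
have lnn0 : 0 < ln (n%:R : R).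
  by apply: lt_le_trans lnn; rewrite mulr_gt0// ltr0n; exact: leq_ltn_trans kk.
rewrite sub0r normrN.
have -> : ln (f n) / ln n%:R - s = (ln (f n) - s * ln n%:R) / ln n%:R.
  by field; rewrite gt_eqF.
rewrite normrM [X in _ * X]gtr0_norm ?invr_gt0// ler_pdivrMr//.
apply: (@le_trans _ _ (ln (C * k.+3%:R ^+ m))).
  have lnpow : ln (n%:R `^ s) = s * ln n%:R :> R by exact: ln_powR.
  rewrite ler_norml -lnpow; apply/andP; split.
    rewrite lerBrDr -lerBrDl opprK addrC -lnM ?posrE//.
    by rewrite ler_ln ?posrE ?mulr_gt0 ?powR_gt0// mulrC.
  rewrite lerBlDr -lnM ?posrE ?powR_gt0//.
  by rewrite ler_ln ?posrE ?mulr_gt0 ?powR_gt0.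
rewrite lnM ?posrE ?exprn_gt0// lnXn// -[ln _ *+ m]mulr_natl.
have kj : j%:R <= k%:R :> R.
  by rewrite ler_nat; exact: leq_trans (leq_addl _ _) (ltnW kk).
have bm : m%:R * b <= e * ln 4 / 2.
  rewrite /b mulrCA ler_pM2l// invfM mulrCA ger_pMr//.
  by rewrite ler_pdivrMr// mul1r ler_nat.
have lnk : m%:R * ln k.+3%:R <= m%:R * (b * k.+3%:R + b^-1).
  by rewrite ler_wpM2l// ln_le_linear.
apply: (@le_trans _ _ (B + m%:R * b * k%:R)).
  have -> : B + m%:R * b * k%:R = `|ln C| + m%:R * (b * k.+3%:R + b^-1).
    by rewrite /B -[k.+3%:R]natr1 -[k.+2%:R]natr1 -[k.+1%:R]natr1; ring.
  by apply: lerD lnk; exact: ler_norm.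
apply: (@le_trans _ _ (e * ln 4 / 2 * k%:R + e * ln 4 / 2 * k%:R)).
  apply: lerD; last by rewrite ler_wpM2r.
  by apply: le_trans Bj _; rewrite ler_wpM2l// divr_ge0// ltW.
apply: (@le_trans _ _ (e * (k%:R * ln 4))); last by rewrite ler_pM2l.
by rewrite le_eqVlt; apply/orP; left; apply/eqP; field.
Qed.

End Exponents.

(** The successor keeps the height [n / q + 1] positive even when [q > n]. *)
Lemma divn_succ_bounds (n q : nat) : (0 < n)%N -> (1 < q)%N -> (q <= 4 * n)%N ->
  [/\ (0 < (n %/ q).+1 <= n)%N, (n <= (n %/ q).+1 * q)%N &
      ((n %/ q).+1 * q <= 5 * n)%N].
Proof.
move=> n0 q1 qn; split.
- by rewrite ltn_Pdiv.
- by apply: ltnW; apply: ltn_ceil; exact: ltnW.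
- by rewrite mulSn (_ : 5 * n = 4 * n + n)%N ?leq_add ?leq_divM// -mulSnr.
Qed.

(** * The two bounds at the scale [4 ^ k] *)

Section GeometricScales.
Local Open Scope ereal_scope.
Variables (R : realType) (d : nat).
Hypothesis hd : (3 <= d <= 5)%N.
Variables (mu : probability nat R) (theta eta : probability (Zd d) R).
Hypothesis mu_mean : offspring_mean mu = 1.
Hypothesis mu_variance : offspring_variance mu < +oo.
Hypothesis mu_nontrivial : (mu : set nat -> \bar R) <> \d_1%N.
Hypothesis eta_irreducible : irreducible_chain (walk_kernel eta).
Hypothesis theta_symmetric : symmetric_law theta.
Hypothesis theta_irreducible : irreducible_chain (walk_kernel theta).
Hypothesis theta_moment : exponential_moment theta.
Variables (dS : measure_display) (S : measurableType dS) (Q : probability S R).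
Variables (Y : nat -> {RV Q >-> Zd d}) (hY : iid_jumps eta Y).
Variables (dT : measure_display) (T : measurableType dT) (P : probability T R).
Variables (N : vertex -> {RV P >-> nat}) (X : vertex -> {RV P >-> Zd d}).
Hypothesis hNX : igw_brw mu theta N X.

Let s : R := ((d%:R - 2) / 2)%R.

Let s_gt0 : (0 < s)%R.
Proof.
case/andP: hd => d3 _; have : (3 <= d%:R :> R)%R by rewrite (ler_nat R 3).
by rewrite /s; lra.
Qed.

Let s_lt2 : (s < 2)%R.
Proof.
case/andP: hd => _ d5; have : (d%:R <= 5 :> R)%R by rewrite (ler_nat R _ 5).
by rewrite /s; lra.
Qed.

Let d_gt1 : (1 < d)%N. Proof. by case/andP: hd => /ltnW. Qed.

Lemma green_average : exists2 C : R, (0 < C)%R & forall k,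
  \esum_(z in [set: Zd d]) (conv_power (mass_function theta) k z *
      green (mass_function eta) z) <= (C * k.+1%:R `^ (- s))%:E.
Proof.
have [C1 C1_gt0 heat1] := heat_kernel_bound eta_irreducible d_gt1.
have [C2 C2_gt0 heat2] := heat_kernel_bound theta_irreducible d_gt1.
have s0 := s_gt0.
have dE : (d%:R / 2 = 1 + s :> R)%R by rewrite /s; field.
exists ((C1 + C2) * (1 + s^-1))%R.
  by rewrite mulr_gt0 ?addr_gt0 ?invr_gt0.
move=> k; apply: green_average_le => //.
- exact: total_mass_mass_function.
- by move=> z; apply: conv_power_ge0 => y; exact: mass_function_ge0.
- by apply: total_mass_conv_power => //; exact: total_mass_mass_function.
- by rewrite addr_ge0 ?ltW.
- move=> n z; apply: le_trans (heat1 n z) _; rewrite lee_fin dE.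
  by rewrite ler_wpM2r ?powR_ge0// lerDl ltW.
- move=> z; apply: le_trans (heat2 k z) _; rewrite lee_fin dE.
  by rewrite ler_wpM2r ?powR_ge0// lerDr ltW.
Qed.

(** The shift by 2 makes [L k ^ 2] greater than 1 already at [k = 0], as [divn_succ_bounds]
    requires. *)
Let L (k : nat) : R := k.+2%:R.

Let L_gt0 k : (0 < L k)%R. Proof. exact: ltr0Sn. Qed.

Let L_sqr_le k : (k.+2 ^ 2 <= 4 * 4 ^ k)%N.
Proof.
rewrite -expnS -[4%N]/(2 ^ 2)%N -expnM mulnC expnM leq_exp2r//.
exact: ltn_expl.
Qed.

Let pow4 k : ((4 ^ k)%N%:R = (2 ^+ k) ^+ 2 :> R)%R.
Proof. by rewrite natrX -[4%:R]/((2 * 2)%N%:R) natrM -expr2 exprAC. Qed.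

(* Up to height h = n / L^2, the number of vertices has standard deviation of
   order 1 / L relatively to its mean, which makes Chebyshev summable. *)
Lemma scale_lower : exists2 c : R, (0 < c)%R &
  exists2 D : R, (0 <= D)%R & exists2 B : nat -> set T,
    forall k, measurable (B k) /\ P (B k) <= (D / L k ^+ 2)%:E &
    forall k t, ~ B k t -> forall r A, visited N X (4 ^ k) t `<=` A -> A `<=` cube r ->
      ((4 ^ k)%:R `^ s)%:E <= (c * L k ^+ 6)%:E * capacity Y A.
Proof.
have [C C_gt0 Cavg] := green_average.
have s0 := s_gt0; have s2 := s_lt2.
pose kappa := offspring_second_moment mu.
have kappa0 : (0 <= kappa)%R := offspring_second_moment_ge0 mu.
pose EC := energy_constant kappa C s.
have EC0 : (0 < EC)%R by exact: energy_constant_gt0.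
have G0 z : 0 <= green (mass_function eta) z.
  by apply: green_ge0 => y; exact: mass_function_ge0.
pose n k := (4 ^ k)%N; pose h k := (n k %/ k.+2 ^ 2).+1.
have n0 k : (0 < n k)%N by rewrite expn_gt0.
have heights k : [/\ (0 < h k <= n k)%N, (n k <= h k * k.+2 ^ 2)%N &
    (h k * k.+2 ^ 2 <= 5 * n k)%N].
  by apply: divn_succ_bounds => //; exact: (ltn_exp2l 0 2 (ltn0Sn _)).
have h_le k : (0 < h k <= n k)%N by case: (heights k).
have hn k : (n k <= h k * k.+2 ^ 2)%N by case: (heights k).
have nh k : (h k * k.+2 ^ 2 <= 5 * n k)%N by case: (heights k).
(* The Markov parameter [L k ^ 2] makes the energy bound fail with probability at most [1 / L^2]. *)
have event k := many_points hNX theta_symmetric mu_mean mu_variance G0 C_gt0 s0 s2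
  Cavg (h_le k) (exprn_gt0 2 (L_gt0 k)).
exists (64 * EC)%R; first by rewrite mulr_gt0.
exists (80 * (2 + kappa) + 1)%R; first by rewrite addr_ge0// mulr_ge0// addr_ge0.
pose B k := sval (cid2 (event k)); exists B => [k|k t].
  rewrite /B; case: cid2 => /= B' [mB' PB'] _; split => //; apply: le_trans PB' _.
  rewrite lee_fin [leRHS]mulrDl mul1r lerD2r; have nR : (0 < (n k)%:R :> R)%R by rewrite ltr0n.
  rewrite ler_pdivlMr ?exprn_gt0// mulrAC ler_pdivrMr//.
  rewrite (_ : 80 * (2 + kappa) = 16 * (2 + kappa) * 5)%R; last by ring.
  rewrite -!mulrA ler_wpM2l// ler_wpM2l ?addr_ge0//.
  by rewrite -natrX -!natrM ler_nat.
rewrite /B; case: cid2 => /= B' _ /[apply] -[pts vis [size_pts energy]] r A nA Ar.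
have E0 : (0 <= L k ^+ 2 * (EC * (n k)%:R `^ (4 - s)))%R.
  by rewrite mulr_ge0 ?sqr_ge0// mulr_ge0 ?powR_ge0// ltW.
have := capacity_ge_energy hY eta_irreducible d_gt1 Ar (fun y yp => nA _ (vis y yp)) E0 energy.
move: (capacity Y A) => cap capE.
have nR : (0 < (n k)%:R :> R)%R by rewrite ltr0n.
have Lk := L_gt0 k.
(* With this factor, [n^4 <= 16 L^4 |pts|^2] reads [n^s <= m |pts|^2]; multiplied by four times the
   energy bound it becomes [64 EC L^6]. *)
pose m : R := (16 * L k ^+ 4 / (n k)%:R `^ (4 - s))%R.
have m0 : (0 <= m)%R by rewrite divr_ge0 ?powR_ge0// mulr_ge0// exprn_ge0// ltW.
have pow0 : (0 < (n k)%:R `^ (4 - s) :> R)%R by exact: powR_gt0.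
apply: (@le_trans _ _ (m * (size pts)%:R ^+ 2)%:E).
  rewrite lee_fin /m mulrAC ler_pdivlMr// -powRD; last by apply/implyP => _; rewrite gt_eqF.
  rewrite addrC subrK (_ : (n k)%:R `^ 4 = (n k)%:R ^+ 4 :> R)%R; last by exact: (powR_mulrn 4 (ltW nR)).
  have hL : ((n k)%:R <= (h k)%:R * L k ^+ 2 :> R)%R by rewrite -natrX -natrM ler_nat.
  have n2 : ((n k)%:R ^+ 2 <= 4 * L k ^+ 2 * (size pts)%:R :> R)%R.
    apply: (@le_trans _ _ ((n k)%:R * ((h k)%:R * L k ^+ 2)))%R.
      by rewrite expr2 ler_wpM2l.
    rewrite (_ : (n k)%:R * _ = 4 * L k ^+ 2 * ((n k)%:R * (h k)%:R / 4))%R; last by field.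
    by rewrite ler_wpM2l// mulr_ge0// exprn_ge0// ltW.
  have n20 : (0 <= (n k)%:R ^+ 2 :> R)%R by rewrite exprn_ge0// ltW.
  have := ler_pM n20 n20 n2 n2.
  by rewrite -exprD => /le_trans; apply; rewrite le_eqVlt; apply/orP; left; apply/eqP; ring.
apply: (@le_trans _ _ (m%:E * ((4 * (L k ^+ 2 * (EC * (n k)%:R `^ (4 - s))))%:E * cap))).
  by rewrite EFinM lee_wpmul2l.
rewrite muleA -EFinM le_eqVlt; apply/orP; left; apply/eqP; congr (_%:E * _).
by rewrite /m; field; rewrite gt_eqF.
Qed.

(* Reaching height n L^2 has probability O(1 / L^2). Up to this height a
   displacement of sqrt n L^3 has probability exp(- c L^3 + O(L^2)), which beats
   the number of vertices. *)
Lemma scale_upper : exists2 D : R, (0 <= D)%R & exists2 B : nat -> set T,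
    forall k, measurable (B k) /\ P (B k) <= (D / L k ^+ 2)%:E &
    forall k t, ~ B k t -> visited N X (4 ^ k) t `<=` cube (k.+2 ^ 3 * 2 ^ k).
Proof.
have [l0 l0_gt0 [C C0 mgfC]] := mgf_le theta_symmetric theta_moment.
have c0 := branching_gt0 mu_mean mu_nontrivial.
(* The coefficient 8 pays for [n H L^2 <= exp (8 L)], shown below; the cubic term is the gain at
   distance [r]. *)
have [E EP] := cubic_bounded (ler0n R 8) (mulr_ge0 C0 (sqr_ge0 l0)) l0_gt0.
pose n k := (4 ^ k)%N; pose H k := (n k * k.+2 ^ 2)%N; pose r k := (k.+2 ^ 3 * 2 ^ k)%N.
have n0 k : (0 < n k)%N by rewrite expn_gt0.
have H0 k : (0 < H k)%N by rewrite muln_gt0 n0 expn_gt0.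
(* A tilt of order [1 / sqrt n]: over [n + H] steps it costs [C l0^2 (1 + L^2)], and at distance [r]
   it gains [l0 L^3]. *)
pose l k := (l0 / 2 ^+ k)%R.
have two_gt0 k : (0 < 2 ^+ k :> R)%R by exact: exprn_gt0.
have l_ge0 k : (0 <= l k)%R by rewrite divr_ge0// ltW.
have l_le k : (l k <= l0)%R by rewrite ler_pdivrMr// ler_peMr ?(ltW l0_gt0)// exprn_ege1// ler1n.
pose D := ((tail mu 1)^-1 + d.*2%:R * expR (C * l0 ^+ 2 + E))%R.
exists D; first by apply: addr_ge0; rewrite ?invr_ge0 ?tail_ge0// mulr_ge0 ?expR_ge0.
exists (fun k => survive N (n k) (H k) `|` exceed N X (n k) (H k) (r k)); last first.
  by move=> k t nB; apply: (@visited_sub_cube _ _ _ _ _ N X (n k) (H k)) => ?; apply: nB; [left|right].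
move=> k; have [mS PS] := probability_survive_le hNX mu_mean (n k) c0 (H0 k).
have mE := exceed_measurable N X (n k) (H k) (r k).
split; first exact: measurableU.
apply: le_trans (measureU2 _ mS mE) _; rewrite /D mulrDl EFinD; apply: leeD.
  apply: le_trans PS _; rewrite lee_fin /H natrM natrX le_eqVlt; apply/orP; left; apply/eqP.
  by field; rewrite !gt_eqF ?ltr0n.
have out j := conv_power_outside_cube_le mgfC j (r k) (introT andP (conj (l_ge0 k) (l_le k))).
apply: le_trans (probability_exceed_le hNX theta_symmetric (letter_mass_le1 mu_mean) _ _ C0 out) _.
rewrite lee_fin ler_pdivlMr ?exprn_gt0//.
have -> : (C * l k ^+ 2 * (n k + H k)%:R - l k * (r k)%:R =
    C * l0 ^+ 2 + (C * l0 ^+ 2 * L k ^+ 2 - l0 * L k ^+ 3))%R.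
  rewrite natrD /H /r !natrM pow4 !natrX /l -[k.+2%:R]/(L k).
  by field; rewrite gt_eqF.
set y := (C * l0 ^+ 2 * L k ^+ 2 - l0 * L k ^+ 3)%R; rewrite (expRD _ y) (expRD _ E); set x := expR y.
have big : ((n k)%:R * (H k)%:R * L k ^+ 2 <= expR (8 * L k) :> R)%R.
  have Le : (L k <= expR (L k))%R by have := expR_ge1Dx (L k); lra.
  have two : (2 <= expR 1 :> R)%R by have := expR_ge1Dx (1 : R); lra.
  have pow2 : (2 ^+ k <= expR (L k))%R.
    apply: (@le_trans _ _ (expR 1 ^+ k))%R; first by rewrite lerXn2r ?nnegrE ?expR_ge0.
    by rewrite -expRM_natl mulr1 ler_expR ler_nat; exact: leqW (leqnSn k).
  rewrite /H natrM pow4 natrX -[k.+2%:R]/(L k) expRM_natl.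
  rewrite (_ : _ * _ = (2 ^+ k) ^+ 4 * L k ^+ 4)%R; last by ring.
  rewrite (_ : 8 = 4 + 4)%N// exprD; apply: ler_pM; rewrite ?exprn_ge0 ?(ltW (L_gt0 k))//.
    by rewrite lerXn2r ?nnegrE ?expR_ge0 ?(ltW (two_gt0 k)).
  by rewrite lerXn2r ?nnegrE ?expR_ge0 ?(ltW (L_gt0 k)).
have small : (expR (8 * L k) * x <= expR E)%R.
  by rewrite -expRD ler_expR /y; have := EP (L k) (ltW (L_gt0 k)); lra.
have : ((n k)%:R * (H k)%:R * L k ^+ 2 * x <= expR E)%R.
  by apply: le_trans small; rewrite ler_wpM2r ?expR_ge0.
have d0 : (0 <= d.*2%:R * expR (C * l0 ^+ 2) :> R)%R by rewrite mulr_ge0 ?expR_ge0.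
move=> /(ler_wpM2l d0) le; rewrite [leRHS]mulrA; apply: le_trans le.
by rewrite le_eqVlt; apply/orP; left; apply/eqP; ring.
Qed.

End GeometricScales.

(** Telescoping, from [1 / (k + 2)^2 <= 1 / (k + 1) - 1 / (k + 2)]. *)
Lemma summable_inverse_squares (R : realType) (a : nat -> \bar R) (D : R) :
  (0 <= D) -> (forall k, 0 <= a k <= (D / k.+2%:R ^+ 2)%:E)%E ->
  (\sum_(k <oo) a k < +oo)%E.
Proof.
move=> D0 aD; apply: (@le_lt_trans _ _ D%:E); last exact: ltry.
apply: lime_le; first by apply: is_cvg_nneseries => k _ _; case/andP: (aD k).
apply: nearW => n; apply: (@le_trans _ _ (D * (1 - n.+1%:R^-1))%:E); last first.
  by rewrite lee_fin ler_piMr// gerBl invr_ge0.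
elim: n => [|n IH]; first by rewrite big_geq// lee_fin invr1 subrr mulr0.
rewrite big_nat_recr//=; have /andP[_ an] := aD n.
apply: le_trans (leeD IH an) _; rewrite -EFinD lee_fin -mulrDr ler_wpM2l//.
have n1 : 0 < (n.+1%:R : R) by [].
rewrite -[n.+2%:R]natr1; move: (n.+1%:R : R) n1 => x x0.
rewrite -subr_ge0 (_ : _ - _ = (x * (x + 1) ^+ 2)^-1).
  by rewrite invr_ge0 mulr_ge0 ?sqr_ge0// ltW.
by field; rewrite !gt_eqF ?addr_gt0.
Qed.

Theorem theorem1p1 (R : realType) (d : nat) (hd : (3 <= d <= 5)%N)
  (mu : probability nat R) (theta eta : probability (Zd d) R)
  (mu_mean : offspring_mean mu = 1%E)
  (mu_variance : (offspring_variance mu < +oo)%E)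
  (mu_nontrivial : (mu : set nat -> \bar R) <> \d_1%N)
  (eta_aperiodic : aperiodic_chain (walk_kernel eta))
  (eta_irreducible : irreducible_chain (walk_kernel eta))
  (eta_mean : mean_zero eta)
  (eta_moment : finite_moment d.+1 eta)
  (theta_symmetric : symmetric_law theta)
  (theta_irreducible : irreducible_chain (walk_kernel theta))
  (theta_moment : exponential_moment theta)
  (* a realization of the random walk with jump law eta *)
  (dS : measure_display) (S : measurableType dS) (Q : probability S R)
  (Y : nat -> {RV Q >-> Zd d}) (hY : iid_jumps eta Y)
  (* a realization of the branching random walk indexed by T^IGW *)
  (dT : measure_display) (T : measurableType dT) (P : probability T R)
  (N : vertex -> {RV P >-> nat}) (X : vertex -> {RV P >-> Zd d})
  (hNX : igw_brw mu theta N X) :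
  exists eps : nat -> T -> R,
    {ae P, forall w : T,
      (eps n w @[n --> \oo] --> (0 : R)) /\
      \forall n \near \oo,
        capacity Y (visited N X n w) =
          (n%:R `^ ((d%:R - 2) / 2 + eps n w))%:E}.
Proof.
have [d_ge3 d_le5] := andP hd; set s : R := (d%:R - 2) / 2.
have s0 : 0 <= s.
  by rewrite divr_ge0// subr_ge0 (ler_nat R 2); exact: ltnW.
have [c1 c1_gt0 [D1 D1_ge0 [B1 B1m B1P]]] := scale_lower hd mu_mean mu_variance
  eta_irreducible theta_symmetric theta_irreducible hY hNX.
have [D2 D2_ge0 [B2 B2m B2P]] := scale_upper mu_mean mu_nontrivial
  theta_symmetric theta_moment hNX.
have [c2 c2_gt0 capC] := capacity_cube_le hY (ltnW d_ge3) eta_mean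
  (fun i => finite_second_moment i (ltnW (ltnW d_ge3)) eta_moment).
pose B k := B1 k `|` B2 k.
have mB k : measurable (B k).
  by apply: measurableU; [case: (B1m k)|case: (B2m k)].
have PB : P (lim_sup_set B) = 0%E.
  apply: lim_sup_set_cvg0 => //.
  apply: (@summable_inverse_squares _ _ (D1 + D2)) => [|k]; first exact: addr_ge0.
  rewrite measure_ge0 mulrDl EFinD /=; have [mB1 PB1] := B1m k; have [mB2 PB2] := B2m k.
  by apply: le_trans (measureU2 _ mB1 mB2) _; exact: leeD.
(* The exponent is read off by logarithms; [fine] is faithful for large [n], where [bounds] below
   shows that the capacity is finite. *)
exists (fun n w => ln (fine (capacity Y (visited N X n w))) / ln n%:R - s).
exists (lim_sup_set B); split => //.
  by apply: bigcapT_measurable => m; apply: bigcup_measurable => j _; exact: mB.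
rewrite -setCS setCK => w nB /=.
have [k0 k0P] : exists k0, forall k, (k0 <= k)%N -> ~ B k w.
  apply: contrapT => nk; apply: nB => k0 _; apply: contrapT => nk0; apply: nk.
  by exists k0 => k k0k Bk; apply: nk0; exists k.
pose f n := fine (capacity Y (visited N X n w)).
have bounds k n : (k0 <= k)%N -> (4 ^ k <= n <= 4 ^ k.+1)%N ->
    [/\ capacity Y (visited N X n w) = (f n)%:E,
      n%:R `^ s <= (4 `^ s * (c1 + c2)) * k.+3%:R ^+ 9 * f n &
      f n <= (4 `^ s * (c1 + c2)) * k.+3%:R ^+ 9 * n%:R `^ s].
  (* Between two scales, the lower bound comes from [4 ^ k] and the upper bound from [4 ^ k.+1];
     comparing either with [n] costs a factor 4 to the power [s]. *)
  move=> k0k /andP[kn nk]; have visited_mono m m' : (m <= m')%N ->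
      visited N X m w `<=` visited N X m' w.
    by move=> mm' _ [v [vm gv] <-]; exists v => //; split => //; exact: leq_trans mm'.
  have cube_n : visited N X n w `<=` cube (k.+3 ^ 3 * 2 ^ k.+1).
    apply: subset_trans (visited_mono _ _ nk) _; apply: B2P => Bk.
    by apply: (k0P k.+1); [exact: leqW|right].
  have r0 : (0 < k.+3 ^ 3 * 2 ^ k.+1)%N by rewrite muln_gt0 !expn_gt0.
  have hi := capC _ _ r0 cube_n.
  (* [scale_lower] is stated for every set containing the points of scale [k], and so applies
     directly to the larger range at time [n]. *)
  have lo := B1P k w (fun Bk => k0P k k0k (or_introl Bk)) _ _ (visited_mono _ _ kn) cube_n.
  have cap0 : (0 <= capacity Y (visited N X n w))%E by apply: esum_ge0.
  have capE : capacity Y (visited N X n w) = (f n)%:E.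
    by rewrite /f fineK// ge0_fin_numE//; exact: le_lt_trans hi (ltry _).
  move: cap0 lo hi; rewrite capE -EFinM !lee_fin => f0 lo hi.
  have L1 : 1 <= (k.+3%:R : R) by rewrite ler1n.
  split => //.
    apply: (@le_trans _ _ (4 `^ s * (4 ^ k)%:R `^ s)).
      by rewrite -powRM// ge0_ler_powR ?nnegrE// -natrM ler_nat -expnS.
    rewrite -[4 `^ s * (c1 + c2) * _]mulrA -[leRHS]mulrA ler_wpM2l ?powR_ge0//.
    apply: le_trans lo _; rewrite ler_wpM2r//; apply: ler_pM; rewrite ?exprn_ge0 ?(ltW c1_gt0)//.
      by rewrite lerDl ltW.
    apply: (@le_trans _ _ (k.+3%:R ^+ 6)); last by rewrite ler_weXn2l.
    by rewrite lerXn2r ?nnegrE// ler_nat.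
  apply: le_trans hi _.
  have pow2 : (2 ^ k.+1)%:R ^+ (d - 2) = (4 ^ k.+1)%:R `^ s :> R.
    have -> : (4 ^ k.+1)%:R = (2 ^ k.+1)%:R `^ 2 :> R.
      by rewrite (powR_mulrn 2)// -natrX -expnM mulnC expnM.
    rewrite -powRrM -powR_mulrn// natrB 1?ltnW//; congr (_ `^ _).
    by rewrite /s; field.
  rewrite natrM exprMn pow2 natrX -exprM.
  apply: (@le_trans _ _ (c2 * (k.+3%:R ^+ 9 * (4 `^ s * n%:R `^ s)))).
    rewrite ler_wpM2l ?(ltW c2_gt0)//; apply: ler_pM; rewrite ?exprn_ge0 ?powR_ge0//.
      (* The logarithmic factor [k.+3 ^ 3] of the side is raised to the power [d - 2 <= 3], whence
         the exponent 9. *)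
      by rewrite ler_weXn2l// (@leq_mul 3 _ 3 3)// leq_subLR.
    rewrite -powRM// ge0_ler_powR ?nnegrE// -natrM ler_nat expnS.
    by rewrite leq_mul2l kn.
  rewrite (_ : c2 * _ = 4 `^ s * c2 * k.+3%:R ^+ 9 * n%:R `^ s); last by ring.
  rewrite ler_wpM2r ?powR_ge0// ler_wpM2r ?exprn_ge0// ler_wpM2l ?powR_ge0//.
  by rewrite lerDr ltW.
have C_gt0 : 0 < 4 `^ s * (c1 + c2) by rewrite mulr_gt0 ?powR_gt0 ?addr_gt0.
have [lim nearE] := @polylog_exponent R s _ 9 k0 f C_gt0 (fun k n kk kn =>
  let: And3 _ lo hi := bounds k n kk kn in conj lo hi).
split => //; have [n0 _ n0P] := nearE.
exists (maxn n0 (4 ^ k0)) => // n /=; rewrite geq_max => /andP[n0n kn].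
have n_gt0 : (0 < n)%N by apply: leq_trans kn; rewrite expn_gt0.
have /andP[ge lt] := trunc_log_bounds (isT : (1 < 4)%N) n_gt0.
have [-> _ _] := bounds _ n (trunc_log_max (isT : (1 < 4)%N) kn)
  (introT andP (conj ge (ltnW lt))).
by congr EFin; exact: n0P.
Qed.
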